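(* Let $p\in(2,3)$ and, for $\lambda>0$, let $I_\lambda:H^1(\mathbb{R}^3)\to\mathbb{R}$ be $$I_\lambda(u)=\frac12\int_{\mathbb{R}^3}\left(|\nabla u|^2+u^2\right)dx+\frac{\lambda}{4}\int_{\mathbb{R}^3}\int_{\mathbb{R}^3}\frac{u^2(x)u^2(y)}{|x-y|}\,dx\,dy-\frac1p\int_{\mathbb{R}^3}|u|^p\,dx .$$ Then there exists $\lambda_0>0$ such that $\inf_{H^1(\mathbb{R}^3)} I_\lambda=0$ for all $\lambda\ge\lambda_0$ and $\inf_{H^1(\mathbb{R}^3)} I_\lambda=-\infty$ for all $\lambda\in(0,\lambda_0)$.
   Context: $H^1(\mathbb{R}^3)$ is the usual Sobolev space (no radial symmetry is imposed). *)

(* Defs.v *)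
From HB Require Import structures.
From mathcomp Require Import all_boot all_order all_algebra.
From mathcomp Require Import all_classical all_reals all_analysis.

Set Implicit Arguments.
Unset Strict Implicit.
Unset Printing Implicit Defensive.

Import Order.TTheory GRing.Theory Num.Theory.
Import numFieldNormedType.Exports.

Local Open Scope classical_set_scope.
Local Open Scope ring_scope.

Notation R3 R := (R * R * R)%type.

Section SobolevR3.
Variable R : realType.
Implicit Types (u g phi : R3 R -> R) (x y : R3 R) (i : 'I_3).

Definition leb3 : {measure
    set (measurableTypeR R * measurableTypeR R * measurableTypeR R)%type
    -> \bar R} :=
  ((@lebesgue_measure R \x @lebesgue_measure R) \x @lebesgue_measure R)%E.

(* The library norm on a product type is the max norm, hence this one. *)
Definition norm3 x : R := Num.sqrt (x.1.1 ^+ 2 + x.1.2 ^+ 2 + x.2 ^+ 2).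

Definition basis3 i : R3 R :=
  ((i == 0 :> nat)%:R, (i == 1 :> nat)%:R, (i == 2 :> nat)%:R).

Definition partial i phi : R3 R -> R := fun x => 'D_(basis3 i) phi x.

(* [s] ranges over all lists of directions, hence over all orders of
   differentiation: this is C^oo. *)
Definition smooth phi : Prop :=
  forall s : seq 'I_3, let psi := foldr partial phi s in
    continuous psi /\ forall i x, derivable psi x (basis3 i).

Definition test_function phi : Prop :=
  smooth phi /\ compact (closure [set x | phi x != 0]).

Definition is_weak_partial i u g : Prop :=
  forall phi, test_function phi ->
    \int[leb3]_x (u x * partial i phi x) = - \int[leb3]_x (g x * phi x).

Definition H1_R3 : set (R3 R -> R) :=
  [set u | u \in Lfun leb3 2%:E /\
    forall i, exists2 g, g \in Lfun leb3 2%:E & is_weak_partial i u g].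

(* Weak derivatives are only unique almost everywhere: this picks one square
   integrable representative (and is 0 if there is none). *)
Definition weak_partial i u : R3 R -> R :=
  xget (cst 0) [set g | g \in Lfun leb3 2%:E /\ is_weak_partial i u g].

Definition weak_grad_sqr u x : R := \sum_(i < 3) weak_partial i u x ^+ 2.

(* The double integral is computed in [0, +oo] and is finite on H^1(R^3), as is
   the integral of |u|^p for 2 <= p <= 6, so that taking real values below
   loses nothing. The inverse of 0 is 0, on the (negligible) diagonal. *)
Definition coulomb u : R :=
  fine (\int[leb3]_y \int[leb3]_x
    ((u x ^+ 2 * u y ^+ 2) / norm3 (x - y))%:E)%E.

Definition I_functional (p lambda : R) u : R :=
  2^-1 * \int[leb3]_x (weak_grad_sqr u x + u x ^+ 2)
  + lambda / 4 * coulomb u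
  - p^-1 * \int[leb3]_x (`|u x| `^ p).

End SobolevR3.

Arguments H1_R3 : clear implicits.

(* Main.v *)
Require Import Defs.
From HB Require Import structures.
From mathcomp Require Import all_boot all_order all_algebra.
From mathcomp Require Import all_classical all_reals all_analysis.
From mathcomp Require Import ring lra.
From mathcomp Require Import measurable_realfun.
Set Implicit Arguments.
Unset Strict Implicit.
Unset Printing Implicit Defensive.
Import Order.TTheory GRing.Theory Num.Theory.
Import numFieldNormedType.Exports.
Local Open Scope classical_set_scope.
Local Open Scope ring_scope.

(** For a fixed function the functional increases with the coupling, so that the
    couplings for which it takes a negative value form an interval starting at
    0, and lambda0 is its right end. Three facts have to be proved: this interval
    is not empty, it is bounded, and a negative value can be amplified to
    arbitrarily negative ones.

    It is not empty because p > 2: a large multiple of a bump makes the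
    functional without Coulomb term negative ([energy_neg_ex]). A negative
    value can be amplified because nothing confines the mass: after cutting
    off, one adds a second copy far away. The Coulomb repulsion between the
    copies is of the order of the inverse distance, all other terms double, and
    this can be iterated ([doubling], [unbounded]).

    The boundedness is where p < 3 enters. As |s|^p / p is at most
    s^2 / 4 + M |s|^3, it suffices to bound the cubic integral by a small
    multiple of the squared norm in H^1 plus a large multiple of the Coulomb
    energy D(u). This is [coulomb_cube]: for all t > 0,

      int |u|^3 <= C t (int |grad u|^2 + int u^2 + (C' / t^2) D(u)).

    One classical proof solves the Poisson equation with right hand side u^2.
    The proof below is elementary. The space is cut into boxes of edges
    (rho^2 l, rho l, l) with rho^3 = 2, which are halved into boxes of the same
    shape. On a box with l int u^2 <= t^2 one compares u with its averages over
    smaller and smaller boxes. By a Poincare inequality ([half_diff]) each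
    bisection increases the cubic integral of the averages by a controlled
    amount, and the increases form a convergent geometric series
    ([avg_cube_good]). A box on which u has too much mass is halved, and the
    loss is paid by its Coulomb energy, which is at least of the order of
    (int u^2)^2 / l and exceeds the sum of those of the halves by their
    interaction ([stopping]). The averages converge to u almost everywhere ([cube_box]),
    and Fatou's lemma gives the estimate.

    Two side issues need care. The Coulomb energy is defined as the finite part
    of an extended integral, hence it has to be shown finite on H^1. This
    follows from the cube integrability of u, obtained from the same argument
    at a level t so large that no box of size 1 has to be halved
    ([H1p_cube_integ], [coulomb_density_integ]). And the functional uses a
    chosen weak gradient, which is compared with any other one by the
    fundamental lemma of the calculus of variations ([fundamental_lemma],
    [H1p_energy]). *)

(** * Lebesgue measure on the space: Borel sets, boxes, translations *)

Section LebesgueR3.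
Variable R : realType.
Notation RR := (measurableTypeR R).
Notation mu := (@lebesgue_measure R).
Notation LL := (@leb3 R).

Lemma leb3_setX (A B C : set RR) : measurable A -> measurable B -> measurable C -> LL (A `*` B `*` C) = (mu A * mu B * mu C)%E.
Proof.
move=> mA mB mC.
rewrite [LHS]product_measure1E//; last exact: measurableX.
by congr (_ * _)%E; rewrite [LHS]product_measure1E.
Qed.

Lemma leb3_sigma_finite : sigma_finite setT LL.
Proof.
exists (fun n => `[- n%:R, n%:R] `*` `[- n%:R, n%:R] `*` `[- n%:R, n%:R]).
  rewrite predeqE => -[[x y] z]; split => // _.
  pose M := Num.max `|x| (Num.max `|y| `|z|).
  have [n _ Hn] : exists2 n, True & M <= n%:R.
    by exists (Num.truncn M).+1 => //; rewrite ltW// Num.Theory.truncnS_gt.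
  exists n => //=; rewrite !in_itv/= -!ler_norml.
  by move: Hn; rewrite !ge_max => /and3P[-> -> ->].
move=> k; split; first by do 2 ?apply: measurableX; exact: measurable_itv.
rewrite leb3_setX; try exact: measurable_itv.
by rewrite !lebesgue_measure_itv/= lte_fin; case: ifPn => _; rewrite ?mul0e// -!EFinD -!EFinM ltry.
Qed.

(** The product measure again, packed with its sigma-finiteness: Tonelli's
    theorem is stated for such measures. *)
Definition leb3s : {sigma_finite_measure set (RR * RR * RR)%type -> \bar R} :=
  HB.pack (LL : set (RR * RR * RR) -> \bar R) (Measure.on LL) (Measure_isSigmaFinite.Build _ _ _ LL leb3_sigma_finite).
Lemma measurable_c1 : measurable_fun [set: RR * RR * RR] (fun x => x.1.1).
Proof. exact: (measurableT_comp measurable_fst measurable_fst). Qed.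
Lemma measurable_c2 : measurable_fun [set: RR * RR * RR] (fun x => x.1.2).
Proof. exact: (measurableT_comp measurable_snd measurable_fst). Qed.
Lemma measurable_c3 : measurable_fun [set: RR * RR * RR] (fun x => x.2).
Proof. exact: measurable_snd. Qed.

Lemma ball3P (x y : R3 R) (e : R) : ball x e y <-> [/\ `|x.1.1 - y.1.1| < e, `|x.1.2 - y.1.2| < e & `|x.2 - y.2| < e].
Proof.
split; first by move=> [[? ?] ?].
by move=> [? ? ?]; split => //; split.
Qed.

Lemma rat_approx (x e : R) : 0 < e -> exists q : rat, `|ratr q - x| < e.
Proof.
move=> e0; have [q] := @rat_in_itvoo R (x - e) (x + e) ltac:(lra).
by rewrite in_itv/= => /andP[q1 q2]; exists q; rewrite ltr_distl q1 q2.
Qed.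

(** The Borel sets of a product are a priori more numerous than the product
    sigma-algebra. Here they agree, because an open set is the union of the
    countably many rational cubes that it contains. *)
Lemma open3_measurable (U : set (R3 R)) : open U -> measurable (U : set (RR * RR * RR)).
Proof.
move=> oU.
pose B (q : rat * rat * rat * rat) : set (RR * RR * RR) :=
  ball (ratr q.1.1.1 : RR) (ratr q.2 : R) `*` ball (ratr q.1.1.2 : RR) (ratr q.2 : R) `*`
  ball (ratr q.1.2 : RR) (ratr q.2 : R).
have mB q : measurable (B q).
  by apply: measurableX; [apply: measurableX|]; exact: measurable_ball.
have -> : U = \bigcup_q (if `[< B q `<=` U >] then B q else set0).
  apply/seteqP; split; last by move=> x [q _]; case: asboolP => // BU /BU.
  move=> x Ux; have /nbhs_ballP[e /= e0 xeU] := open_nbhs_nbhs (conj oU Ux).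
  have [r] := @rat_in_itvoo R 0 (e / 2) ltac:(lra).
  rewrite in_itv/= => /andP[r0 re].
  have [q1 h1] := rat_approx x.1.1 r0.
  have [q2 h2] := rat_approx x.1.2 r0.
  have [q3 h3] := rat_approx x.2 r0.
  exists (q1, q2, q3, r) => //.
  case: asboolP => [_|[]]; first by split => //; split.
  move=> y [[/= y1 y2] y3]; apply: xeU; apply/ball3P.
  move: h1 h2 h3 y1 y2 y3; rewrite /ball/= !ltr_distl.
  have tri (a q b : R) : a - ratr r < q < a + ratr r -> b - ratr r < q < b + ratr r -> b - e < a < b + e.
    by move: (ratr r) re => t te /andP[? ?] /andP[? ?]; apply/andP; split; lra.
  by move=> a1 a2 a3 b1 b2 b3; split; [exact: tri a1 b1|exact: tri a2 b2|exact: tri a3 b3].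
apply: countable_bigcupT_measurable; first exact: countableP.
by move=> q; case: ifP.
Qed.

Lemma continuous3_measurable (f : R3 R -> R) : continuous f -> measurable_fun [set: RR * RR * RR] f.
Proof.
move=> /continuousP cf; apply: (measurability _ (RGenOpens.measurableE R)).
move=> _ [_ [a [b ->] <-]]; rewrite setTI; apply: open3_measurable.
exact/cf/interval_open.
Qed.

Definition tr3 (v x : R3 R) : R3 R := x + v.

Lemma measurable_tr3 (v : R3 R) : measurable_fun [set: RR * RR * RR] (tr3 v : RR * RR * RR -> RR * RR * RR).
Proof.
apply/measurable_fun_pairP; split => /=; first (apply/measurable_fun_pairP; split => /=).
- by apply: (@measurable_funD _ _ _ _ (fun x : RR * RR * RR => x.1.1 : R) (cst v.1.1)) => //; exact: measurable_c1.
- by apply: (@measurable_funD _ _ _ _ (fun x : RR * RR * RR => x.1.2 : R) (cst v.1.2)) => //; exact: measurable_c2.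
- by apply: (@measurable_funD _ _ _ _ (fun x : RR * RR * RR => x.2 : R) (cst v.2)) => //; exact: measurable_c3.
Qed.

Definition obox3 : set (set (R3 R)) :=
  [set B | exists a b : R3 R, B = `]a.1.1, b.1.1]%classic `*` `]a.1.2, b.1.2]%classic `*` `]a.2, b.2]%classic].

Lemma obox3I : setI_closed obox3.
Proof.
move=> _ _ [a [b ->]] [c [d ->]].
exists (Num.max a.1.1 c.1.1, Num.max a.1.2 c.1.2, Num.max a.2 c.2).
exists (Num.min b.1.1 d.1.1, Num.min b.1.2 d.1.2, Num.min b.2 d.2).
apply/seteqP; split => [x|x] /=; rewrite !in_itv/= !gt_max !le_min.
  by move=> [[[/andP[-> ->] /andP[-> ->]] /andP[-> ->]] [[/andP[-> ->] /andP[-> ->]] /andP[-> ->]]].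
by move=> [[/andP[/andP[-> ->] /andP[-> ->]] /andP[/andP[-> ->] /andP[-> ->]]] /andP[/andP[-> ->] /andP[-> ->]]].
Qed.

Lemma obox3_exhaust (x : R3 R) : exists n : nat, (`]- n%:R, n%:R] `*` `]- n%:R, n%:R] `*` `]- n%:R, n%:R]) x.
Proof.
pose M := Num.max `|x.1.1| (Num.max `|x.1.2| `|x.2|).
have [n _ Hn] : exists2 n, True & M < n%:R.
  by exists (Num.truncn M).+1 => //; rewrite Num.Theory.truncnS_gt.
exists n => //=; rewrite !in_itv/=; move: Hn; rewrite !gt_max !ltr_norml.
by move=> /and3P[/andP[-> /ltW ->] /andP[-> /ltW ->] /andP[-> /ltW ->]].
Qed.

Lemma obox3_gen : measurable = <<s obox3 >> :> set (set (RR * RR * RR)).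
Proof.
apply/seteqP; split; last first.
  apply: smallest_sub; first exact: sigma_algebra_measurable.
  move=> _ [a [b ->]]; apply: measurableX; [apply: measurableX|]; exact: measurable_itv.
pose T := g_sigma_algebraType obox3.
have mO (B : set T) : obox3 B -> measurable B by exact: sub_sigma_algebra.
have gen (f : T -> RR) : (forall a b, measurable [set x | f x \in `]a, b] ]) -> measurable_fun setT f.
  move=> mf; apply: (@measurability _ _ _ _ setT f (R.-ocitv.-measurable)) => //.
  by move=> _ [_ [[a b] _ <-] <-]; rewrite setTI; exact: mf.
have m1 : measurable_fun [set: T] (fun x : T => x.1.1 : RR).
  apply: gen => a b.
  rewrite (_ : [set x | _] = \bigcup_n ((`]a, b] `*` `]- n%:R, n%:R] `*` `]- n%:R, n%:R]) : set T)); last first.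
    apply/seteqP; split => [x /= xab|x [n _] [[]]//].
    by have [n [[_ h2] h3]] := obox3_exhaust x; exists n.
  by apply: bigcupT_measurable => n; apply: mO; exists (a, - n%:R, - n%:R), (b, n%:R, n%:R).
have m2 : measurable_fun [set: T] (fun x : T => x.1.2 : RR).
  apply: gen => a b.
  rewrite (_ : [set x | _] = \bigcup_n ((`]- n%:R, n%:R] `*` `]a, b] `*` `]- n%:R, n%:R]) : set T)); last first.
    apply/seteqP; split => [x /= xab|x [n _] [[]]//].
    by have [n [[h2 _] h3]] := obox3_exhaust x; exists n.
  by apply: bigcupT_measurable => n; apply: mO; exists (- n%:R, a, - n%:R), (n%:R, b, n%:R).
have m3 : measurable_fun [set: T] (fun x : T => x.2 : RR).
  apply: gen => a b.
  rewrite (_ : [set x | _] = \bigcup_n ((`]- n%:R, n%:R] `*` `]- n%:R, n%:R] `*` `]a, b]) : set T)); last first.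
    apply/seteqP; split => [x /= xab|x [n _] []//].
    by have [n [[h1 h2] h3]] := obox3_exhaust x; exists n.
  by apply: bigcupT_measurable => n; apply: mO; exists (- n%:R, - n%:R, a), (n%:R, n%:R, b).
have mid : measurable_fun [set: T] (fun x : T => (x.1.1, x.1.2, x.2) : RR * RR * RR).
  by apply: measurable_fun_pair => //; apply: measurable_fun_pair.
move=> A mA; have := mid measurableT A mA.
rewrite setTI (_ : _ @^-1` _ = A)//.
by apply/seteqP; split => -[[? ?] ?].
Qed.

(** Half-open boxes are stable under intersection, generate the measurable
    sets and exhaust the space. *)
Lemma measure3_unique (m1 m2 : {measure set (RR * RR * RR) -> \bar R}) :
  (forall B, obox3 B -> m1 B = m2 B) -> (forall B, obox3 B -> m1 B < +oo)%E ->
  forall A, measurable A -> m1 A = m2 A.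
Proof.
move=> m12 m1oo; pose I n : set (R3 R) := `]- n%:R, n%:R] `*` `]- n%:R, n%:R] `*` `]- n%:R, n%:R].
have oI n : obox3 (I n) by exists (- n%:R, - n%:R, - n%:R), (n%:R, n%:R, n%:R).
have cov : \bigcup_k I k = setT.
  by apply/seteqP; split => // x _; have [n h] := obox3_exhaust x; exists n.
move=> A mA; apply: (@measure_unique _ R (RR * RR * RR)%type obox3 I obox3_gen obox3I oI cov m1 m2 m12 _ A mA).
by move=> k; exact: m1oo.
Qed.

Lemma obox3_lty B : obox3 B -> (LL B < +oo)%E.
Proof.
move=> [a [b ->]]; rewrite leb3_setX; try exact: measurable_itv.
rewrite !lebesgue_measure_itv/=.
by case: ifP => _; case: ifP => _; case: ifP => _; rewrite ?mul0e ?mule0 -?EFinB -?EFinM ?ltry.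
Qed.

(** A translation maps boxes to boxes of the same volume, and boxes determine
    a measure. *)
Lemma leb3_translation (v : R3 R) (A : set (RR * RR * RR)) : measurable A -> LL (tr3 v @^-1` A) = LL A.
Proof.
move=> mA.
pose m := isMeasurableFun.Build _ _ _ _ _ (@measurable_tr3 v).
pose f : {mfun (RR * RR * RR)%type >-> (RR * RR * RR)%type} := HB.pack (tr3 v : RR * RR * RR -> RR * RR * RR) m.
have E (a b : R3 R) : tr3 v @^-1` (`]a.1.1, b.1.1]%classic `*` `]a.1.2, b.1.2]%classic `*` `]a.2, b.2]%classic) =
  `](a - v).1.1, (b - v).1.1]%classic `*` `](a - v).1.2, (b - v).1.2]%classic `*` `](a - v).2, (b - v).2]%classic.
  by apply/seteqP; split => x /=; rewrite !in_itv/= !ltrBlDr !lerBrDr.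
rewrite -[LHS]/(pushforward LL f A).
apply: (@measure3_unique (pushforward LL f) LL); last exact: mA.
  move=> _ [a [b ->]]; set B := (X in LL X); rewrite -[LHS]/(LL (tr3 v @^-1` B)) /B {B} E.
  rewrite !leb3_setX; try exact: measurable_itv.
  rewrite !lebesgue_measure_itv/= !lte_fin !ltrD2r -!EFinB.
  have sub (x y z : R) : x - z - (y - z) = x - y by ring.
  by rewrite !sub.
have H B : obox3 B -> (LL (tr3 v @^-1` B) < +oo)%E.
  by move=> [a [b ->]]; rewrite E; apply: obox3_lty; exists (a - v), (b - v).
exact: H.
Qed.

Lemma ge0_integral_tr3 (v : R3 R) (f : R3 R -> \bar R) :
  measurable_fun [set: RR * RR * RR] f -> (forall x, 0 <= f x)%E ->
  (\int[LL]_x f ((x : R3 R) + v)%R = \int[LL]_x f x)%E.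
Proof.
move=> mf f0.
pose m := isMeasurableFun.Build _ _ _ _ _ (@measurable_tr3 v).
pose g : {mfun (RR * RR * RR)%type >-> (RR * RR * RR)%type} := HB.pack (tr3 v : RR * RR * RR -> RR * RR * RR) m.
rewrite -[RHS](@eq_measure_integral _ _ _ _ LL (pushforward LL g)); last first.
  by move=> A mA _; exact: leb3_translation.
by rewrite ge0_integral_pushforward.
Qed.

Lemma integral_tr3 (v : R3 R) (f : R3 R -> \bar R) :
  measurable_fun [set: RR * RR * RR] f -> (\int[LL]_x f ((x : R3 R) + v)%R = \int[LL]_x f x)%E.
Proof.
move=> mf; rewrite integralE [RHS]integralE.
congr (_ - _)%E.
- rewrite -(@ge0_integral_tr3 v (f^\+)%E (measurable_funepos mf) (funepos_ge0 f)).
  by apply: eq_integral => x _; rewrite !funeposE.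
- rewrite -(@ge0_integral_tr3 v (f^\-)%E (measurable_funeneg mf) (funeneg_ge0 f)).
  by apply: eq_integral => x _; rewrite !funenegE.
Qed.

Lemma Rintegral_tr3 (v : R3 R) (f : R3 R -> R) :
  measurable_fun [set: RR * RR * RR] f -> \int[LL]_x f ((x : R3 R) + v) = \int[LL]_x f x.
Proof.
move=> mf; rewrite /Rintegral; congr fine.
by rewrite -(@integral_tr3 v (EFin \o f))//; exact/measurable_EFinP.
Qed.

Lemma integrable_tr3 (v : R3 R) (f : R3 R -> \bar R) :
  LL.-integrable setT f -> LL.-integrable setT (fun x : RR * RR * RR => f ((x : R3 R) + v)).
Proof.
move=> /integrableP[mf fi]; apply/integrableP; split.
  by apply: measurableT_comp => //; exact: measurable_tr3.
rewrite -[X in (X < _)%E](ge0_integral_tr3 v) in fi => //.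
by apply: measurableT_comp.
Qed.

End LebesgueR3.

(** * Smooth steps and ramps on the line *)

Section SmoothSteps.
Variable R : realType.
Notation mu := (@lebesgue_measure R).

(** Smoothness is witnessed by the sequence of all derivatives. Exhibiting such
    a sequence is easier than iterating a derivation operator. *)
Definition csmooth (f : R -> R) := exists F : nat -> R -> R, F 0%N = f /\
  forall n (x : R), is_derive x (1 : R) (F n) (F n.+1 x).

Lemma pow_expRN_le (n : nat) (y : R) : 0 < y -> y ^+ n * expR (- y) <= n`!%:R.
Proof.
move=> y0; case: n => [|n]; first by rewrite mul1r fact0 expRN invf_le1 ?expR_gt0// -expR0 ler_expR ltW.
rewrite expRN ler_pdivrMr ?expR_gt0//.
have := @expR_ge1Dxn R y n (ltW y0) => H.
have f0 : (0 : R) < (n.+1)`!%:R by rewrite ltr0n fact_gt0.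
rewrite mulrC -ler_pdivrMr//; apply: le_trans H; lra.
Qed.

Lemma horner_expRN_le (p : {poly R}) : exists2 C : R, 0 <= C & forall y, 0 < y -> `|p.[y]| * expR (- y) <= C.
Proof.
exists (\sum_(i < size p) `|p`_i| * i`!%:R); first by apply: sumr_ge0 => i _; rewrite mulr_ge0.
move=> y y0; rewrite horner_coef.
apply: (@le_trans _ _ (\sum_(i < size p) (`|p`_i| * y ^+ i) * expR (- y))).
  rewrite -mulr_suml ler_wpM2r ?expR_ge0//.
  apply: (le_trans (ler_norm_sum _ _ _)).
  by apply: ler_sum => i _; rewrite normrM normrX (gtr0_norm y0).
apply: ler_sum => i _; rewrite -mulrA ler_wpM2l//; exact: pow_expRN_le.
Qed.

(** The functions [p(1/x) exp(-1/x)], extended by 0, are closed under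
    derivation, and for [p = 1] this is the classical smooth function which
    vanishes exactly on the nonpositive numbers. *)
Definition flat (p : {poly R}) (x : R) : R := if 0 < x then p.[x^-1] * expR (- x^-1) else 0.

(** Exponential decay beats any polynomial in [1/x]. The quadratic bound gives
    the derivative at 0. *)
Lemma flat_le (p : {poly R}) : exists2 C : R, 0 <= C & forall x, `|flat p x| <= C * x ^+ 2.
Proof.
have [C C0 HC] := horner_expRN_le ('X ^+ 2 * p).
exists C => // x; rewrite /flat; case: ifPn => [x0|_]; last by rewrite normr0 mulr_ge0// sqr_ge0.
have := HC x^-1; rewrite invr_gt0 => /(_ x0).
rewrite hornerM hornerXn normrM exprVn => H.
rewrite normrM (ger0_norm (expR_ge0 _)) mulrC.
have x2 : 0 < x ^+ 2 by rewrite exprn_gt0.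
rewrite ger0_norm ?invr_ge0 ?(ltW x2)// -mulrA mulrC in H.
by rewrite -ler_pdivrMr// (mulrC (expR _)).
Qed.

Lemma is_derive_sqr_bound (f : R -> R) (C : R) : f 0 = 0 -> (forall x, `|f x| <= C * x ^+ 2) -> is_derive (0 : R) (1 : R) f 0.
Proof.
move=> f0 fC.
have cv : (fun h : R => h^-1 *: ((f \o shift 0) (h *: 1) - f 0)) @ 0^' --> (0 : R).
  apply/cvgr0Pnorm_le => /= e e0.
  near=> h.
  have h0 : h != 0 by near: h; exact: nbhs_dnbhs_neq.
  rewrite /= f0 addr0 subr0 /GRing.scale/= mulr1 normrM normfV.
  rewrite -ler_pdivlMl ?invr_gt0 ?normr_gt0// invrK.
  apply: (le_trans (fC h)).
  have -> : C * h ^+ 2 = `|h| * (C * `|h|) by rewrite -(real_normK (num_real h)); ring.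
  rewrite ler_wpM2l//.
  have : `|h| <= e / (`|C| + 1).
    near: h; apply: nbhs_dnbhs; apply: (@nbhs0_le _ R^o); rewrite divr_gt0// ltr_wpDl//.
  rewrite ler_pdivlMr ?ltr_wpDl// => H.
  apply: le_trans H; rewrite mulrC ler_wpM2l//; have := ler_norm C; lra.
by apply: DeriveDef; [apply/cvg_ex; exists 0|apply: cvg_lim].
Unshelve. all: by end_near. Qed.

Lemma flat_derive (p : {poly R}) (x : R) : is_derive x (1 : R) (flat p) (flat ('X ^+ 2 * (p - p^`())) x).
Proof.
have [x0|x0|x0] := ltgtP x 0.
- rewrite {2}/flat ltNge (ltW x0)/=.
  apply: (@near_eq_is_derive _ _ _ (cst 0)) => //.
  by near=> y; rewrite /flat ltNge ltW//; near: y; exact: lt_nbhsl.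
- apply: (@near_eq_is_derive R R^o R^o (fun y : R => p.[y^-1] * expR (- y^-1) : R) (flat p)) => //.
    by near=> y; rewrite /flat ifT//; near: y; exact: lt_nbhsr.
  rewrite /flat x0.
  have xn : x != 0 by rewrite gt_eqF.
  have d1 : is_derive x (1 : R) (fun y : R => y^-1) (- x ^- 2).
    by have := @is_deriveV R id x 1 1 xn (is_derive_id _ _); rewrite /GRing.scale/= mulr1.
  have d2 : is_derive x (1 : R) (fun y : R => p.[y^-1]) ((p^`()).[x^-1] * (- x ^- 2)).
    exact: (@is_derive1_comp R (horner p) (fun y => y^-1)).
  have d3 : is_derive x (1 : R) (fun y : R => expR (- y^-1)) (expR (- x^-1) * (x ^- 2)).
    apply: (@is_derive1_comp R expR (fun y => - y^-1)).
    by rewrite -[x ^- 2]opprK; exact: is_deriveN.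
  set r := (X in is_derive _ _ _ X).
  have -> : r = p.[x^-1] * (expR (- x^-1) / x ^+ 2) + expR (- x^-1) * (p^`().[x^-1] * - x ^- 2).
    by rewrite /r hornerM hornerXn hornerD hornerN exprVn; ring.
  exact: (is_deriveM d2 d3).
- rewrite x0 {2}/flat ltxx; have [C C0 HC] := flat_le p.
  by apply: (is_derive_sqr_bound _ HC); rewrite /flat ltxx.
Unshelve. all: by end_near. Qed.

Lemma csmooth_flat p : csmooth (flat p).
Proof.
exists (fun n => flat (iter n (fun q => 'X ^+ 2 * (q - q^`())) p)); split => // n x.
exact: flat_derive.
Qed.

(** A class of functions that is closed under derivation consists of smooth
    functions: choose successive derivatives inside the class. *)
Lemma csmooth_coind (P : (R -> R) -> Prop) :
  (forall f, P f -> exists2 g, P g & forall x : R, is_derive x (1 : R) f (g x)) -> forall f, P f -> csmooth f.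
Proof.
move=> HP f Pf.
have HP' (s : {h : R -> R | P h}) : {t : {h : R -> R | P h} | forall x : R, is_derive x (1 : R) (sval s) (sval t x)}.
  by apply: cid; case: (HP _ (svalP s)) => g Pg Hg; exists (exist _ g Pg).
exists (fun n => sval (iter n (fun s => sval (HP' s)) (exist _ f Pf))); split => // n x.
exact: (svalP (HP' _)).
Qed.

Lemma csmooth_derive f : csmooth f -> exists2 g, csmooth g & forall x : R, is_derive x (1 : R) f (g x).
Proof.
move=> [F [F0 HF]]; exists (F 1%N).
  by exists (fun n => F n.+1); split => // n x; exact: HF.
by move=> x; rewrite -F0; exact: HF.
Qed.

Lemma csmooth_prim (f g : R -> R) : csmooth g -> (forall x : R, is_derive x (1 : R) f (g x)) -> csmooth f.
Proof.
move=> [F [F0 HF]] fg; exists (fun n => if n is m.+1 then F m else f); split => // -[|n] x //=.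
by rewrite F0; exact: fg.
Qed.

(** Closing the smooth functions under the algebraic operations gives a class
    to which [csmooth_coind] applies, which proves the Leibniz rule at all
    orders without any binomial formula. *)
Inductive calg : (R -> R) -> Prop :=
| calg_base f : csmooth f -> calg f
| calg_cst c : calg (fun=> c)
| calg_add f g : calg f -> calg g -> calg (fun x => f x + g x)
| calg_mul f g : calg f -> calg g -> calg (fun x => f x * g x)
| calg_aff f a b : calg f -> calg (fun x => f (a * x + b)).

Lemma calg_csmooth f : calg f -> csmooth f.
Proof.
apply: csmooth_coind; move=> {}f; elim => {f}.
- by move=> f /csmooth_derive[g gs fg]; exists g => //; exact: calg_base.
- by move=> c; exists (fun=> 0); [exact: calg_cst|move=> x; exact: is_derive_cst].
- move=> f g cf [f' cf' ff'] cg [g' cg' gg'].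
  exists (fun x => f' x + g' x); first exact: calg_add.
  by move=> x; exact: is_deriveD.
- move=> f g cf [f' cf' ff'] cg [g' cg' gg'].
  exists (fun x => f x * g' x + g x * f' x); first by apply: calg_add; exact: calg_mul.
  by move=> x; exact: is_deriveM.
- move=> f a b cf [f' cf' ff'].
  exists (fun x => f' (a * x + b) * a); first by apply: calg_mul; [exact: calg_aff|exact: calg_cst].
  move=> x; apply: (@is_derive1_comp R f (fun x => a * x + b)).
  have := is_deriveD (is_deriveZ a (is_derive_id x (1 : R))) (is_derive_cst b x (1 : R)).
  by rewrite /GRing.scale/= mulr1 addr0.
Qed.

Lemma csmooth_cst c : csmooth (fun=> c). Proof. exact/calg_csmooth/calg_cst. Qed.
Lemma csmoothD f g : csmooth f -> csmooth g -> csmooth (fun x => f x + g x).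
Proof. by move=> /calg_base cf /calg_base cg; exact/calg_csmooth/calg_add. Qed.
Lemma csmoothM f g : csmooth f -> csmooth g -> csmooth (fun x => f x * g x).
Proof. by move=> /calg_base cf /calg_base cg; exact/calg_csmooth/calg_mul. Qed.
Lemma csmooth_aff f a b : csmooth f -> csmooth (fun x => f (a * x + b)).
Proof. by move=> /calg_base cf; exact/calg_csmooth/calg_aff. Qed.

Lemma is_derive_continuous (f g : R -> R) : (forall x : R, is_derive x (1 : R) f (g x)) -> continuous f.
Proof. by move=> fg x; apply/differentiable_continuous/derivable1_diffP; case: (fg x). Qed.

Lemma csmooth_continuous f : csmooth f -> continuous f.
Proof. by move=> /csmooth_derive[g _]; exact: is_derive_continuous. Qed.

Lemma MVT_all (f g : R -> R) (a b : R) : (forall x : R, is_derive x (1 : R) f (g x)) -> a < b ->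
  exists2 c, a < c < b & f b - f a = g c * (b - a).
Proof.
move=> fg ab; have [|c] := @MVT R f g a b ab (fun x _ => fg x).
  by apply: continuous_subspaceT; exact: is_derive_continuous fg.
by rewrite in_itv/=; exists c.
Qed.

Lemma primitive_ex (f : R -> R) : continuous f -> (forall x, x <= 0 -> f x = 0) ->
  exists F : R -> R, (forall x : R, is_derive x (1 : R) F (f x)) /\ (forall x, x <= 0 -> F x = 0).
Proof.
move=> cf f0; pose F x := \int[mu]_(t in `[(-1 : R), x]) f t.
have F0 x : x <= 0 -> F x = 0.
  move=> x0; rewrite /F; under eq_Rintegral.
    move=> t; rewrite inE/= in_itv/= => /andP[_ tx]; rewrite f0 ?(le_trans tx)//.
    over.
  by rewrite /Rintegral integral0.
exists F; split => // x; have [x0|x0] := ltP x 0.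
  rewrite f0 ?ltW//; apply: (@near_eq_is_derive R R^o R^o (cst 0) F) => //.
  by near=> y; rewrite F0// ltW//; near: y; exact: lt_nbhsl.
have [||||h1 h2] := @continuous_FTC1_closed R f (-1) x (x + 1).
- by rewrite ltrDl.
- apply: continuous_compact_integrable; first exact: segment_compact.
  exact: continuous_subspaceT.
- by apply: lt_le_trans x0; rewrite ltrN10.
- exact: cf.
apply: DeriveDef; first exact: h1.
by move: h2; rewrite derive1E.
Unshelve. all: by end_near. Qed.

(** A normalized primitive of the bump [flat 1 x * flat 1 (1 - x)]. *)
Lemma smooth_step_ex : exists S : R -> R, [/\ csmooth S, forall x, x <= 0 -> S x = 0,
  forall x, 1 <= x -> S x = 1 & forall x, 0 <= S x <= 1].
Proof.
pose b x := flat 1 x * flat 1 (-1 * x + 1).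
have cb : csmooth b by apply: csmoothM; [exact: csmooth_flat|apply: csmooth_aff; exact: csmooth_flat].
have fl0 x : x <= 0 -> flat 1 x = 0 by move=> x0; rewrite /flat ltNge x0.
have flp x : 0 < x -> 0 < flat 1 x by move=> x0; rewrite /flat x0 hornerC mul1r expR_gt0.
have b0 x : x <= 0 -> b x = 0 by move=> x0; rewrite /b fl0 ?mul0r.
have b1 x : 1 <= x -> b x = 0 by move=> x1; rewrite /b [X in _ * X]fl0 ?mulr0//; lra.
have bge x : 0 <= b x.
  have [x0|x0] := leP x 0; first by rewrite b0.
  have [x1|x1] := leP 1 x; first by rewrite b1.
  by rewrite ltW// mulr_gt0// flp//; lra.
have [F [dF F0]] := primitive_ex (csmooth_continuous cb) b0.
have Fmono x y : x <= y -> F x <= F y.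
  rewrite le_eqVlt => /predU1P[->//|xy]; have [c _ H] := MVT_all dF xy.
  by rewrite -subr_ge0 H mulr_ge0// subr_ge0 ltW.
have F1 x : 1 <= x -> F x = F 1.
  rewrite le_eqVlt => /predU1P[<-//|xy]; have [c /andP[c1 _] H] := MVT_all dF xy.
  by apply/eqP; rewrite -subr_eq0 H b1 ?mul0r// ltW.
have Fp : 0 < F 1.
  have [c /andP[c0 c1]] := MVT_all dF (@ltr01 R); rewrite (F0 0)// !subr0 mulr1 => ->.
  by rewrite mulr_gt0// flp//; lra.
exists (fun x => (F 1)^-1 * F x); split.
- by apply: csmoothM; [exact: csmooth_cst|exact: csmooth_prim cb dF].
- by move=> x /F0 ->; rewrite mulr0.
- by move=> x /F1 ->; rewrite mulVf// gt_eqF.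
- move=> x; apply/andP; split.
    rewrite mulr_ge0// ?invr_ge0 ?(ltW Fp)//.
    by have [x0|/ltW x0] := leP x 0; [rewrite F0|rewrite -(F0 0)// Fmono].
  rewrite mulrC ler_pdivrMr// mul1r.
  by have [x1|/ltW x1] := leP x 1; [rewrite Fmono|rewrite F1].
Qed.

Definition sstep : R -> R := sval (cid smooth_step_ex).
Lemma sstep_csmooth : csmooth sstep. Proof. by rewrite /sstep; case: cid => S []. Qed.
Lemma sstep0 x : x <= 0 -> sstep x = 0. Proof. by rewrite /sstep; case: cid => S [? + ? ?]/=; exact. Qed.
Lemma sstep1 x : 1 <= x -> sstep x = 1. Proof. by rewrite /sstep; case: cid => S [? ? + ?]/=; exact. Qed.
Lemma sstep_ge0 x : 0 <= sstep x. Proof. by rewrite /sstep; case: cid => S [? ? ? H]/=; have /andP[] := H x. Qed.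
Lemma sstep_le1 x : sstep x <= 1. Proof. by rewrite /sstep; case: cid => S [? ? ? H]/=; have /andP[] := H x. Qed.

Lemma smooth_ramp_ex : exists P : R -> R, [/\ csmooth P, forall x : R, is_derive x (1 : R) P (sstep x),
  forall x, x <= 0 -> P x = 0, forall x, 0 <= x -> x - 1 <= P x <= x & forall x, 1 <= x -> P x = P 1 + (x - 1)].
Proof.
have [F [dF F0]] := primitive_ex (csmooth_continuous sstep_csmooth) sstep0.
have F1 x : 1 <= x -> F x = F 1 + (x - 1).
  rewrite le_eqVlt => /predU1P[<-|xy]; first by rewrite subrr addr0.
  have [c /andP[c1 _]] := MVT_all dF xy.
  by rewrite sstep1 ?mul1r ?(ltW c1)//; lra.
have Fx x : 0 <= x -> 0 <= F x <= x.
  rewrite le_eqVlt => /predU1P[<-|xy]; first by rewrite F0 ?lexx.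
  have [c _] := MVT_all dF xy; rewrite (F0 0)// !subr0 => ->.
  by rewrite mulr_ge0 ?sstep_ge0 ?(ltW xy)//= ler_piMl ?sstep_le1 ?(ltW xy).
exists F; split => //; first exact: csmooth_prim sstep_csmooth dF.
move=> x x0; have /andP[a b] := Fx x x0; rewrite b andbT.
have [x1|/ltW x1] := leP x 1; first lra.
by rewrite F1// ; have /andP[] := Fx 1 ler01; lra.
Qed.

Definition sramp : R -> R := sval (cid smooth_ramp_ex).
Lemma sramp_csmooth : csmooth sramp. Proof. by rewrite /sramp; case: cid => S []. Qed.
Lemma sramp_derive (x : R) : is_derive x (1 : R) sramp (sstep x).
Proof. by rewrite /sramp; case: cid => S [? H ? ? ?]/=. Qed.
Lemma sramp0 x : x <= 0 -> sramp x = 0. Proof. by rewrite /sramp; case: cid => S [? ? + ? ?]/=; exact. Qed.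
Lemma sramp_bound x : 0 <= x -> x - 1 <= sramp x <= x. Proof. by rewrite /sramp; case: cid => S [? ? ? + ?]/=; exact. Qed.
Lemma sramp1 x : 1 <= x -> sramp x = sramp 1 + (x - 1). Proof. by rewrite /sramp; case: cid => S [? ? ? ? +]/=; exact. Qed.

End SmoothSteps.

(** * Smooth functions and test functions *)

Section TestFunctions.
Variable R : realType.
Notation RR := (measurableTypeR R).
Notation LL := (@leb3 R).
Implicit Types (phi psi : R3 R -> R) (i j : 'I_3) (x : R3 R).

Definition coord j x : R := if (j == 0 :> nat) then x.1.1 else if (j == 1 :> nat) then x.1.2 else x.2.

Lemma I3_ind (P : 'I_3 -> Prop) : P 0 -> P 1 -> P 2 -> forall i, P i.
Proof.
move=> p0 p1 p2 i; case: i => -[|[|[|//]]] H.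
- by rewrite (_ : Ordinal H = 0)//; apply/val_inj.
- by rewrite (_ : Ordinal H = 1)//; apply/val_inj.
- by rewrite (_ : Ordinal H = 2)//; apply/val_inj.
Qed.

Lemma coordD j x y : coord j (x + y) = coord j x + coord j y.
Proof. by elim/I3_ind: j. Qed.
Lemma coordZ j (h : R) x : coord j (h *: x) = h * coord j x.
Proof. by elim/I3_ind: j. Qed.
Lemma coordN j x : coord j (- x) = - coord j x.
Proof. by elim/I3_ind: j. Qed.
Lemma coord_basis i j : coord j (basis3 R i) = (i == j)%:R.
Proof. by elim/I3_ind: i; elim/I3_ind: j. Qed.

Lemma measurable_coord j : measurable_fun [set: RR * RR * RR] (coord j).
Proof.
by elim/I3_ind: j; [exact: measurable_c1|exact: measurable_c2|exact: measurable_c3].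
Qed.

Lemma continuous_coord j : continuous (coord j).
Proof.
elim/I3_ind: j => x.
- by apply: (@continuous_comp _ _ _ (fun x : R3 R => x.1) fst); exact: cvg_fst.
- by apply: (@continuous_comp _ _ _ (fun x : R3 R => x.1) snd); [exact: cvg_fst|exact: cvg_snd].
- exact: cvg_snd.
Qed.

Lemma is_derive_coord (f f' : R -> R) i j x : (forall t : R, is_derive t (1 : R) f (f' t)) ->
  is_derive x (basis3 R i) (f \o coord j) ((i == j)%:R * f' (coord j x)).
Proof.
move=> ff'.
have E (h : R) : h^-1 *: (((f \o coord j) \o shift x) (h *: basis3 R i) - (f \o coord j) x)
   = if i == j then h^-1 *: ((f \o shift (coord j x)) (h *: (1 : R)) - f (coord j x)) else 0.
  rewrite /= coordD coordZ coord_basis; case: (eqVneq i j) => [_|_]; first by [].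
  by rewrite mulr0 add0r subrr scaler0.
have cv : (fun h : R => h^-1 *: (((f \o coord j) \o shift x) (h *: basis3 R i) - (f \o coord j) x)) @ 0^' -->
   ((i == j)%:R * f' (coord j x) : R).
  under eq_fun do rewrite E.
  case: (eqVneq i j) => [_|_]; last by rewrite mul0r; exact: cvg_cst.
  rewrite mul1r; have [d <-] := ff' (coord j x); exact: d.
by apply: DeriveDef; [apply/cvg_ex; eexists; exact: cv|exact: cvg_lim cv].
Qed.

(** The counterpart in space of [csmooth_coind]. *)
Lemma smooth_coind (P : (R3 R -> R) -> Prop) :
  (forall phi, P phi -> [/\ continuous phi, forall i x, derivable phi x (basis3 R i) & forall i, P (partial i phi)]) ->
  forall phi, P phi -> smooth phi.
Proof.
move=> HP phi Pphi s /=.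
have : P (foldr (@partial R) phi s).
  by elim: s => //= i s IH; have [_ _] := HP _ IH; apply.
by move=> /HP[c d _]; split.
Qed.

Lemma smooth_cont phi : smooth phi -> continuous phi.
Proof. by move=> /(_ [::])[]. Qed.
Lemma smooth_derivable phi i x : smooth phi -> derivable phi x (basis3 R i).
Proof. by move=> /(_ [::])[_]; apply. Qed.
Lemma smooth_partial phi i : smooth phi -> smooth (partial i phi).
Proof. by move=> sp s; have := sp (rcons s i); rewrite foldr_rcons. Qed.

Lemma partial_is_derive phi i x d : is_derive x (basis3 R i) phi d -> partial i phi x = d.
Proof. by move=> [_ <-]. Qed.

Lemma smooth_is_derive phi i x : smooth phi -> is_derive x (basis3 R i) phi (partial i phi x).
Proof. by move=> /smooth_derivable h; apply: DeriveDef. Qed.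

Inductive smalg : (R3 R -> R) -> Prop :=
| smalg_base phi : smooth phi -> smalg phi
| smalg_cst c : smalg (fun=> c)
| smalg_coord f j : csmooth f -> smalg (f \o coord j)
| smalg_add phi psi : smalg phi -> smalg psi -> smalg (fun x => phi x + psi x)
| smalg_mul phi psi : smalg phi -> smalg psi -> smalg (fun x => phi x * psi x)
| smalg_tr phi v : smalg phi -> smalg (fun x => phi (x + v)).

Lemma is_derive_tr phi v b x d : is_derive (x + v) b phi d -> is_derive x b (fun x => phi (x + v)) d.
Proof.
move=> [h1 h2].
have E : (fun h : R => h^-1 *: (((fun x => phi (x + v)) \o shift x) (h *: b) - phi (x + v))) =
  (fun h : R => h^-1 *: ((phi \o shift (x + v)) (h *: b) - phi (x + v))).
  by apply/funext => h /=; rewrite addrA.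
by apply: DeriveDef; [rewrite /derivable E|rewrite /derive E].
Qed.

Lemma smalg_derive phi : smalg phi -> continuous phi /\ forall i, exists2 psi, smalg psi & forall x, is_derive x (basis3 R i) phi (psi x).
Proof.
elim => {phi}.
- move=> phi sp; split; first exact: smooth_cont.
  by move=> i; exists (partial i phi); [exact/smalg_base/smooth_partial|move=> x; exact: smooth_is_derive].
- move=> c; split; first by move=> x; exact: cvg_cst.
  by move=> i; exists (fun=> 0); [exact: smalg_cst|move=> x; exact: is_derive_cst].
- move=> f j cf; split.
    by move=> x; apply: continuous_comp; [exact: continuous_coord|exact: csmooth_continuous].
  have [g cg fg] := csmooth_derive cf.
  move=> i; exists (fun x => (i == j)%:R * (g \o coord j) x); last by move=> x; exact: is_derive_coord.
  by apply: smalg_mul; [exact: smalg_cst|exact: smalg_coord].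
- move=> phi psi _ [c1 d1] _ [c2 d2]; split; first by move=> x; apply: cvgD; [exact: c1|exact: c2].
  move=> i; have [g1 s1 h1] := d1 i; have [g2 s2 h2] := d2 i.
  by exists (fun x => g1 x + g2 x); [exact: smalg_add|move=> x; exact: is_deriveD].
- move=> phi psi p1 [c1 d1] p2 [c2 d2]; split; first by move=> x; apply: cvgM; [exact: c1|exact: c2].
  move=> i; have [g1 s1 h1] := d1 i; have [g2 s2 h2] := d2 i.
  exists (fun x => phi x * g2 x + psi x * g1 x); first by apply: smalg_add; exact: smalg_mul.
  by move=> x; exact: is_deriveM.
- move=> phi v p1 [c1 d1]; split.
    move=> x; apply: (@continuous_comp _ _ _ (fun x : R3 R => x + v) phi); last exact: c1.
    by apply: cvgD; [exact: cvg_id|exact: cvg_cst].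
  move=> i; have [g1 s1 h1] := d1 i.
  by exists (fun x => g1 (x + v)); [exact: smalg_tr|move=> x; exact: is_derive_tr].
Qed.

Lemma smalg_smooth phi : smalg phi -> smooth phi.
Proof.
apply: smooth_coind => {}phi /smalg_derive[c d]; split => //.
  by move=> i x; have [g _ h] := d i; case: (h x).
move=> i; have [g sg h] := d i; rewrite (_ : partial i phi = g)//.
by apply/funext => x; exact: partial_is_derive.
Qed.

Lemma smooth_cst c : smooth (fun _ : R3 R => c). Proof. exact/smalg_smooth/smalg_cst. Qed.
Lemma smooth_coord f j : csmooth f -> smooth (f \o coord j). Proof. by move=> ?; exact/smalg_smooth/smalg_coord. Qed.
Lemma smoothD phi psi : smooth phi -> smooth psi -> smooth (fun x => phi x + psi x).
Proof. by move=> /smalg_base ? /smalg_base ?; exact/smalg_smooth/smalg_add. Qed.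
Lemma smoothM phi psi : smooth phi -> smooth psi -> smooth (fun x => phi x * psi x).
Proof. by move=> /smalg_base ? /smalg_base ?; exact/smalg_smooth/smalg_mul. Qed.
Lemma smooth_tr phi v : smooth phi -> smooth (fun x => phi (x + v)).
Proof. by move=> /smalg_base ?; exact/smalg_smooth/smalg_tr. Qed.

Lemma partialM phi psi i x : smooth phi -> smooth psi ->
  partial i (fun x => phi x * psi x) x = phi x * partial i psi x + psi x * partial i phi x.
Proof. by move=> sp sq; apply: partial_is_derive; apply: is_deriveM; exact: smooth_is_derive. Qed.
Lemma partial_tr phi v i x : smooth phi -> partial i (fun x => phi (x + v)) x = partial i phi (x + v).
Proof. by move=> sp; apply: partial_is_derive; apply: is_derive_tr; exact: smooth_is_derive. Qed.
Lemma partial_coord f f' i j x : (forall t : R, is_derive t (1 : R) f (f' t)) ->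
  partial i (f \o coord j) x = (i == j)%:R * f' (coord j x).
Proof. by move=> ff'; apply: partial_is_derive; exact: is_derive_coord. Qed.

Definition cube3 (r : R) : set (R3 R) := [set x | forall j, `|coord j x| <= r].

Lemma cube3P r x : cube3 r x <-> [/\ `|x.1.1| <= r, `|x.1.2| <= r & `|x.2| <= r].
Proof.
split=> [H|[a b c]]; first by split; [have := H 0|have := H 1|have := H 2].
by elim/I3_ind.
Qed.

Lemma cube3E r : cube3 r = (`[- r, r] `*` `[- r, r]) `*` `[- r, r].
Proof.
apply/seteqP; split => x.
  by move=> /cube3P[]; rewrite !ler_norml; split => //; split.
by move=> /= [[]]; rewrite !in_itv/= => a b c; apply/cube3P; rewrite !ler_norml.
Qed.

Lemma cube3S r s : r <= s -> cube3 r `<=` cube3 s.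
Proof. by move=> rs x H j; apply: le_trans (H j) rs. Qed.

Lemma cube3_compact r : compact (cube3 r).
Proof. by rewrite cube3E; apply: compact_setX; [apply: compact_setX|]; exact: segment_compact. Qed.

Lemma hausdorff_R3 : hausdorff_space (R3 R).
Proof. exact: norm_hausdorff. Qed.

Lemma cube3_closed r : closed (cube3 r).
Proof. by apply: compact_closed; [exact: hausdorff_R3|exact: cube3_compact]. Qed.

Lemma cube3_measurable r : measurable (cube3 r : set (RR * RR * RR)).
Proof. by rewrite cube3E; apply: measurableX; [apply: measurableX|]; exact: measurable_itv. Qed.

Lemma cube3_lty r : (LL (cube3 r) < +oo)%E.
Proof.
rewrite cube3E leb3_setX; try exact: measurable_itv.
rewrite !lebesgue_measure_itv/=.
by case: ifP => _; rewrite ?mul0e ?mule0 -?EFinB -?EFinM ?ltry.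
Qed.

Definition supp_in r phi := forall x, ~ cube3 r x -> phi x = 0.

(** Support in a bounded cube is easier to handle than compactness of the
    closure of the support. *)
Lemma test_functionP phi : test_function phi <-> smooth phi /\ exists r, supp_in r phi.
Proof.
split => -[sp H]; split => //.
  have [M [_ HM]] := compact_bounded H.
  exists (M + 1) => x; apply: contra_notP => /eqP px.
  have : `|x| <= M + 1 by apply: HM; [rewrite ltrDl|exact: subset_closure].
  by rewrite prod_normE/= ge_max prod_normE/= ge_max => /andP[/andP[? ?] ?]; apply/cube3P.
have [r Hr] := H.
apply: (@subclosed_compact _ _ (cube3 r)); [exact: closed_closure|exact: cube3_compact|].
rewrite [X in _ `<=` X]((closure_id (cube3 r)).1 (@cube3_closed r)).
apply: closure_subset => x /= /eqP; apply: contra_notP; exact: Hr.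
Qed.

Lemma test_smooth phi : test_function phi -> smooth phi. Proof. by case. Qed.

Lemma supp_in_partial r phi i : supp_in r phi -> supp_in r (partial i phi).
Proof.
move=> H x xr; rewrite /partial -[RHS](derive_cst (0 : R) x (basis3 R i)).
apply: near_eq_derive; have : nbhs x (~` cube3 r).
  by apply: open_nbhs_nbhs; split => //; exact/closed_openC/cube3_closed.
by apply: filterS => y /= /H.
Qed.

Lemma test_partial phi i : test_function phi -> test_function (partial i phi).
Proof.
move=> /test_functionP[sp [r H]]; apply/test_functionP; split; first exact: smooth_partial.
by exists r; exact: supp_in_partial.
Qed.

Lemma test_mull phi psi : smooth phi -> test_function psi -> test_function (fun x => phi x * psi x).
Proof.
move=> sp /test_functionP[sq [r H]]; apply/test_functionP; split; first exact: smoothM.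
by exists r => x /H ->; rewrite mulr0.
Qed.

Lemma testD phi psi : test_function phi -> test_function psi -> test_function (fun x => phi x + psi x).
Proof.
move=> /test_functionP[sp [r H]] /test_functionP[sq [s K]]; apply/test_functionP; split; first exact: smoothD.
exists (Num.max r s) => x xrs; rewrite H ?K ?addr0//.
  by apply: contra_not xrs; apply: cube3S; rewrite le_max lexx orbT.
by apply: contra_not xrs; apply: cube3S; rewrite le_max lexx.
Qed.

Lemma testZ phi c : test_function phi -> test_function (fun x => c * phi x).
Proof. by move=> tp; apply: (@test_mull (fun=> c)) => //; exact: smooth_cst. Qed.

Lemma test_tr phi v : test_function phi -> test_function (fun x => phi (x + v)).
Proof.
move=> /test_functionP[sp [r H]]; apply/test_functionP; split; first exact: smooth_tr.
exists (r + \sum_(j < 3) `|coord j v|) => x xr; apply: H.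
apply: contra_not xr => H j; rewrite (_ : coord j x = coord j (x + v) - coord j v); last by rewrite coordD addrK.
apply: (le_trans (ler_normB _ _)); apply: lerD; first exact: H.
by rewrite (bigD1 j)//= lerDl sumr_ge0.
Qed.

Lemma continuous_supp_bounded phi r : continuous phi -> supp_in r phi -> exists2 M, 0 <= M & forall x, `|phi x| <= M.
Proof.
move=> cp H.
have : compact (phi @` cube3 r).
  by apply: continuous_compact; [exact: continuous_subspaceT|exact: cube3_compact].
move=> /compact_bounded[M [_ HM]].
exists (`|M| + 1); first by rewrite addr_ge0.
move=> x; have [xr|xr] := pselect (cube3 r x); last by rewrite H// normr0 addr_ge0.
apply: HM; last by exists x.
by have := ler_norm M; lra.
Qed.

Lemma test_bounded phi : test_function phi -> exists2 M, 0 <= M & forall x, `|phi x| <= M.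
Proof. by move=> /test_functionP[/smooth_cont sp [r H]]; exact: continuous_supp_bounded H. Qed.

Lemma smooth_measurable phi : smooth phi -> measurable_fun [set: RR * RR * RR] phi.
Proof. by move=> /smooth_cont; exact: continuous3_measurable. Qed.

End TestFunctions.

(** * Integrable and square integrable functions *)

Section Integrability.
Variable R : realType.
Notation RR := (measurableTypeR R).
Notation LL := (@leb3 R).
Notation L2 := (Lfun (@leb3 R) 2%:E).
Notation meas f := (measurable_fun [set: RR * RR * RR] f).
Implicit Types (u v f g phi psi : R3 R -> R) (i j : 'I_3) (x : R3 R).
Notation integ f := (LL.-integrable setT (EFin \o (f : R3 R -> R))).

Lemma integ_meas f : integ f -> meas f.
Proof. by move=> /integrableP[/measurable_EFinP]. Qed.

Lemma integ_le f g : meas f -> (forall x, `|f x| <= `|g x|) -> integ g -> integ f.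
Proof.
move=> mf fg; apply: le_integrable => //; first exact/measurable_EFinP.
by move=> x _ /=; rewrite lee_fin.
Qed.

Lemma integD f g : integ f -> integ g -> integ (fun x => f x + g x).
Proof. by move=> fi gi; have := integrableD measurableT fi gi. Qed.
Lemma integB f g : integ f -> integ g -> integ (fun x => f x - g x).
Proof. by move=> fi gi; have := integrableB measurableT fi gi. Qed.
Lemma integZ c f : integ f -> integ (fun x => c * f x).
Proof. by move=> fi; have := integrableZl measurableT c fi. Qed.
Lemma integN f : integ f -> integ (fun x => - f x).
Proof. by move=> fi; have := integrableN fi. Qed.
Lemma eq_integ f g : (forall x, f x = g x) -> integ f -> integ g.
Proof. by move=> fg; rewrite (_ : f = g)//; exact/funext. Qed.

Lemma RintD f g : integ f -> integ g -> \int[LL]_x (f x + g x) = \int[LL]_x f x + \int[LL]_x g x.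
Proof. by move=> fi gi; rewrite RintegralD. Qed.
Lemma RintB f g : integ f -> integ g -> \int[LL]_x (f x - g x) = \int[LL]_x f x - \int[LL]_x g x.
Proof. by move=> fi gi; rewrite RintegralB. Qed.
Lemma RintZ c f : integ f -> \int[LL]_x (c * f x) = c * \int[LL]_x f x.
Proof. by move=> fi; rewrite RintegralZl. Qed.
Lemma RintN f : integ f -> \int[LL]_x (- f x) = - \int[LL]_x f x.
Proof.
move=> fi; rewrite -mulN1r -RintZ//.
by congr Rintegral; apply/funext => x; rewrite mulN1r.
Qed.
Lemma Rint_ge0 f : (forall x, 0 <= f x) -> 0 <= \int[LL]_x f x.
Proof. by move=> f0; apply: Rintegral_ge0. Qed.
Lemma Rint_le f g : integ f -> integ g -> (forall x, f x <= g x) -> \int[LL]_x f x <= \int[LL]_x g x.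
Proof. by move=> fi gi fg; apply: le_Rintegral. Qed.
Lemma Rint_norm f : integ f -> `|\int[LL]_x f x| <= \int[LL]_x `|f x|.
Proof. by move=> fi; apply: le_normr_Rintegral. Qed.
Lemma integ_norm f : integ f -> integ (fun x => `|f x|).
Proof. by move=> fi; apply: (integ_le _ _ fi) => [|x]; [exact: measurableT_comp (integ_meas fi)|rewrite normr_id]. Qed.
Lemma Rint_EFin f : integ f -> (\int[LL]_x (f x)%:E)%E = (\int[LL]_x f x)%:E.
Proof. by move=> fi; rewrite /Rintegral fineK//; exact: integrable_fin_num. Qed.
Lemma eq_Rint f g : (forall x, f x = g x) -> \int[LL]_x f x = \int[LL]_x g x.
Proof. by move=> fg; apply: eq_Rintegral => x _; exact: fg. Qed.
Lemma aeS (P Q : R3 R -> Prop) : (forall x, P x -> Q x) -> {ae LL, forall x, P x} -> {ae LL, forall x, Q x}.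
Proof. by move=> PQ; apply: negligibleS => x /= nQ /PQ. Qed.
Lemma aeI (P Q : R3 R -> Prop) : {ae LL, forall x, P x} -> {ae LL, forall x, Q x} -> {ae LL, forall x, P x /\ Q x}.
Proof.
move=> p q; apply: negligibleS (negligibleU p q) => x /= /not_andP[np|nq]; [by left|by right].
Qed.
Lemma ae_all (P : nat -> R3 R -> Prop) : (forall n, {ae LL, forall x, P n x}) -> {ae LL, forall x n, P n x}.
Proof.
move=> H; apply: negligibleS (negligible_bigcup H) => x /= /existsNP[n nP].
by exists n.
Qed.

Lemma ae_eq_Rint f g : meas f -> meas g -> {ae LL, forall x, f x = g x} -> \int[LL]_x f x = \int[LL]_x g x.
Proof.
move=> mf mg fg; rewrite /Rintegral; congr fine; apply: ae_eq_integral => //; [exact/measurable_EFinP..|].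
by apply: aeS fg => x ->.
Qed.

Lemma L2_meas u : u \in L2 -> meas u.
Proof. by move=> /andP[/[!inE]/= mf _]. Qed.

Lemma L2_sqr u : u \in L2 -> integ (fun x => u x ^+ 2).
Proof. exact: Lfun2_integrable_sqr. Qed.

Lemma L2_intro u : meas u -> integ (fun x => u x ^+ 2) -> u \in L2.
Proof.
move=> mf /integrableP[_ H]; apply/andP; split; rewrite inE//=.
rewrite /finite_norm unlock /Lnorm poweR_lty//.
apply: le_lt_trans H; apply: ge0_le_integral => //.
- by move=> x _; rewrite lee_fin powR_ge0.
- by apply/measurable_EFinP; apply: (measurableT_comp (measurable_powR 2)); exact: measurableT_comp.
- by apply: measurableT_comp => //; apply/measurable_EFinP; exact: measurable_funX.
- by move=> x _; rewrite lee_fin powR_mulrn// normrX.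
Qed.

Lemma L2_mul u v : u \in L2 -> v \in L2 -> integ (fun x => u x * v x).
Proof. by move=> lu lv; exact: (Lfun1_integrable _ _).1 (Lfun2_mul_Lfun1 lu lv). Qed.

Lemma L2D u v : u \in L2 -> v \in L2 -> (fun x => u x + v x) \in L2.
Proof.
move=> lu lv; apply: L2_intro; first by apply: measurable_funD; exact: L2_meas.
apply: (@eq_integ (fun x => (u x ^+ 2 + v x ^+ 2) + 2 * (u x * v x))); first by move=> x; ring.
by apply: integD; [apply: integD; exact: L2_sqr|apply: integZ; exact: L2_mul].
Qed.

Lemma L2_bddM u v (M : R) : meas v -> (forall x, `|v x| <= M) -> u \in L2 -> (fun x => v x * u x) \in L2.
Proof.
move=> mv vM lu; apply: L2_intro; first by apply: measurable_funM => //; exact: L2_meas.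
apply: integ_le (integZ (M ^+ 2) (L2_sqr lu)).
  by apply: measurable_funX; apply: measurable_funM => //; exact: L2_meas.
move=> x; rewrite exprMn (normrM (v x ^+ 2)) (normrM (M ^+ 2)) ler_wpM2r// !normrX ler_pXn2r ?nnegrE//.
exact: le_trans (vM x) (ler_norm _).
Qed.

Lemma L2Z c u : u \in L2 -> (fun x => c * u x) \in L2.
Proof. by apply: (@L2_bddM _ (fun=> c) `|c|) => //. Qed.

Lemma L2_tr u t : u \in L2 -> (fun x => u (x + t)) \in L2.
Proof.
move=> lu; apply: L2_intro.
  exact: (measurableT_comp (L2_meas lu) (@measurable_tr3 R t)).
exact: (integrable_tr3 t (L2_sqr lu)).
Qed.

Lemma integ_tr f t : integ f -> integ (fun x => f (x + t)).
Proof. by move=> fi; exact: (integrable_tr3 t fi). Qed.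

Lemma integ_indic (A : set (RR * RR * RR)) : measurable A -> (LL A < +oo)%E -> integ (\1_A : R3 R -> R).
Proof.
move=> mA Aoo; apply/integrableP; split; first by apply/measurable_EFinP; exact: measurable_indic.
have E x : `|(EFin \o (\1_A : R3 R -> R)) x|%E = (\1_A x)%:E by rewrite /= ger0_norm.
by under eq_integral => x _ do rewrite E; rewrite integral_indic// setIT.
Qed.

Lemma integ_cube r : integ (\1_(cube3 r) : R3 R -> R).
Proof. by apply: integ_indic; [exact: cube3_measurable|exact: cube3_lty]. Qed.

Lemma supp_integ f r (M : R) : meas f -> (forall x, `|f x| <= M) -> supp_in r f -> integ f.
Proof.
move=> mf fM H; apply: integ_le (integZ M (integ_cube r)) => // x.
rewrite indicE; have [xr|xr] := pselect (cube3 r x).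
  by rewrite mem_set// mulr1 (le_trans (fM x))// ler_norm.
by rewrite H// normr0.
Qed.

Lemma supp_L2 f r (M : R) : meas f -> (forall x, `|f x| <= M) -> supp_in r f -> f \in L2.
Proof.
move=> mf fM H; apply: L2_intro => //; apply: (@supp_integ _ r (M ^+ 2)).
- exact: measurable_funX.
- move=> x; rewrite normrX ler_pXn2r ?nnegrE//; exact: le_trans (fM x).
- by move=> x /H ->; rewrite expr0n.
Qed.

Lemma test_meas phi : test_function phi -> meas phi.
Proof. by move=> /test_smooth; exact: smooth_measurable. Qed.
Lemma test_L2 phi : test_function phi -> phi \in L2.
Proof.
move=> tp; have [M _ pM] := test_bounded tp; have /test_functionP[_ [r H]] := tp.
by apply: supp_L2 H; [exact: test_meas|exact: pM].
Qed.
Lemma test_integ phi : test_function phi -> integ phi.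
Proof.
move=> tp; have [M _ pM] := test_bounded tp; have /test_functionP[_ [r H]] := tp.
by apply: supp_integ H; [exact: test_meas|exact: pM].
Qed.

End Integrability.

(** * Weak gradients *)

Section WeakGradients.
Variable R : realType.
Notation RR := (measurableTypeR R).
Notation LL := (@leb3 R).
Notation L2 := (Lfun (@leb3 R) 2%:E).
Notation meas f := (measurable_fun [set: RR * RR * RR] f).
Implicit Types (u v f g phi psi : R3 R -> R) (i j : 'I_3) (x : R3 R).
Notation integ f := (LL.-integrable setT (EFin \o (f : R3 R -> R))).

Lemma dominated_Rint_ae (f_ : nat -> R3 R -> R) f g : (forall n, meas (f_ n)) -> meas f ->
  {ae LL, forall x, f_ n x @[n --> \oo] --> f x} -> integ g -> (forall n x, `|f_ n x| <= g x) ->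
  \int[LL]_x f_ n x @[n --> \oo] --> \int[LL]_x f x.
Proof.
move=> mfn mf cf ig fg.
have mfn' n : meas (EFin \o f_ n) by exact/measurable_EFinP.
have mf' : meas (EFin \o f) by exact/measurable_EFinP.
have cf' : {ae LL, forall x, setT x -> (EFin \o f_ n) x @[n --> \oo] --> (EFin \o f) x}.
  by apply: aeS cf => x cx _; apply: cvg_EFin => //; exact: nearW.
have fg' : {ae LL, forall x n, setT x -> (`|(EFin \o f_ n) x| <= (EFin \o g) x)%E}.
  by apply: aeW => x n _; rewrite /= lee_fin.
have [fi _ H] := dominated_convergence measurableT mfn' mf' cf' ig fg'.
have fi' : integ f by exact: fi.
apply: fine_cvg; rewrite -(Rint_EFin fi'); exact: H.
Qed.

Lemma dominated_Rint (f_ : nat -> R3 R -> R) f g : (forall n, meas (f_ n)) -> meas f ->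
  (forall x, f_ n x @[n --> \oo] --> f x) -> integ g -> (forall n x, `|f_ n x| <= g x) ->
  \int[LL]_x f_ n x @[n --> \oo] --> \int[LL]_x f x.
Proof. by move=> mfn mf cf; apply: dominated_Rint_ae => //; exact: aeW. Qed.

Lemma line_derive phi i x (t : R) : smooth phi ->
  is_derive t (1 : R) (fun s : R => phi (s *: basis3 R i + x)) (partial i phi (t *: basis3 R i + x)).
Proof.
move=> sp; have [h1 h2] := smooth_is_derive i (t *: basis3 R i + x) sp.
have E : (fun h : R => h^-1 *: (((fun s : R => phi (s *: basis3 R i + x)) \o shift t) (h *: 1) - phi (t *: basis3 R i + x))) =
  (fun h : R => h^-1 *: ((phi \o shift (t *: basis3 R i + x)) (h *: basis3 R i) - phi (t *: basis3 R i + x))).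
  by apply/funext => h /=; rewrite scalerDl /GRing.scale/= mulr1 addrA.
by apply: DeriveDef; [rewrite /derivable E|rewrite /derive E].
Qed.

Lemma line_lipschitz phi i M x (t : R) : smooth phi -> (forall y, `|partial i phi y| <= M) ->
  `|phi (t *: basis3 R i + x) - phi x| <= M * `|t|.
Proof.
move=> sp HM; have H := fun s => line_derive i x s sp.
have E0 : phi x = phi ((0 : R) *: basis3 R i + x) by rewrite scale0r add0r.
have [t0|t0|->] := ltgtP t 0; last by rewrite scale0r add0r subrr normr0 mulr0.
- have [c _] := MVT_all H t0; rewrite -E0 sub0r distrC => ->.
  by rewrite normrM normrN ler_wpM2r.
- have [c _] := MVT_all H t0; rewrite -E0 subr0 => ->.
  by rewrite normrM ler_wpM2r.
Qed.

(** Translation invariance makes the integral of every difference quotient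
    vanish. The quotients are bounded by the Lipschitz constant and live in a
    fixed cube, so that their limit may be taken under the integral. *)
Lemma integral_partial0 chi i : test_function chi -> \int[LL]_x partial i chi x = 0.
Proof.
move=> tc; have sc := test_smooth tc.
have [M M0 HM] := test_bounded (test_partial i tc).
have /test_functionP[_ [r Hr]] := tc.
pose h n : R := n.+1%:R^-1.
have h0 n : 0 < h n by rewrite invr_gt0.
have h1 n : h n <= 1 by rewrite invf_le1// ler1n.
pose q n x := (h n)^-1 * (chi (h n *: basis3 R i + x) - chi x).
have tq n : test_function (q n).
  apply: (@testZ _ (fun x => chi (h n *: basis3 R i + x) - chi x)).
  rewrite (_ : (fun x => _) = (fun x => chi (x + h n *: basis3 R i) + (-1) * chi x)); last first.
    by apply/funext => x; rewrite mulN1r addrC [in RHS]addrC (addrC x).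
  by apply: testD; [exact: test_tr|exact: testZ].
have Iq n : \int[LL]_x q n x = 0.
  rewrite RintZ; last first.
    by have := integZ (h n) (test_integ (tq n)); apply: eq_integ => x; rewrite /q mulrA mulfV ?mul1r// gt_eqF.
  have E x : chi (x + h n *: basis3 R i) = chi (h n *: basis3 R i + x) by rewrite addrC.
  have i1 : integ (fun x => chi (h n *: basis3 R i + x)).
    exact: (eq_integ E (integ_tr (h n *: basis3 R i) (test_integ tc))).
  rewrite RintB//; last exact: test_integ.
  by rewrite -(eq_Rint E) (@Rintegral_tr3 R (h n *: basis3 R i) chi) ?subrr ?mulr0//; exact: test_meas.
have : \int[LL]_x q n x @[n --> \oo] --> \int[LL]_x partial i chi x.
  apply: (@dominated_Rint q _ (fun x => M * \1_(cube3 (r + 1)) x)).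
  - by move=> n; exact: test_meas.
  - by apply: test_meas; exact: test_partial.
  - move=> x; have : derivable chi x (basis3 R i) by exact: smooth_derivable.
    rewrite /derivable => dc.
    have H : h n @[n --> \oo] --> 0^'.
      move=> A HA; have K : \forall n \near \oo, h n != 0 -> A (h n) by exact: (@cvg_harmonic R _ HA).
      have : \forall n \near \oo, A (h n) by apply: filterS K => n; apply; rewrite gt_eqF.
      by [].
    exact: (cvg_comp _ _ H dc).
  - exact/integZ/integ_cube.
  - move=> n x; rewrite indicE; have [xr|xr] := pselect (cube3 (r + 1) x).
      rewrite mem_set// mulr1 /q normrM gtr0_norm ?invr_gt0// ler_pdivrMl//.
      apply: le_trans (line_lipschitz _ _ sc HM) _.
      by rewrite gtr0_norm// mulrC.
    rewrite memNset// mulr0 /q !Hr ?subrr ?mulr0 ?normr0//.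
      by apply: contra_not xr; apply: cube3S; lra.
    apply: contra_not xr => H j.
    rewrite (_ : coord j x = coord j (h n *: basis3 R i + x) - h n * (i == j)%:R); last first.
      by rewrite coordD coordZ coord_basis; ring.
    apply: (le_trans (ler_normB _ _)); apply: lerD; first exact: H.
    rewrite normrM (gtr0_norm (h0 n)) mulr_ile1 ?(ltW (h0 n))//.
    by case: (i == j); rewrite ?normr1 ?normr0.
rewrite (_ : (fun n => _) = fun=> 0); last by apply/funext => n; exact: Iq.
by move=> H; exact: (cvg_unique (@Rhausdorff R) H (cvg_cst (0 : R))).
Qed.

(** Working with a pair of a function and one of its weak gradients avoids the
    choice made by [weak_partial], which commutes with the operations below
    only almost everywhere. *)
Definition H1p u (G : 'I_3 -> R3 R -> R) := u \in L2 /\ forall i, G i \in L2 /\ is_weak_partial i u (G i).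

Lemma H1p_test phi : test_function phi -> H1p phi (fun i => partial i phi).
Proof.
move=> tp; split; first exact: test_L2.
move=> i; split; first by apply: test_L2; exact: test_partial.
move=> psi tq; have := integral_partial0 i (test_mull (test_smooth tp) tq).
have sp := test_smooth tp; have sq := test_smooth tq.
rewrite (eq_Rint (fun x => partialM i x sp sq)).
have i1 := L2_mul (test_L2 tp) (test_L2 (test_partial i tq)).
have i2 := L2_mul (test_L2 (test_partial i tp)) (test_L2 tq).
have i3 : integ (fun x => psi x * partial i phi x) by apply: eq_integ i2 => x; rewrite mulrC.
rewrite RintD// => /eqP; rewrite addr_eq0 => /eqP ->.
by congr (- _); apply: eq_Rint => x; rewrite mulrC.
Qed.

Lemma H1pZ c u G : H1p u G -> H1p (fun x => c * u x) (fun i x => c * G i x).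
Proof.
move=> [lu HG]; split; first exact: L2Z.
move=> i; have [lg wg] := HG i; split; first exact: L2Z.
move=> psi tq.
have i1 : integ (fun x => u x * partial i psi x) by apply: L2_mul => //; apply: test_L2; exact: test_partial.
have i2 : integ (fun x => G i x * psi x) by apply: L2_mul => //; exact: test_L2.
under eq_Rintegral do rewrite -mulrA.
by rewrite RintZ// wg// mulrN -RintZ//; congr (- _); apply: eq_Rint => x; rewrite mulrA.
Qed.

Lemma H1pD u G v H : H1p u G -> H1p v H -> H1p (fun x => u x + v x) (fun i x => G i x + H i x).
Proof.
move=> [lu HG] [lv HH]; split; first exact: L2D.
move=> i; have [lg wg] := HG i; have [lh wh] := HH i; split; first exact: L2D.
move=> psi tq.
have tL := test_L2 tq; have tL' := test_L2 (test_partial i tq).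
under eq_Rintegral do rewrite mulrDl.
under [X in _ = - X]eq_Rintegral do rewrite mulrDl.
by rewrite !RintD ?wg ?wh ?opprD//; exact: L2_mul.
Qed.

Lemma H1p_mul chi u G : test_function chi -> H1p u G ->
  H1p (fun x => chi x * u x) (fun i x => chi x * G i x + partial i chi x * u x).
Proof.
move=> tc [lu HG].
have [M _ cM] := test_bounded tc.
split; first by apply: L2_bddM cM _ => //; exact: test_meas.
move=> i; have [lg wg] := HG i.
have [M' _ cM'] := test_bounded (test_partial i tc).
have mc := test_meas tc; have mc' := test_meas (test_partial i tc).
have l1 := L2_bddM mc cM lg; have l2 := L2_bddM mc' cM' lu; have l3 := L2_bddM mc cM lu.
split; first exact: L2D.
move=> psi tq; have tL := test_L2 tq; have tL' := test_L2 (test_partial i tq).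
have tcq := test_mull (test_smooth tc) tq.
have E : \int[LL]_x (u x * partial i (fun x => chi x * psi x) x) = - \int[LL]_x (G i x * (chi x * psi x)) by exact: wg.
have i1 := L2_mul l3 tL'; have i2 := L2_mul l2 tL; have i3 := L2_mul l1 tL.
under [X in _ = - X]eq_Rintegral do rewrite mulrDl.
rewrite RintD//.
have -> : \int[LL]_x (chi x * G i x * psi x) = \int[LL]_x (G i x * (chi x * psi x)).
  by apply: eq_Rint => x; ring.
rewrite opprD -E -RintB//; last exact: L2_mul lu (test_L2 (test_partial i tcq)).
by apply: eq_Rint => x; rewrite partialM; [ring|exact: test_smooth..].
Qed.

Lemma H1p_tr t u G : H1p u G -> H1p (fun x => u (x + t)) (fun i x => G i (x + t)).
Proof.
move=> [lu HG]; split; first exact: L2_tr.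
move=> i; have [lg wg] := HG i; split; first exact: L2_tr.
move=> psi tq.
pose psi' x := psi (x + (- t)).
have tq' : test_function psi' by exact: test_tr.
have := wg psi' tq'.
have m1 : meas (fun x => u x * partial i psi' x).
  exact: measurable_funM (L2_meas lu) (test_meas (test_partial i tq')).
have m2 : meas (fun x => G i x * psi' x).
  exact: measurable_funM (L2_meas lg) (test_meas tq').
rewrite -(Rintegral_tr3 t m1) -(Rintegral_tr3 t m2).
have E1 x : u (x + t) * partial i psi' (x + t) = u (x + t) * partial i psi x.
  by rewrite partial_tr ?addrK//; exact: test_smooth.
have E2 x : G i (x + t) * psi' (x + t) = G i (x + t) * psi x by rewrite /psi' addrK.
by rewrite (eq_Rint E1) (eq_Rint E2).
Qed.

End WeakGradients.

(** * The fundamental lemma of the calculus of variations *)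

Section FundamentalLemma.
Variable R : realType.
Notation RR := (measurableTypeR R).
Notation LL := (@leb3 R).
Notation L2 := (Lfun (@leb3 R) 2%:E).
Notation meas f := (measurable_fun [set: RR * RR * RR] f).
Implicit Types (u v f g phi psi : R3 R -> R) (i j : 'I_3) (x : R3 R).
Notation integ f := (LL.-integrable setT (EFin \o (f : R3 R -> R))).


Definition tens (f : 'I_3 -> R -> R) x : R := f 0 (coord 0 x) * f 1 (coord 1 x) * f 2 (coord 2 x).
Definition upd (f : 'I_3 -> R -> R) i (g : R -> R) : 'I_3 -> R -> R := fun j => if j == i then g else f j.

Lemma upd_same (f : 'I_3 -> R -> R) i (g : R -> R) : upd f i g i = g. Proof. by rewrite /upd eqxx. Qed.

Lemma tens_supp (f : 'I_3 -> R -> R) r : (forall j t, r < `|t| -> f j t = 0) -> supp_in r (tens f).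
Proof.
move=> H x; apply: contra_notP => H0; apply/cube3P; rewrite !leNgt; split; apply/negP => h; apply: H0; rewrite /tens.
- by rewrite (H 0) ?mul0r.
- by rewrite (H 1) ?mulr0 ?mul0r.
- by rewrite (H 2) ?mulr0.
Qed.

Lemma tens_test (f : 'I_3 -> R -> R) r : (forall j, csmooth (f j)) -> (forall j t, r < `|t| -> f j t = 0) -> test_function (tens f).
Proof.
move=> cf H; apply/test_functionP; split; last by exists r; exact: tens_supp.
by apply: smoothM; [apply: smoothM|]; exact: smooth_coord.
Qed.

Lemma tens_partial (f : 'I_3 -> R -> R) i (g : R -> R) x : (forall j, csmooth (f j)) -> (forall t : R, is_derive t (1 : R) (f i) (g t)) ->
  partial i (tens f) x = tens (upd f i g) x.
Proof.
move=> cf fg; have sc j := smooth_coord j (cf j).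
have D j : partial i (f j \o coord j) x = (i == j)%:R * g (coord j x).
  have [ij|ij] := eqVneq i j; first by subst j; rewrite (partial_coord i i x fg) eqxx.
  have [h _ Hh] := csmooth_derive (cf j).
  by rewrite (partial_coord i j x Hh) (negbTE ij) !mul0r.
rewrite /tens.
rewrite (partialM i x (smoothM (sc 0) (sc 1)) (sc 2)) (partialM i x (sc 0) (sc 1)) !D.
by rewrite /upd; elim/I3_ind: i {fg D} => /=; rewrite /comp/=; ring.
Qed.

Lemma tens_cvg (F : nat -> 'I_3 -> R -> R) (f : 'I_3 -> R -> R) x :
  (forall j t, F n j t @[n --> \oo] --> f j t) -> tens (F n) x @[n --> \oo] --> tens f x.
Proof. by move=> H; apply: cvgM; [apply: cvgM|]; exact: H. Qed.

Lemma near_mul_ge1 (c : R) : 0 < c -> \forall n \near \oo, 1 <= n%:R * c.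
Proof.
move=> c0; near=> n; rewrite -ler_pdivrMr// div1r.
by near: n; exact: nbhs_infty_ger.
Unshelve. all: by end_near. Qed.

(** Smooth approximation of the indicator of a half-open interval. *)
Definition zeta (a b : R) (n : nat) (t : R) : R := sstep (n%:R * (t - a)) * sstep (1 + n%:R * (b - t)).

Lemma zeta_csmooth a b n : csmooth (zeta a b n).
Proof.
apply: csmoothM.
  rewrite (_ : (fun _ => _) = (fun s : R => sstep (n%:R * s + (- n%:R * a)))); last by apply/funext => s; congr sstep; ring.
  by apply: csmooth_aff; exact: sstep_csmooth.
rewrite (_ : (fun _ => _) = (fun s : R => sstep ((- n%:R) * s + (1 + n%:R * b)))); last by apply/funext => s; congr sstep; ring.
by apply: csmooth_aff; exact: sstep_csmooth.
Qed.

Lemma zeta_ge0 a b n t : 0 <= zeta a b n t. Proof. by rewrite mulr_ge0// sstep_ge0. Qed.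
Lemma zeta_le1 a b n t : zeta a b n t <= 1. Proof. by rewrite mulr_ile1 ?sstep_ge0 ?sstep_le1. Qed.

Lemma zeta_out a b n t : (0 < n)%N -> `|a| + `|b| + 1 < `|t| -> zeta a b n t = 0.
Proof.
move=> n0 tab; rewrite /zeta.
have n1 : 1 <= n%:R :> R by rewrite ler1n.
have [ta|ta] := leP t a; first by rewrite sstep0 ?mul0r// mulr_ge0_le0//; lra.
rewrite [X in _ * X]sstep0 ?mulr0//.
have : b + 1 <= t.
  have := ler_norm b; have := ler_norm (- a); rewrite normrN => ha hb.
  move: tab; have := normr_ge0 a; have := normr_ge0 b; rewrite ltr_normr => ? ? /orP[]; lra.
move=> bt; have : 1 <= n%:R * (t - b) by rewrite -[leLHS]mulr1 ler_pM//; lra.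
by rewrite -(opprB b t) mulrN; lra.
Qed.

Lemma zeta_cvg a b t : zeta a b n t @[n --> \oo] --> (\1_(`]a, b]%classic) t : R).
Proof.
rewrite indicE; case: (boolP (t \in _)) => [|].
  rewrite inE/= in_itv/= => /andP[at_ tb].
  apply: cvg_near_cst; near=> n; rewrite /zeta !sstep1 ?mulr1//.
    by rewrite lerDl mulr_ge0// subr_ge0.
  by near: n; apply: near_mul_ge1; rewrite subr_gt0.
rewrite notin_setE/= in_itv/= => /negP; rewrite negb_and -!leNgt -ltNge => /orP[ta|bt].
  apply: cvg_near_cst; near=> n; rewrite /zeta sstep0 ?mul0r//.
  by rewrite mulr_ge0_le0// subr_le0.
apply: cvg_near_cst; near=> n; rewrite /zeta [X in _ * X]sstep0 ?mulr0//.
rewrite -(opprB t b) mulrN subr_le0.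
by near: n; apply: near_mul_ge1; rewrite subr_gt0.
Unshelve. all: by end_near. Qed.

(** The added 1 covers the supports of the approximations [ztest] of the
    indicator of the box, which overlap the box by at most 1. *)
Definition obox_rad (a b : R3 R) : R := \sum_(j < 3) (`|coord j a| + `|coord j b|) + 1.

Definition ztest (a b : R3 R) n := tens (fun j => zeta (coord j a) (coord j b) n).

Lemma ztest_out (a b : R3 R) n j t : (0 < n)%N -> obox_rad a b < `|t| -> zeta (coord j a) (coord j b) n t = 0.
Proof.
move=> n0 H; apply: zeta_out => //; apply: le_lt_trans H.
by rewrite /obox_rad lerD2r (bigD1 j)//= lerDl sumr_ge0.
Qed.

Lemma ztest_supp a b n : (0 < n)%N -> supp_in (obox_rad a b) (ztest a b n).
Proof. by move=> n0; apply: tens_supp => j t; exact: ztest_out. Qed.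

Lemma ztest_test a b n : (0 < n)%N -> test_function (ztest a b n).
Proof.
move=> n0; apply: (@tens_test _ (obox_rad a b)) => [j|j t]; [exact: zeta_csmooth|exact: ztest_out].
Qed.

Lemma ztest_norm a b n x : `|ztest a b n x| <= 1.
Proof.
rewrite /ztest /tens ger0_norm; last by apply: mulr_ge0; [apply: mulr_ge0|]; exact: zeta_ge0.
apply: mulr_ile1; [apply: mulr_ge0; exact: zeta_ge0|exact: zeta_ge0| |exact: zeta_le1].
by apply: mulr_ile1; [exact: zeta_ge0|exact: zeta_ge0|exact: zeta_le1|exact: zeta_le1].
Qed.

Definition obox (a b : R3 R) : set (R3 R) := `]a.1.1, b.1.1]%classic `*` `]a.1.2, b.1.2]%classic `*` `]a.2, b.2]%classic.

Lemma oboxP (a b : R3 R) x : obox a b x <-> forall j, coord j a < coord j x <= coord j b.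
Proof.
split; first by move=> H; move: H; rewrite /obox /= !in_itv/= => -[[h0 h1] h2] j; elim/I3_ind: j.
by move=> H; rewrite /obox /= !in_itv/=; split; [split; [exact: (H 0)|exact: (H 1)]|exact: (H 2)].
Qed.

Definition obox_indic (a b : R3 R) : 'I_3 -> R -> R := fun j => \1_(`]coord j a, coord j b]%classic).

Lemma indic_obox a b x : \1_(obox a b) x = tens (obox_indic a b) x.
Proof. by rewrite /tens /obox_indic !indicE -!natrM !mulnb /obox !in_setX -andbA. Qed.

Lemma ztest_cvg a b x : ztest a b n x @[n --> \oo] --> (\1_(obox a b) x : R).
Proof. by rewrite indic_obox; apply: tens_cvg => j t; exact: zeta_cvg. Qed.

Lemma obox_measurable a b : measurable (obox a b : set (RR * RR * RR)).
Proof. by apply: measurableX; [apply: measurableX|]; exact: measurable_itv. Qed.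

Lemma obox_cube a b : obox a b `<=` cube3 (obox_rad a b).
Proof.
move=> x H j; have : `|coord j x| <= `|coord j a| + `|coord j b|.
  have : coord j a < coord j x <= coord j b.
    by move: H; rewrite /obox /= !in_itv/=; elim/I3_ind: j => -[[]].
  move=> /andP[h1 h2]; rewrite ler_norml.
  have := ler_norm (coord j b); have := ler_norm (- coord j a); rewrite normrN.
  have := normr_ge0 (coord j a); have := normr_ge0 (coord j b).
  by move=> ? ? ? ?; apply/andP; split; lra.
move=> /le_trans; apply; rewrite /obox_rad (bigD1 j)//= -addrA lerDl.
by apply: addr_ge0 => //; apply: sumr_ge0 => k _; exact: addr_ge0.
Qed.

Definition locint f := meas f /\ forall r, integ (fun x => f x * \1_(cube3 r) x).

Lemma L2_locint f : f \in L2 -> locint f.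
Proof.
move=> lf; split; first exact: L2_meas.
move=> r; apply: L2_mul => //; apply: (@supp_L2 _ _ r 1).
- by apply: measurable_indic; exact: cube3_measurable.
- by move=> x; rewrite indicE; case: (_ \in _); rewrite ?normr1 ?normr0.
- by move=> x xr; rewrite indicE memNset.
Qed.

Lemma test_box_cvg f a b : locint f ->
  \int[LL]_x (f x * ztest a b n.+1 x) @[n --> \oo] --> \int[LL]_x (f x * \1_(obox a b) x).
Proof.
move=> [mf Hf].
apply: (@dominated_Rint _ (fun n x => f x * ztest a b n.+1 x) _ (fun x => `|f x * \1_(cube3 (obox_rad a b)) x|)).
- by move=> n; apply: measurable_funM => //; apply: test_meas; exact: ztest_test.
- by apply: measurable_funM => //; apply: measurable_indic; exact: obox_measurable.
- move=> x; apply: cvgM; first exact: cvg_cst.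
  by rewrite (cvg_shiftS (fun n => ztest a b n x)); exact: ztest_cvg.
- exact: integ_norm.
- move=> n x; rewrite !(normrM (f x)) ler_wpM2l//.
  rewrite indicE; have [xr|xr] := pselect (cube3 (obox_rad a b) x).
    by rewrite mem_set// normr1 ztest_norm.
  by rewrite ztest_supp// normr0.
Qed.

Section dens. Variables (f : R3 R -> R) (mf : meas f) (f0 : forall x, 0 <= f x).
Let F (A : set (RR * RR * RR)) : \bar R := (\int[LL]_(x in A) (f x)%:E)%E.
Let F0 : F set0 = 0%E. Proof. by rewrite /F integral_set0. Qed.
Let Fge A : (0 <= F A)%E. Proof. by apply: integral_ge0 => x _; rewrite lee_fin. Qed.
Let Fs : semi_sigma_additive F.
Proof. by apply: semi_sigma_additive_nng_induced => //; exact/measurable_EFinP. Qed.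
Definition dens_measure : {measure set (RR * RR * RR) -> \bar R} := HB.pack F (isMeasure.Build _ _ _ F F0 Fge Fs).
Lemma dens_measureE A : dens_measure A = (\int[LL]_(x in A) (f x)%:E)%E. Proof. by []. Qed.
End dens.

Lemma Rint0_ae f : integ f -> (forall x, 0 <= f x) -> \int[LL]_x f x = 0 -> {ae LL, forall x, f x = 0}.
Proof.
move=> fi f0 If.
have E : (\int[LL]_x `|(EFin \o f) x| = 0)%E.
  rewrite (_ : (fun x => _) = (fun x => (f x)%:E)); last by apply/funext => x /=; rewrite ger0_norm.
  by rewrite Rint_EFin// If.
have mf : meas (EFin \o f) by apply/measurable_EFinP; exact: integ_meas.
have [/(_ E) + _] := ae_eq_integral_abs LL measurableT mf.
by apply: aeS => x /(_ I)/= [].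
Qed.

(** The positive and the negative part of the function are the densities of two
    measures that agree on boxes, hence everywhere. Testing this on the sets
    where the function has a constant sign shows that both parts vanish. *)
Lemma boxes_ae0 f : locint f -> (forall a b, \int[LL]_x (f x * \1_(obox a b) x) = 0) -> {ae LL, forall x, f x = 0}.
Proof.
move=> [mf Hf] H0.
pose p x := Num.max (f x) 0; pose q x := Num.max (- f x) 0.
have mp : meas p by apply: measurable_maxr => //.
have mq : meas q by apply: measurable_maxr => //; exact: measurableT_comp.
have p0 x : 0 <= p x by rewrite le_max lexx orbT.
have q0 x : 0 <= q x by rewrite le_max lexx orbT.
have fpq x : f x = p x - q x by rewrite /p /q; case: (ltP (f x) 0); case: (ltP (- f x) 0); lra.
have pf x : `|p x| <= `|f x| by rewrite (ger0_norm (p0 x)) /p ge_max normr_ge0 andbT ler_norm.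
have qf x : `|q x| <= `|f x| by rewrite (ger0_norm (q0 x)) /q ge_max normr_ge0 andbT -normrN ler_norm.
pose m1 := dens_measure mp p0.
pose m2 := dens_measure mq q0.
have iA g (A : set (RR * RR * RR)) r : meas g -> (forall x, `|g x| <= `|f x|) ->
    measurable A -> A `<=` cube3 r -> integ (fun x => g x * \1_A x).
  move=> mg gf mA Ar; apply: integ_le (Hf r); first by apply: measurable_funM => //; exact: measurable_indic.
  move=> x; rewrite !normrM; apply: ler_pM => //; rewrite !indicE.
  case: (boolP (x \in A)) => [xA|_]; last by rewrite normr0.
  by rewrite mem_set//; apply: Ar; exact: set_mem.
have dE g (mg : meas g) (g0 : forall x, 0 <= g x) (A : set (RR * RR * RR)) r : (forall x, `|g x| <= `|f x|) ->
    measurable A -> A `<=` cube3 r -> dens_measure mg g0 A = (\int[LL]_x (g x * \1_A x))%:E.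
  move=> gf mA Ar; rewrite dens_measureE -Rint_EFin; last exact: iA Ar.
  rewrite integral_mkcond; apply: eq_integral => x _.
  by rewrite /patch indicE; case: ifP => _; rewrite ?mulr1 ?mulr0.
have E (A : set (RR * RR * RR)) r : measurable A -> A `<=` cube3 r -> \int[LL]_x (f x * \1_A x) = \int[LL]_x (p x * \1_A x) - \int[LL]_x (q x * \1_A x).
  move=> mA Ar; rewrite -RintB; [|exact: iA Ar..].
  by apply: eq_Rint => x; rewrite fpq mulrBl.
have m12 : forall A, measurable A -> m1 A = m2 A.
  apply: measure3_unique => _ [a [b ->]]; rewrite /m1 /m2 -/(obox a b).
    rewrite !(dE _ _ _ _ (obox_rad a b))//; try exact: obox_measurable; try exact: obox_cube.
    by congr EFin; apply/eqP; rewrite -subr_eq0 -(E _ (obox_rad a b)) ?H0//; [exact: obox_measurable|exact: obox_cube].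
  by rewrite (dE _ _ _ _ (obox_rad a b)) ?ltry//; [exact: obox_measurable|exact: obox_cube].
have mc (r : R) := @cube3_measurable R r.
have mpos (r : R) : measurable (cube3 r `&` [set x | 0 <= f x] : set (RR * RR * RR)).
  by rewrite -[X in _ `&` X]setTI; apply: measurableI => //; apply: (measurable_fun_le (f := cst 0)).
have mneg (r : R) : measurable (cube3 r `&` [set x | f x <= 0] : set (RR * RR * RR)).
  by rewrite -[X in _ `&` X]setTI; apply: measurableI => //; apply: (measurable_fun_le (g := cst 0)).
have Z (A : set (RR * RR * RR)) r : measurable A -> A `<=` cube3 r -> \int[LL]_x (f x * \1_A x) = 0.
  move=> mA Ar; rewrite (E _ _ mA Ar); apply/eqP; rewrite subr_eq0; apply/eqP/EFin_inj.
  by rewrite -(dE _ mp p0 _ _ pf mA Ar) -(dE _ mq q0 _ _ qf mA Ar); exact: m12.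
have ic (A : set (RR * RR * RR)) x : (\1_A x = 0 :> R) \/ (A x /\ \1_A x = 1 :> R).
  have [xA|xA] := pselect (A x); first by right; rewrite indicE mem_set.
  by left; rewrite indicE memNset.
have aer (r : R) : {ae LL, forall x, cube3 r x -> f x = 0}.
  have r1 : cube3 r `&` [set x | 0 <= f x] `<=` cube3 r by move=> x [].
  have r2 : cube3 r `&` [set x | f x <= 0] `<=` cube3 r by move=> x [].
  have a1 := Rint0_ae (iA f _ r mf (fun x => lexx _) (mpos r) r1) _ (Z _ r (mpos r) r1).
  have a2 := Rint0_ae (integN (iA f _ r mf (fun x => lexx _) (mneg r) r2)) _ _.
  have {}a1 : {ae LL, forall x, f x * \1_(cube3 r `&` [set x | 0 <= f x]) x = 0}.
    by apply: a1 => x; have [->|[[_ /= h] ->]] := ic (cube3 r `&` [set x | 0 <= f x]) x; rewrite ?mulr0 ?mulr1.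
  have {}a2 : {ae LL, forall x, - (f x * \1_(cube3 r `&` [set x | f x <= 0]) x) = 0}.
    apply: a2 => [x|].
      by have [->|[[_ /= h] ->]] := ic (cube3 r `&` [set x | f x <= 0]) x; rewrite ?mulr0 ?mulr1 ?oppr0 ?oppr_ge0.
    rewrite RintN; last exact: iA r2.
    by rewrite (Z _ r (mneg r) r2) oppr0.
  apply: aeS (aeI a1 a2) => x [h1 h2] xr.
  have [fx|fx] := leP 0 (f x).
    by move: h1; rewrite indicE mem_set ?mulr1.
  by move/eqP: h2; rewrite oppr_eq0 indicE mem_set ?mulr1; [move/eqP|split => //; exact: ltW].
have := ae_all (fun n => aer n%:R); apply: aeS => x H.
have [n [[h1 h2] h3]] := obox3_exhaust x.
apply: (H n); apply/cube3P; move: h1 h2 h3 => /=; rewrite !in_itv/= !ler_norml.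
by move=> /andP[/ltW -> ->] /andP[/ltW -> ->] /andP[/ltW -> ->].
Qed.

Lemma fundamental_lemma f : locint f -> (forall phi, test_function phi -> \int[LL]_x (f x * phi x) = 0) ->
  {ae LL, forall x, f x = 0}.
Proof.
move=> lf H; apply: boxes_ae0 => // a b.
have := @test_box_cvg f a b lf.
rewrite (_ : (fun n => _) = fun=> 0); last by apply/funext => n; apply: H; exact: ztest_test.
by move=> K; apply: (cvg_unique (@Rhausdorff R) K (cvg_cst (0 : R))).
Qed.

End FundamentalLemma.

(** * Uniqueness of weak gradients *)

Section WeakGradientUnique.
Variable R : realType.
Notation LL := (@leb3 R).
Notation L2 := (Lfun (@leb3 R) 2%:E).
Implicit Types (u v f g phi psi : R3 R -> R) (i j : 'I_3) (x : R3 R).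


Lemma weak_partial_unique i u g1 g2 : g1 \in L2 -> g2 \in L2 -> is_weak_partial i u g1 -> is_weak_partial i u g2 ->
  {ae LL, forall x, g1 x = g2 x}.
Proof.
move=> l1 l2 w1 w2.
have l12 : (fun x => g1 x + (-1) * g2 x) \in L2 by apply: L2D => //; exact: L2Z.
have := fundamental_lemma (L2_locint l12); move=> H.
have : {ae LL, forall x, g1 x + (-1) * g2 x = 0}.
  apply: H => phi tp; have lp := test_L2 tp.
  have i1 := L2_mul l1 lp; have i2 := L2_mul l2 lp.
  rewrite (@eq_Rint R _ (fun x => g1 x * phi x - g2 x * phi x)); last by move=> x; ring.
  by rewrite RintB// -[X in X - _]opprK -w1// -[X in _ - X]opprK -w2// subrr.
by apply: aeS => x; rewrite mulN1r => /eqP; rewrite subr_eq0 => /eqP.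
Qed.

Lemma H1pP u : H1_R3 R u <-> exists G, H1p u G.
Proof.
split => [[lu H]|[G [lu H]]].
  have H' i : {g | g \in L2 /\ is_weak_partial i u g} by apply: cid; have [g] := H i; exists g.
  by exists (fun i => sval (H' i)); split => // i; exact: (svalP (H' i)).
by split => // i; have [lg wg] := H i; exists (G i).
Qed.

Lemma H1p_weak u G i : H1p u G -> weak_partial i u \in L2 /\ {ae LL, forall x, weak_partial i u x = G i x}.
Proof.
move=> [lu H]; have [lg wg] := H i.
have [lw ww] : weak_partial i u \in L2 /\ is_weak_partial i u (weak_partial i u).
  by rewrite /weak_partial; case: xgetP => [g _ []//|/(_ (G i))]; case.
by split => //; apply: weak_partial_unique lw lg ww wg.
Qed.

Lemma sum3 (V : zmodType) (F : 'I_3 -> V) : \sum_(i < 3) F i = F 0 + F 1 + F 2.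
Proof.
rewrite !big_ord_recl big_ord0 addr0 addrA.
have -> : lift ord0 ord0 = 1 :> 'I_3 by apply/val_inj.
by have -> : lift ord0 (lift ord0 ord0) = 2 :> 'I_3 by apply/val_inj.
Qed.

Lemma H1p_energy u G : H1p u G ->
  \int[LL]_x (weak_grad_sqr u x + u x ^+ 2) = \sum_(i < 3) \int[LL]_x (G i x ^+ 2) + \int[LL]_x (u x ^+ 2).
Proof.
move=> HG; have [lu H] := HG.
have lw i := (H1p_weak i HG).1; have aw i := (H1p_weak i HG).2.
have E i : \int[LL]_x (G i x ^+ 2) = \int[LL]_x (weak_partial i u x ^+ 2).
  apply: ae_eq_Rint.
  - exact: measurable_funX (L2_meas (H i).1).
  - exact: measurable_funX (L2_meas (lw i)).
  - by apply: aeS (aw i) => x ->.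
have S x : weak_grad_sqr u x = weak_partial 0 u x ^+ 2 + weak_partial 1 u x ^+ 2 + weak_partial 2 u x ^+ 2.
  exact: sum3.
have i01 := integD (L2_sqr (lw 0)) (L2_sqr (lw 1)).
have i012 := integD i01 (L2_sqr (lw 2)).
rewrite (@eq_Rint R _ (fun x => weak_partial 0 u x ^+ 2 + weak_partial 1 u x ^+ 2 + weak_partial 2 u x ^+ 2 + u x ^+ 2)); last by move=> x; rewrite S.
rewrite (RintD i012 (L2_sqr lu)) (RintD i01 (L2_sqr (lw 2))) (RintD (L2_sqr (lw 0)) (L2_sqr (lw 1))).
by rewrite sum3 !E.
Qed.

End WeakGradientUnique.

(** * Integrals over the two halves of a box *)

Section HalfBoxes.
Variable R : realType.
Notation RR := (measurableTypeR R).
Notation LL := (@leb3 R).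
Notation L2 := (Lfun (@leb3 R) 2%:E).
Notation meas f := (measurable_fun [set: RR * RR * RR] f).
Implicit Types (u v f g phi psi : R3 R -> R) (i j : 'I_3) (x : R3 R).
Notation integ f := (LL.-integrable setT (EFin \o (f : R3 R -> R))).

Definition vec3 (f : 'I_3 -> R) : R3 R := (f 0, f 1, f 2).
Lemma coord_vec3 (f : 'I_3 -> R) j : coord j (vec3 f) = f j.
Proof. by elim/I3_ind: j. Qed.

(** Smooth approximations of the tent of height [h] over an interval of length
    [2 h], and of its derivative, which is 1 on the left half of the interval
    and -1 on the right half. *)
Definition stent (c h : R) (n : nat) (t : R) : R :=
  n%:R^-1 * (sramp (n%:R * (t - c)) - 2 * sramp (n%:R * (t - c - h)) + sramp (n%:R * (t - c - 2 * h))).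
Definition dstent (c h : R) (n : nat) (t : R) : R :=
  sstep (n%:R * (t - c)) - 2 * sstep (n%:R * (t - c - h)) + sstep (n%:R * (t - c - 2 * h)).
Definition tent (c h t : R) : R := Num.max (t - c) 0 - 2 * Num.max (t - c - h) 0 + Num.max (t - c - 2 * h) 0.

Lemma csmooth_comp_aff (f : R -> R) (a b : R) : csmooth f -> csmooth (fun t => f (a * (t - b))).
Proof.
move=> cf; rewrite (_ : (fun _ => _) = (fun s : R => f (a * s + (- a * b)))); first exact: csmooth_aff.
by apply/funext => s; congr f; ring.
Qed.

Lemma is_derive_comp_aff (f g : R -> R) (a b t : R) : (forall s : R, is_derive s (1 : R) f (g s)) ->
  is_derive t (1 : R) (fun t => f (a * (t - b))) (g (a * (t - b)) * a).
Proof.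
move=> fg; apply: (@is_derive1_comp R f (fun t => a * (t - b))).
have := is_deriveZ a (is_deriveB (is_derive_id t (1 : R)) (is_derive_cst b t (1 : R))).
by rewrite /GRing.scale/= subr0 mulr1.
Qed.

Lemma stent_csmooth (c h : R) n : csmooth (stent c h n).
Proof.
rewrite /stent; apply: csmoothM; first exact: csmooth_cst.
rewrite (_ : (fun _ => _) = (fun t : R => (sramp (n%:R * (t - c)) + (-2) * sramp (n%:R * (t - (c + h)))) + sramp (n%:R * (t - (c + 2 * h))))); last first.
  by apply/funext => t; rewrite mulNr !opprD !addrA.
by apply: csmoothD; [apply: csmoothD; [|apply: csmoothM; [exact: csmooth_cst|]]|]; apply: csmooth_comp_aff; exact: sramp_csmooth.
Qed.

Lemma stent_derive (c h : R) n (t : R) : (0 < n)%N -> is_derive t (1 : R) (stent c h n) (dstent c h n t).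
Proof.
move=> n0; have n1 : n%:R != 0 :> R by rewrite pnatr_eq0 -lt0n.
have d1 := @is_derive_comp_aff _ _ n%:R c t (@sramp_derive R).
have d2 := @is_derive_comp_aff _ _ n%:R (c + h) t (@sramp_derive R).
have d3 := @is_derive_comp_aff _ _ n%:R (c + 2 * h) t (@sramp_derive R).
have := is_deriveZ n%:R^-1 (is_deriveD (is_deriveB d1 (is_deriveZ 2 d2)) d3).
rewrite /GRing.scale/=.
set F := (X in is_derive _ _ X _); set G := (X in is_derive _ _ _ X).
rewrite (_ : F = stent c h n); last first.
  apply/funext => s; change (n%:R^-1 * (sramp (n%:R * (s - c)) - 2 * sramp (n%:R * (s - (c + h))) +
    sramp (n%:R * (s - (c + 2 * h)))) = stent c h n s).
  by rewrite /stent !opprD !(addrA s).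
rewrite (_ : G = dstent c h n t)// /G /dstent !opprD !(addrA t).
by field.
Qed.

Lemma sstep_cvg (s : R) : sstep (n%:R * s) @[n --> \oo] --> ((0 < s)%R%:R : R).
Proof.
have [s0|s0] := ltP 0 s; apply: cvg_near_cst; near=> n.
  by apply: sstep1; near: n; exact: near_mul_ge1.
by apply: sstep0; rewrite mulr_ge0_le0.
Unshelve. all: by end_near. Qed.

Lemma sramp_le (s : R) n : (0 < n)%N -> `|n%:R^-1 * sramp (n%:R * s)| <= `|s|.
Proof.
move=> n0; have n1 : 0 < n%:R :> R by rewrite ltr0n.
have [s0|s0] := ltP s 0; first by rewrite sramp0 ?mulr0 ?normr0// mulr_ge0_le0// ltW.
have H : 0 <= n%:R * s by rewrite mulr_ge0.
have /andP[_ h2] := sramp_bound H.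
have h3 : 0 <= sramp (n%:R * s).
  have [h|/ltW h] := leP 1 (n%:R * s); first by have /andP[+ _] := sramp_bound H; lra.
  have := @sramp_derive R.
  have [->|/eqP] := eqVneq (n%:R * s) 0; first by rewrite sramp0.
  move=> nz D; have p : 0 < n%:R * s by rewrite lt_neqAle H andbT eq_sym; apply/eqP.
  have [d _] := MVT_all D p; rewrite (sramp0 (x := 0))// !subr0 => ->.
  by rewrite mulr_ge0 ?sstep_ge0.
by rewrite ger0_norm ?mulr_ge0 ?invr_ge0 ?(ltW n1)// ler_pdivrMl// (ger0_norm s0).
Qed.

Lemma sramp_cvg (s : R) : n%:R^-1 * sramp (n%:R * s) @[n --> \oo] --> Num.max s 0.
Proof.
have [s0|s0] := ltP s 0.
  apply: cvg_near_cst; near=> n; rewrite sramp0 ?mulr0//.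
  by rewrite mulr_ge0_le0// ltW.
apply: (@squeeze_cvgr _ _ _ _ (fun n : nat => s - n%:R^-1) (fun=> s)).
- near=> n; have n1 : 0 < n%:R :> R by rewrite ltr0n; near: n; exact: nbhs_infty_gt.
  have /andP[h1 h2] := sramp_bound (mulr_ge0 (ltW n1) s0).
  apply/andP; split; last by rewrite ler_pdivrMl.
  by rewrite ler_pdivlMl// mulrBr mulfV ?gt_eqF.
- rewrite -[X in _ --> X]subr0; apply: cvgB; first exact: cvg_cst.
  apply/cvgr0Pnorm_le => e e0; near=> n; have n1 : 0 < n%:R :> R by rewrite ltr0n; near: n; exact: nbhs_infty_gt.
  by rewrite gtr0_norm ?invr_gt0// -div1r ler_pdivrMr// mulrC; near: n; exact: near_mul_ge1.
- exact: cvg_cst.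
Unshelve. all: by end_near. Qed.

Lemma dstent_cvg (c h t : R) : 0 < h ->
  dstent c h n t @[n --> \oo] --> (\1_(`]c, c + h]%classic) t - \1_(`]c + h, c + 2 * h]%classic) t : R).
Proof.
move=> h0.
have -> : \1_(`]c, c + h]%classic) t - \1_(`]c + h, c + 2 * h]%classic) t =
   (0 < t - c)%R%:R - 2 * (0 < t - c - h)%R%:R + (0 < t - c - 2 * h)%R%:R :> R.
  rewrite !indicE !mem_setE !in_itv/= !subr_gt0.
  have -> : (h < t - c) = (c + h < t) by rewrite ltrBrDl.
  have -> : (2 * h < t - c) = (c + 2 * h < t) by rewrite ltrBrDl.
  case: (ltP c t); case: (ltP (c + h) t); case: (ltP (c + 2 * h) t) => /=; lra.
by apply: cvgD; [apply: cvgB; [|apply: cvgMr]|]; exact: sstep_cvg.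
Qed.

Lemma dstent_bound (c h t : R) n : `|dstent c h n t| <= 4.
Proof.
rewrite /dstent.
have B s := conj (sstep_ge0 (R := R) s) (sstep_le1 s).
have [? ?] := B (n%:R * (t - c)); have [? ?] := B (n%:R * (t - c - h)); have [? ?] := B (n%:R * (t - c - 2 * h)).
rewrite ler_norml; apply/andP; split; lra.
Qed.

Lemma stent_cvg (c h t : R) : stent c h n t @[n --> \oo] --> tent c h t.
Proof.
rewrite (_ : (fun n => _) = (fun n : nat => n%:R^-1 * sramp (n%:R * (t - c)) - 2 * (n%:R^-1 * sramp (n%:R * (t - c - h))) +
   n%:R^-1 * sramp (n%:R * (t - c - 2 * h)))); last by apply/funext => n; rewrite /stent; ring.
by apply: cvgD; [apply: cvgB; [|apply: cvgMr]|]; exact: sramp_cvg.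
Qed.

Lemma stent_bound (c h t : R) n : (0 < n)%N -> `|stent c h n t| <= 4 * (`|t| + `|c| + 2 * `|h|).
Proof.
move=> n0.
have -> : stent c h n t = n%:R^-1 * sramp (n%:R * (t - c)) - 2 * (n%:R^-1 * sramp (n%:R * (t - c - h))) +
   n%:R^-1 * sramp (n%:R * (t - c - 2 * h)) by rewrite /stent; ring.
have A : `|t - c| <= `|t| + `|c| by exact: ler_normB.
have B : `|t - c - h| <= `|t| + `|c| + `|h| by apply: (le_trans (ler_normB _ _)); rewrite lerD2r.
have C : `|t - c - 2 * h| <= `|t| + `|c| + 2 * `|h|.
  by apply: (le_trans (ler_normB _ _)); rewrite normrM (ger0_norm (ler0n _ 2)) lerD2r.
have := sramp_le (t - c) n0; have := sramp_le (t - c - h) n0; have := sramp_le (t - c - 2 * h) n0.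
set X := n%:R^-1 * _; set Y := n%:R^-1 * _; set Z := n%:R^-1 * _ => hX hY hZ.
apply: (le_trans (ler_normD _ _)); apply: (le_trans (lerD (ler_normB _ _) (lexx _))).
by rewrite (normrM 2) (ger0_norm (ler0n _ 2)); have := normr_ge0 h; lra.
Qed.

Lemma stent_out (c h t : R) n : 0 < h -> (0 < n)%N -> `|c| + 2 * h + 1 < `|t| -> stent c h n t = 0.
Proof.
move=> h0 n0 H; have n1 : 1 <= n%:R :> R by rewrite ler1n.
rewrite /stent; have [tc|tc] := leP t c.
  by rewrite !sramp0 ?mulr0 ?subr0 ?addr0 ?mulr0//; apply: mulr_ge0_le0 => //; lra.
have T : c + 2 * h + 1 <= t.
  have := ler_norm c; have := ler_norm (- c); rewrite normrN => ? ?.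
  by move: H; have := normr_ge0 c; rewrite ltr_normr => ? /orP[]; lra.
have G (s : R) : 1 <= s -> 1 <= n%:R * s by move=> s1; rewrite -[leLHS]mulr1 ler_pM.
have E (s : R) : 1 <= s -> sramp (n%:R * s) = sramp 1 + (n%:R * s - 1).
  by move=> s1; rewrite sramp1//; exact: G.
by rewrite !E; try lra; rewrite (_ : _ + _ = 0) ?mulr0//; ring.
Qed.

Lemma tent_bound (c h t : R) : 0 < h -> 0 <= tent c h t <= h * \1_(`]c, c + 2 * h]%classic) t.
Proof.
move=> h0; rewrite indicE mem_setE in_itv/= /tent.
case: (ltP (t - c) 0); case: (ltP (t - c - h) 0); case: (ltP (t - c - 2 * h) 0); case: (ltP c t); case: (leP t (c + 2 * h)) => /= *; rewrite ?mulr1 ?mulr0; apply/andP; split; lra.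
Qed.

Lemma measurable_tent (a h : R) : measurable_fun setT (tent a h).
Proof.
have M (s : R) : measurable_fun setT (fun t : R => Num.max (t - s) 0).
  by apply: measurable_maxr => //; apply: measurable_funB.
rewrite (_ : tent _ _ = fun t => Num.max (t - a) 0 - 2 * Num.max (t - (a + h)) 0 + Num.max (t - (a + 2 * h)) 0); last first.
  by apply/funext => t; rewrite /tent !opprD !(addrA t).
by apply: measurable_funD => //; apply: measurable_funB => //; apply: measurable_funM.
Qed.

Lemma tens_meas (f : 'I_3 -> R -> R) : (forall j, measurable_fun setT (f j)) -> meas (tens f).
Proof.
move=> mf.
have M j : meas (fun x => f j (coord j x)) by apply: (measurableT_comp (mf j)); exact: measurable_coord.
by apply: measurable_funM; [apply: measurable_funM|]; exact: M.
Qed.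

Lemma tens_bound (f : 'I_3 -> R -> R) i (M : R) x :
  (forall j, j != i -> `|f j (coord j x)| <= 1) -> (`|f i (coord i x)| <= M) -> `|tens f x| <= M.
Proof.
move=> H1 HM; have M0 : 0 <= M by exact: le_trans HM.
have P : `|tens f x| = \prod_(j < 3) `|f j (coord j x)|.
  rewrite /tens !normrM !big_ord_recl big_ord0 mulr1 mulrA.
  have -> : lift ord0 ord0 = 1 :> 'I_3 by apply/val_inj.
  by have -> : lift ord0 (lift ord0 ord0) = 2 :> 'I_3 by apply/val_inj.
rewrite P (bigD1 i)//= -[leRHS]mulr1; apply: ler_pM => //; first by apply: prodr_ge0.
by apply: prodr_ile1 => j ji; rewrite normr_ge0 H1.
Qed.

Lemma dominated_supp v (F : nat -> R3 R -> R) f r (M : R) : v \in L2 -> (forall n, meas (F n)) -> meas f ->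
  (forall n, supp_in r (F n)) -> (forall n x, cube3 r x -> `|F n x| <= M) -> (forall x, F n x @[n --> \oo] --> f x) ->
  \int[LL]_x (v x * F n x) @[n --> \oo] --> \int[LL]_x (v x * f x).
Proof.
move=> lv mF mf sF FM cF; have mv := L2_meas lv.
apply: (@dominated_Rint _ (fun n x => v x * F n x) _ (fun x => `|M| * `|v x * \1_(cube3 r) x|)).
- by move=> n; exact: measurable_funM.
- exact: measurable_funM.
- by move=> x; apply: cvgMr; exact: cF.
- by apply: integZ; apply: integ_norm; exact: (L2_locint lv).2.
- move=> n x; rewrite !(normrM (v x)); have [xr|xr] := pselect (cube3 r x).
    rewrite indicE mem_set// normr1 mulr1 mulrC ler_wpM2r//; exact: le_trans (FM _ _ xr) (ler_norm _).
  by rewrite sF// normr0 mulr0 !mulr_ge0.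
Qed.

(** Integration by parts against the function which is a tent in the direction
    [i] and an indicator in the other two: its derivative is the difference of
    the indicators of the two halves of the box. The weak gradient is
    defined by smooth functions only, hence the approximation. *)
Lemma tent_identity u G i (a b : R3 R) (h : R) : H1p u G -> 0 < h -> coord i b = coord i a + 2 * h ->
  \int[LL]_x (u x * \1_(obox a (b - h *: basis3 R i)) x) - \int[LL]_x (u x * \1_(obox (a + h *: basis3 R i) b) x)
  = - \int[LL]_x (G i x * tens (upd (obox_indic a b) i (tent (coord i a) h)) x).
Proof.
move=> [lu HG] h0 ab; have [lg wg] := HG i.
pose Z n : 'I_3 -> R -> R := fun j => zeta (coord j a) (coord j b) n.+1.
pose A n := upd (Z n) i (stent (coord i a) h n.+1).
pose B n := upd (Z n) i (dstent (coord i a) h n.+1).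
have AB n : upd (A n) i (dstent (coord i a) h n.+1) = B n.
  by apply/funext => j; rewrite /A /B /upd; case: eqP.
have cA n j : csmooth (A n j).
  by rewrite /A /upd; case: ifP => _; [exact: stent_csmooth|exact: zeta_csmooth].
pose r := obox_rad a b + 2 * h + 1.
have zr : 1 <= obox_rad a b by rewrite /obox_rad lerDr sumr_ge0// => k _; exact: addr_ge0.
have rz : obox_rad a b <= r by rewrite /r; lra.
have ra j : `|coord j a| <= obox_rad a b - 1.
  by rewrite /obox_rad addrK (bigD1 j)//= -addrA lerDl addr_ge0// sumr_ge0// => k _; exact: addr_ge0.
have A0 n j t : r < `|t| -> A n j t = 0.
  rewrite /A /upd; case: ifP => _ rt; first by apply: stent_out => //; apply: le_lt_trans rt; have := ra i; rewrite /r; lra.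
  by rewrite /Z; apply: (ztest_out (a := a) (b := b)) => //; exact: le_lt_trans rt.
have tA n : test_function (tens (A n)) by exact: (@tens_test _ (A n) r (cA n) (A0 n)).
have dA n x : partial i (tens (A n)) x = tens (B n) x.
  by rewrite -AB; apply: tens_partial => // t; rewrite /A upd_same; exact: stent_derive.
have I n : \int[LL]_x (u x * tens (B n) x) = - \int[LL]_x (G i x * tens (A n) x).
  by rewrite -(wg _ (tA n)); apply: eq_Rint => x; rewrite dA.
have cz j t : Z n j t @[n --> \oo] --> obox_indic a b j t.
  by rewrite /Z (cvg_shiftS (fun n => zeta (coord j a) (coord j b) n t)); exact: zeta_cvg.
pose D t : R := \1_(`]coord i a, coord i a + h]%classic) t - \1_(`]coord i a + h, coord i a + 2 * h]%classic) t.
have cB x : tens (B n) x @[n --> \oo] --> tens (upd (obox_indic a b) i D) x.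
  apply: tens_cvg => j t; rewrite /B /upd; case: eqP => [_|_]; last exact: cz.
  by rewrite (cvg_shiftS (fun n => dstent (coord i a) h n t)); exact: dstent_cvg.
have cAA x : tens (A n) x @[n --> \oo] --> tens (upd (obox_indic a b) i (tent (coord i a) h)) x.
  apply: tens_cvg => j t; rewrite /A /upd; case: eqP => [_|_]; last exact: cz.
  by rewrite (cvg_shiftS (fun n => stent (coord i a) h n t)); exact: stent_cvg.
have mind j : measurable_fun setT (obox_indic a b j) by apply: measurable_indic; exact: measurable_itv.
have mD : measurable_fun setT D by apply: measurable_funB; apply: measurable_indic; exact: measurable_itv.
have mT := measurable_tent (coord i a) h.
have mU (g : R -> R) : measurable_fun setT g -> meas (tens (upd (obox_indic a b) i g)).
  by move=> mg; apply: tens_meas => j; rewrite /upd; case: ifP.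
have sA n : supp_in r (tens (A n)) by apply: tens_supp; exact: A0.
have sB n : supp_in r (tens (B n)) by move=> x xr; rewrite -dA (supp_in_partial i (sA n)).
have mA n : meas (tens (A n)) by exact: test_meas.
have mB n : meas (tens (B n)).
  by rewrite (_ : tens (B n) = partial i (tens (A n))); [exact: test_meas (test_partial i (tA n))|apply/funext => x; rewrite dA].
have zb n j t : `|Z n j t| <= 1 by rewrite /Z ger0_norm ?zeta_ge0 ?zeta_le1.
have L1 : \int[LL]_x (u x * tens (B n) x) @[n --> \oo] --> \int[LL]_x (u x * tens (upd (obox_indic a b) i D) x).
  apply: (@dominated_supp u (fun n => tens (B n)) _ r 4) => //; first exact: mU.
  move=> n x _; apply: (@tens_bound _ i) => [j ji|]; first by rewrite /B /upd (negbTE ji).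
  by rewrite /B upd_same; exact: dstent_bound.
have L2' : \int[LL]_x (G i x * tens (A n) x) @[n --> \oo] --> \int[LL]_x (G i x * tens (upd (obox_indic a b) i (tent (coord i a) h)) x).
  apply: (@dominated_supp (G i) (fun n => tens (A n)) _ r (4 * (r + `|coord i a| + 2 * `|h|))) => //; first exact: mU.
  move=> n x xr; apply: (@tens_bound _ i) => [j ji|]; first by rewrite /A /upd (negbTE ji).
  rewrite /A upd_same; apply: le_trans (stent_bound _ _ _ _) _ => //.
  by rewrite ler_wpM2l// !lerD2r.
have -> : (- (\int[LL]_x (G i x * tens (upd (obox_indic a b) i (tent (coord i a) h)) x)) = \int[LL]_x (u x * tens (upd (obox_indic a b) i D) x)).
  have := cvgN L2'; rewrite (_ : (- (fun n => _)) = (fun n => \int[LL]_x (u x * tens (B n) x))); last by apply/funext => n; rewrite I.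
  move=> K; exact: (cvg_unique (@Rhausdorff R) (K _) L1).
have tl (g1 g2 : R -> R) x : tens (upd (obox_indic a b) i (fun t => g1 t - g2 t)) x = tens (upd (obox_indic a b) i g1) x - tens (upd (obox_indic a b) i g2) x.
  by rewrite /tens /upd; elim/I3_ind: (i) => /=; ring.
have E1 : obox_indic a (b - h *: basis3 R i) = upd (obox_indic a b) i \1_(`]coord i a, coord i a + h]%classic).
  apply/funext => j; rewrite /upd /obox_indic coordD coordN coordZ coord_basis eq_sym.
  case: eqP => [->|_]; last by rewrite mulr0 subr0.
  by rewrite mulr1 ab (_ : coord i a + 2 * h - h = coord i a + h)//; ring.
have E2 : obox_indic (a + h *: basis3 R i) b = upd (obox_indic a b) i \1_(`]coord i a + h, coord i a + 2 * h]%classic).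
  apply/funext => j; rewrite /upd /obox_indic coordD coordZ coord_basis eq_sym.
  case: eqP => [->|_]; last by rewrite mulr0 addr0.
  by rewrite mulr1 ab.
have lob (c d : R3 R) : integ (fun x => u x * \1_(obox c d) x).
  apply: L2_mul => //; apply: (@supp_L2 _ _ (obox_rad c d) 1).
  - by apply: measurable_indic; exact: obox_measurable.
  - by move=> x; rewrite indicE; case: (_ \in _); rewrite ?normr1 ?normr0.
  - by move=> x xr; rewrite indicE memNset//; apply: contra_not xr; exact: obox_cube.
rewrite -RintB//; apply: eq_Rint => x.
by rewrite !indic_obox E1 E2 -mulrBr /D tl.
Qed.

End HalfBoxes.

(** * Boxes similar to their halves *)

Section SelfSimilarBoxes.
Variable R : realType.
Notation RR := (measurableTypeR R).
Notation LL := (@leb3 R).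
Notation L2 := (Lfun (@leb3 R) 2%:E).
Notation meas f := (measurable_fun [set: RR * RR * RR] f).
Implicit Types (u v f g phi psi : R3 R -> R) (i j : 'I_3) (x c : R3 R) (l : R).
Notation integ f := (LL.-integrable setT (EFin \o (f : R3 R -> R))).

(** A box whose edges are proportional to [rho^2, rho, 1], with [rho^3 = 2], is
    halved across its longest edge into two boxes of the same shape, smaller by
    the factor [rho], with the next direction as longest edge. Bisection then
    never deforms the boxes, and the estimates are scale invariant. *)
Definition rho : R := 2 `^ (3^-1).

Lemma rho3 : rho ^+ 3 = 2.
Proof. by rewrite /rho -powR_mulrn ?powR_ge0// -powRrM mulVf ?powRr1. Qed.
Lemma rho_gt0 : 0 < rho. Proof. by rewrite powR_gt0. Qed.
Lemma rho_gt1 : 1 < rho.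
Proof.
rewrite ltNge; apply/negP => H; have : rho ^+ 3 <= 1 by rewrite exprn_ile1 ?(ltW rho_gt0).
by rewrite rho3; lra.
Qed.
Lemma rho_lt2 : rho < 2.
Proof.
have := rho3; have := rho_gt1; rewrite !exprS expr0 => h1 h3; nra.
Qed.

(** Length of the edge [j] of a box whose longest edge is [i] and whose shortest
    edge is [l]. The index [j - i] is taken modulo 3. *)
Definition side i l j : R := l * rho ^+ (2 - (j - i)%R)%N.

Lemma side_gt0 i l j : 0 < l -> 0 < side i l j.
Proof. by move=> l0; rewrite mulr_gt0// exprn_gt0// rho_gt0. Qed.

Lemma side_same i l : side i l i = 2 * (l / rho).
Proof. by rewrite /side subrr/= -rho3; have := rho_gt0 => r0; field; rewrite gt_eqF. Qed.

Lemma side_next i l j : side (i + 1) (l / rho) j = side i l j - (i == j)%:R * (l / rho).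
Proof.
have r0 : rho != 0 by rewrite gt_eqF// rho_gt0.
have E (a : R) : l / rho * rho = l by field.
have [<-|ij] := eqVneq i j.
  rewrite side_same mul1r /side (_ : (2 - _)%N = 0%N) ?expr0; first by ring.
  by rewrite opprD addrA subrr add0r.
rewrite mul0r subr0 /side.
have : j - i = 1 \/ j - i = 2.
  have : j - i != 0 by rewrite subr_eq0 eq_sym.
  by elim/I3_ind: (j - i) => //; [left|right].
rewrite opprD addrA => -[->|->].
  by have -> : nat_of_ord (1 - 1 : 'I_3)%R = 0%N by []; rewrite /=; field.
by have -> : nat_of_ord (2 - 1 : 'I_3)%R = 1%N by []; rewrite /=; field.
Qed.

Definition box i c l : set (R3 R) := obox c (c + vec3 (side i l)).

Lemma boxP i c l x : box i c l x <-> forall j, coord j c < coord j x <= coord j c + side i l j.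
Proof. by rewrite /box oboxP; split => H j; have := H j; rewrite coordD coord_vec3. Qed.

Lemma ext3 (x y : R3 R) : (forall j, coord j x = coord j y) -> x = y.
Proof.
by move=> H; have := H 0; have := H 1; have := H 2; move: x y {H} => [[x0 x1] x2] [[y0 y1] y2]; rewrite /coord /= => -> -> ->.
Qed.

Lemma box_left i c l : box (i + 1) c (l / rho) = obox c (c + vec3 (side i l) - (l / rho) *: basis3 R i).
Proof.
rewrite /box; congr obox; apply: ext3 => j.
rewrite !(coordD, coordN, coordZ) coord_basis !coord_vec3 side_next; ring.
Qed.

Lemma box_right i c l : box (i + 1) (c + (l / rho) *: basis3 R i) (l / rho) = obox (c + (l / rho) *: basis3 R i) (c + vec3 (side i l)).
Proof.
rewrite /box; congr obox; apply: ext3 => j.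
rewrite !(coordD, coordN, coordZ) coord_basis !coord_vec3 side_next; ring.
Qed.

Lemma box_split i c l x : 0 < l -> \1_(box i c l) x = \1_(box (i + 1) c (l / rho)) x + \1_(box (i + 1) (c + (l / rho) *: basis3 R i) (l / rho)) x :> R.
Proof.
move=> l0; have h0 : 0 < l / rho by rewrite divr_gt0// rho_gt0.
have PL : box (i + 1) c (l / rho) x <-> box i c l x /\ coord i x <= coord i c + l / rho.
  split.
    move=> /boxP H; split.
      by apply/boxP => j; have := H j; rewrite side_next; case: (i == j) => /= /andP[-> h] /=; lra.
    by have := H i; rewrite side_next eqxx side_same mul1r => /andP[_]; lra.
  move=> [/boxP H Hi]; apply/boxP => j; have := H j; rewrite side_next.
  have [<-|ij] := eqVneq i j => /=; first by rewrite side_same mul1r => /andP[-> _]/=; lra.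
  by rewrite mul0r subr0.
have PR : box (i + 1) (c + (l / rho) *: basis3 R i) (l / rho) x <-> box i c l x /\ coord i c + l / rho < coord i x.
  split.
    move=> /boxP H; split.
      apply/boxP => j; have := H j; rewrite side_next coordD coordZ coord_basis.
      by case: (i == j) => /= /andP[h1 h2]; apply/andP; split; lra.
    by have := H i; rewrite coordD coordZ coord_basis eqxx mulr1 => /andP[].
  move=> [/boxP H Hi]; apply/boxP => j; have := H j; rewrite side_next coordD coordZ coord_basis.
  have [<-|ij] := eqVneq i j => /= /andP[h1 h2]; apply/andP; split; lra.
have [xb|xb] := pselect (box i c l x); last first.
  by rewrite !indicE !memNset ?addr0//; [move=> /PR[]|move=> /PL[]].
have [h|h] := leP (coord i x) (coord i c + l / rho).
  by rewrite !indicE mem_set// mem_set ?memNset ?addr0//; [move=> /PR[_]; rewrite ltNge h|apply/PL].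
by rewrite !indicE mem_set// memNset ?mem_set ?add0r//; [apply/PR|move=> /PL[_]; rewrite leNgt h].
Qed.

Lemma box_measurable i c l : measurable (box i c l : set (RR * RR * RR)).
Proof. exact: obox_measurable. Qed.

Definition box_int f i c l : R := \int[LL]_x (f x * \1_(box i c l) x).

Lemma locint_obox f (a b : R3 R) : locint f -> integ (fun x => f x * \1_(obox a b) x).
Proof.
move=> [mf Hf]; apply: integ_le (Hf (obox_rad a b)).
  by apply: measurable_funM => //; apply: measurable_indic; exact: obox_measurable.
move=> x; rewrite !(normrM (f x)) ler_wpM2l// !indicE.
case: (boolP (x \in obox a b)) => [xA|_]; last by rewrite normr0.
by rewrite mem_set//; apply: obox_cube; exact: set_mem.
Qed.

Lemma locint_box f i c l : locint f -> integ (fun x => f x * \1_(box i c l) x).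
Proof. exact: locint_obox. Qed.

Lemma integ_locint f : integ f -> locint f.
Proof.
move=> fi; split; first exact: integ_meas.
move=> r; apply: (integ_le _ _ fi).
  by apply: measurable_funM; [exact: integ_meas|apply: measurable_indic; exact: cube3_measurable].
move=> x; rewrite normrM ler_piMr// indicE.
by case: (_ \in _); rewrite ?normr1 ?normr0.
Qed.

Lemma box_int_split f i c l : locint f -> 0 < l -> box_int f i c l = box_int f (i + 1) c (l / rho) + box_int f (i + 1) (c + (l / rho) *: basis3 R i) (l / rho).
Proof.
move=> lf l0; rewrite /box_int -RintD; [|exact: locint_box..].
by apply: eq_Rint => x; rewrite (box_split _ _ _ l0) mulrDr.
Qed.

Lemma box_int_ge0 f i c l : (forall x, 0 <= f x) -> 0 <= box_int f i c l.
Proof. by move=> f0; apply: Rint_ge0 => x; rewrite mulr_ge0. Qed.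

Lemma box_int_le f i c l : (forall x, 0 <= f x) -> integ f -> box_int f i c l <= \int[LL]_x f x.
Proof.
move=> f0 fi; apply: Rint_le => //; first exact: locint_box (integ_locint fi).
by move=> x; rewrite ler_piMr.
Qed.

Lemma box_vol i c l : 0 < l -> LL (box i c l) = (2 * l ^+ 3)%:E.
Proof.
move=> l0; rewrite /box /obox leb3_setX; try exact: measurable_itv.
have H j : lebesgue_measure `]coord j c, coord j (c + vec3 (side i l))] = (side i l j)%:E.
  rewrite lebesgue_measure_itv/= lte_fin coordD coord_vec3 ltrDl side_gt0// -EFinB.
  by congr EFin; ring.
rewrite (H 0) (H 1) (H 2) -!EFinM; congr EFin.
by rewrite /side -rho3; elim/I3_ind: i {H}; rewrite /=; ring.
Qed.

Lemma box_int_cst1 i c l : 0 < l -> box_int (fun=> 1) i c l = 2 * l ^+ 3.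
Proof.
move=> l0; rewrite /box_int (eq_Rint (g := \1_(box i c l))); last by move=> x; rewrite mul1r.
by rewrite /Rintegral integral_indic ?setIT ?box_vol//; exact: box_measurable.
Qed.

Lemma locint_cst (k : R) : locint (fun _ : R3 R => k).
Proof. by split => // r; apply: integZ; exact: integ_cube. Qed.

Lemma box_int_CS u i c l : u \in L2 -> 0 < l -> (box_int u i c l) ^+ 2 <= 2 * l ^+ 3 * box_int (fun x => u x ^+ 2) i c l.
Proof.
move=> lu l0; have l3 : 0 < l ^+ 3 by rewrite exprn_gt0.
set a := box_int u i c l; set V := 2 * l ^+ 3; have V0 : 0 < V by rewrite mulr_gt0.
have i1 := locint_box i c l (integ_locint (L2_sqr lu)).
have i2 := locint_box i c l (L2_locint lu).
have i3 := locint_box i c l (locint_cst 1).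
have : 0 <= \int[LL]_x (u x ^+ 2 * \1_(box i c l) x - (2 * (a / V)) * (u x * \1_(box i c l) x) + (a / V) ^+ 2 * (1 * \1_(box i c l) x)).
  apply: Rint_ge0 => x.
  rewrite (_ : _ + _ = (u x - a / V) ^+ 2 * \1_(box i c l) x); last by ring.
  by rewrite mulr_ge0 ?sqr_ge0.
rewrite RintD; [|apply: integB => //; exact: integZ|exact: integZ].
rewrite RintB//; last exact: integZ.
rewrite (RintZ _ i2) (RintZ _ i3) -/(box_int u i c l) -/(box_int (fun=> 1) i c l) -/(box_int (fun x => u x ^+ 2) i c l) box_int_cst1// -/a -/V.
set b := box_int _ _ _ _ => H.
have E : V * (b - 2 * (a / V) * a + (a / V) ^+ 2 * V) = V * b - a ^+ 2 by field; rewrite gt_eqF.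
by rewrite -subr_ge0 -E mulr_ge0// ltW.
Qed.

Section rec.
Variables (u : R3 R -> R) (G : 'I_3 -> R3 R -> R) (HG : H1p u G).

Definition usq x : R := u x ^+ 2.
Definition gsq x : R := G 0 x ^+ 2 + G 1 x ^+ 2 + G 2 x ^+ 2.

Lemma H1p_L2 : u \in L2. Proof. by case: HG. Qed.
Lemma H1p_gradL2 i : G i \in L2. Proof. by case: HG => _ /(_ i)[]. Qed.
Lemma int_usq : integ usq. Proof. exact: L2_sqr H1p_L2. Qed.
Lemma int_gsq : integ gsq.
Proof. by apply: integD; [apply: integD|]; exact: L2_sqr (H1p_gradL2 _). Qed.
Lemma usq_ge0 x : 0 <= usq x. Proof. exact: sqr_ge0. Qed.
Lemma gsq_ge0 x : 0 <= gsq x. Proof. by rewrite !addr_ge0 ?sqr_ge0. Qed.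
Lemma gsq_ge i x : G i x ^+ 2 <= gsq x.
Proof.
have := sqr_ge0 (G 0 x); have := sqr_ge0 (G 1 x); have := sqr_ge0 (G 2 x).
by rewrite /gsq; elim/I3_ind: i; lra.
Qed.

(** Poincare inequality for the two halves of a box. The tent in
    [tent_identity] has height [l / rho <= l], and the Cauchy-Schwarz
    inequality on the box, of volume [2 l^3], does the rest. *)
Lemma half_diff i c l : 0 < l ->
  (box_int u (i + 1) c (l / rho) - box_int u (i + 1) (c + (l / rho) *: basis3 R i) (l / rho)) ^+ 2 <= l ^+ 2 * (2 * l ^+ 3 * box_int gsq i c l).
Proof.
move=> l0; have h0 : 0 < l / rho by rewrite divr_gt0// rho_gt0.
have hl : l / rho <= l by rewrite ler_pdivrMr ?rho_gt0// ler_peMr ?(ltW l0)// ltW// rho_gt1.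
rewrite /box_int box_left box_right (@tent_identity _ u G i c (c + vec3 (side i l)) (l / rho) HG h0); last first.
  by rewrite coordD coord_vec3 side_same.
set T := tens _.
have TB x : `|T x| <= (l / rho) * \1_(box i c l) x.
  rewrite /T /box indic_obox; set b := c + _.
  have E : (l / rho) * tens (obox_indic c b) x = tens (upd (obox_indic c b) i (fun t => (l / rho) * \1_(`]coord i c, coord i b]%classic) t)) x.
    by rewrite /tens /upd; elim/I3_ind: (i) => /=; rewrite /obox_indic; ring.
  rewrite E.
  have P j : 0 <= upd (obox_indic c b) i (tent (coord i c) (l / rho)) j (coord j x) <=
     upd (obox_indic c b) i (fun t => (l / rho) * \1_(`]coord i c, coord i b]%classic) t) j (coord j x).
    rewrite /upd; case: eqP => [->|_]; last by rewrite lexx andbT /obox_indic indicE.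
    by have := tent_bound (coord i c) (coord i x) h0; rewrite /b coordD coord_vec3 side_same.
  have /andP[p0 q0] := P 0; have /andP[p1 q1] := P 1; have /andP[p2 q2] := P 2.
  rewrite ger0_norm; last by rewrite /tens; apply: mulr_ge0 => //; apply: mulr_ge0.
  by rewrite /tens; apply: ler_pM => //; [apply: mulr_ge0|apply: ler_pM].
have mT : meas T.
  apply: tens_meas => j; rewrite /upd; case: ifP => _; first exact: measurable_tent.
  by apply: measurable_indic; exact: measurable_itv.
have lg := H1p_gradL2 i.
have iGT : integ (fun x => G i x * T x).
  apply: integ_le (integZ (l / rho) (locint_box i c l (L2_locint lg))).
    by apply: measurable_funM => //; exact: L2_meas.
  move=> x; rewrite [X in _ <= `|X|]mulrCA !(normrM (G i x)) ler_wpM2l//; apply: le_trans (TB x) (ler_norm _).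
have nG : (fun x => `|G i x|) \in L2.
  apply: L2_intro; first by apply: measurableT_comp => //; exact: L2_meas.
  by apply: eq_integ (L2_sqr lg) => x; rewrite real_normK// num_real.
have K : `|\int[LL]_x (G i x * T x)| <= (l / rho) * box_int (fun x => `|G i x|) i c l.
  apply: le_trans (Rint_norm iGT) _; rewrite /box_int -RintZ; last exact: locint_box (L2_locint nG).
  apply: Rint_le; [exact: integ_norm|exact: integZ (locint_box i c l (L2_locint nG))|].
  by move=> x; rewrite (normrM (G i x)) [leRHS]mulrCA ler_wpM2l.
rewrite sqrrN -(real_normK (num_real _)).
have JG0 : 0 <= box_int (fun x => `|G i x|) i c l by exact: box_int_ge0.
apply: (@le_trans _ _ ((l * box_int (fun x => `|G i x|) i c l) ^+ 2)).
  rewrite ler_pXn2r ?nnegrE ?mulr_ge0 ?(ltW l0)//.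
  by apply: le_trans K _; rewrite ler_wpM2r.
rewrite exprMn ler_wpM2l ?sqr_ge0//; apply: le_trans (box_int_CS i c nG l0) _.
rewrite ler_wpM2l ?mulr_ge0 ?exprn_ge0 ?(ltW l0)// /box_int.
apply: Rint_le; [exact: locint_box (integ_locint (L2_sqr nG))|exact: locint_box (integ_locint int_gsq)|].
move=> x; rewrite ler_wpM2r// real_normK ?num_real//; exact: gsq_ge.
Qed.

(** The sum, over the [2^n] boxes obtained by [n] successive bisections, of the
    cube of the absolute average of [u] times the volume: the cubic integral
    of the average of [u] at that scale. *)
Fixpoint avg_cube n i c l : R := if n is n'.+1 then
  avg_cube n' (i + 1) c (l / rho) + avg_cube n' (i + 1) (c + (l / rho) *: basis3 R i) (l / rho)
  else `|box_int u i c l / (2 * l ^+ 3)| ^+ 3 * (2 * l ^+ 3).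

(** Quantitative form of the convexity of the cube: what is lost when two
    averages are replaced by their mean is of second order in their
    difference. *)
Lemma cube_mean (x y : R) : (`|x| ^+ 3 + `|y| ^+ 3) / 2 <= `|(x + y) / 2| ^+ 3 + (`|x| + `|y|) * (x - y) ^+ 2 / 2.
Proof.
have K (a b : R) : 0 <= a -> 0 <= b -> (a ^+ 3 + b ^+ 3) / 2 <= ((a + b) / 2) ^+ 3 + (a + b) * (a - b) ^+ 2 / 2.
  move=> a0 b0.
  have -> : ((a + b) / 2) ^+ 3 + (a + b) * (a - b) ^+ 2 / 2 = (a ^+ 3 + b ^+ 3) / 2 + (a + b) * (a - b) ^+ 2 / 8.
    by field.
  rewrite lerDl; apply: divr_ge0 => //; apply: mulr_ge0; [exact: addr_ge0|exact: sqr_ge0].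
have K2 (a b : R) : 0 <= a -> 0 <= b -> (a ^+ 3 + b ^+ 3) / 2 <= (a + b) * (a + b) ^+ 2 / 2.
  move=> a0 b0; rewrite ler_pM2r//.
  have -> : (a + b) * (a + b) ^+ 2 = a ^+ 3 + b ^+ 3 + 3 * (a * b * (a + b)) by ring.
  rewrite lerDl; apply: mulr_ge0 => //; apply: mulr_ge0; [exact: mulr_ge0|exact: addr_ge0].
have [x0|/ltW x0] := leP 0 x; have [y0|/ltW y0] := leP 0 y.
- rewrite !ger0_norm ?divr_ge0 ?addr_ge0//; exact: K.
- apply: (@le_trans _ _ ((`|x| + `|y|) * (x - y) ^+ 2 / 2)); last by rewrite lerDr exprn_ge0.
  rewrite (_ : x - y = `|x| + `|y|); last by rewrite ger0_norm// ler0_norm.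
  exact: K2.
- apply: (@le_trans _ _ ((`|x| + `|y|) * (x - y) ^+ 2 / 2)); last by rewrite lerDr exprn_ge0.
  rewrite (_ : (x - y) ^+ 2 = (`|x| + `|y|) ^+ 2); last by rewrite ler0_norm// ger0_norm//; ring.
  exact: K2.
- have s0 : (x + y) / 2 <= 0 by lra.
  rewrite !ler0_norm//.
  have := K (- x) (- y); rewrite !oppr_ge0 => /(_ x0 y0).
  rewrite (_ : - x - - y = - (x - y)); last by ring.
  by rewrite sqrrN (_ : (- x - y) / 2 = - ((x + y) / 2)); last field.
Qed.

Definition sig : R := Num.sqrt rho.
Lemma sig2 : sig ^+ 2 = rho. Proof. by rewrite sqr_sqrtr// ltW// rho_gt0. Qed.
Lemma sig_gt0 : 0 < sig. Proof. by rewrite sqrtr_gt0 rho_gt0. Qed.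
Lemma sig_gt1 : 1 < sig.
Proof.
rewrite ltNge; apply/negP => H; have := rho_gt1; rewrite -sig2 ltNge => /negP; apply.
by rewrite exprn_ile1 ?(ltW sig_gt0).
Qed.
(** The sum of the geometric series [4 (1 + 1/sig + 1/sig^2 + ...)]. *)
Definition C0 : R := 4 * sig / (sig - 1).
Lemma C0_eq : C0 = 4 + C0 / sig.
Proof. by rewrite /C0; field; rewrite !gt_eqF ?sig_gt0// subr_gt0 sig_gt1. Qed.
Lemma C0_ge4 : 4 <= C0.
Proof.
rewrite C0_eq lerDl /C0 !divr_ge0 ?(ltW sig_gt0)//; first by rewrite mulr_ge0// ltW// sig_gt0.
by rewrite subr_ge0 ltW// sig_gt1.
Qed.

Lemma vol_child l : 2 * (l / rho) ^+ 3 = l ^+ 3.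
Proof. by rewrite expr_div_n rho3; field. Qed.
End rec.

End SelfSimilarBoxes.

(** * The stopping argument *)

Section Stopping.
Variable R : realType.
Notation LL := (@leb3 R).
Implicit Types (u v f g phi psi : R3 R -> R) (i j : 'I_3) (x c : R3 R) (l t : R).
Notation rho := (@rho R).
Notation sig := (@sig R).
Notation C0 := (@C0 R).

Section rec.
Variables (u : R3 R -> R) (G : 'I_3 -> R3 R -> R) (HG : H1p u G).
Notation J := (@box_int R).
Notation X := (avg_cube u).
Notation aa := (J (usq u)).
Notation bb := (J (gsq G)).
Notation c' i c l := (c + (l / rho) *: basis3 R i).

Lemma aa_split i c l : 0 < l -> aa i c l = aa (i + 1) c (l / rho) + aa (i + 1) (c' i c l) (l / rho).
Proof. by move=> l0; apply: box_int_split => //; exact/integ_locint/(int_usq HG). Qed.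
Lemma bb_split i c l : 0 < l -> bb i c l = bb (i + 1) c (l / rho) + bb (i + 1) (c' i c l) (l / rho).
Proof. by move=> l0; apply: box_int_split => //; exact/integ_locint/(int_gsq HG). Qed.
Lemma aa_ge0 i c l : 0 <= aa i c l.
Proof. by apply: box_int_ge0 => x; exact: usq_ge0. Qed.
Lemma bb_ge0 i c l : 0 <= bb i c l.
Proof. by apply: box_int_ge0 => x; exact: gsq_ge0. Qed.
Lemma mean_sqr i c l : 0 < l -> (J u i c l / (2 * l ^+ 3)) ^+ 2 * (2 * l ^+ 3) <= aa i c l.
Proof.
move=> l0; have V0 : 0 < 2 * l ^+ 3 by rewrite mulr_gt0// exprn_gt0.
rewrite -(ler_pM2r V0) (_ : _ * _ * _ = J u i c l ^+ 2); last by field; rewrite gt_eqF.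
by rewrite mulrC; apply: box_int_CS => //; exact: H1p_L2 HG.
Qed.

Lemma sqr_le_le (x y : R) : 0 <= y -> x ^+ 2 <= y ^+ 2 -> `|x| <= y.
Proof. by move=> y0; rewrite -(real_normK (num_real x)) ler_pXn2r ?nnegrE. Qed.

Lemma mean_good i c l t : 0 < l -> 0 <= t -> aa i c l * l <= t ^+ 2 -> `|J u i c l / (2 * l ^+ 3)| <= t / l ^+ 2.
Proof.
move=> l0 t0 H; have := mean_sqr i c l0; set m := _ / _ => M.
apply: sqr_le_le; first by rewrite divr_ge0 ?exprn_ge0// ltW.
rewrite -(ler_pM2r (exprn_gt0 4 l0)).
have -> : (t / l ^+ 2) ^+ 2 * l ^+ 4 = t ^+ 2 by field; rewrite gt_eqF.
have P : 0 <= m ^+ 2 * l ^+ 4 by apply: mulr_ge0; [exact: sqr_ge0|exact: exprn_ge0 (ltW l0)].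
apply: le_trans H; apply: (@le_trans _ _ (m ^+ 2 * (2 * l ^+ 3) * l)); last by rewrite ler_pM2r.
rewrite (_ : m ^+ 2 * _ * l = m ^+ 2 * l ^+ 4 + m ^+ 2 * l ^+ 4); last by ring.
by rewrite lerDl.
Qed.

Lemma mean_cube i c l (s : R) : 0 < l -> `|J u i c l / (2 * l ^+ 3)| <= s -> `|J u i c l / (2 * l ^+ 3)| ^+ 3 * (2 * l ^+ 3) <= s * aa i c l.
Proof.
move=> l0; have := mean_sqr i c l0; set m := _ / _ => M H.
rewrite exprS -mulrA real_normK ?num_real//; apply: ler_pM => //.
by apply: mulr_ge0; [exact: sqr_ge0|rewrite mulr_ge0// exprn_ge0// ltW].
Qed.

(** Call a box good at level [t] if [l a <= t^2], where [a] is the integral of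
    [u^2]. Its average and those of its halves are then at most [t / l^2] in
    absolute value. By [cube_mean] and [half_diff] one bisection costs at most
    [4 t b], where [b] is the integral of the square of the gradient. The two halves
    are good at level [t / sig], as [l] drops by [rho = sig^2], and therefore
    the costs add up to a geometric series. *)
Lemma avg_cube_good n i c l t : 0 < l -> 0 <= t -> aa i c l * l <= t ^+ 2 ->
  X n i c l <= `|J u i c l / (2 * l ^+ 3)| ^+ 3 * (2 * l ^+ 3) + C0 * t * bb i c l.
Proof.
have r0 := @rho_gt0 R; have s0 := @sig_gt0 R; have C4 := @C0_ge4 R.
elim: n i c l t => [|n IH] i c l t l0 t0 H.
  by rewrite /= lerDl; apply: mulr_ge0 (bb_ge0 _ _ _); apply: mulr_ge0 => //; lra.
have h0 : 0 < l / rho by rewrite divr_gt0.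
have hl : l / rho <= l by rewrite ler_pdivrMr// ler_peMr ?(ltW l0)// ltW// rho_gt1.
have T0 : 0 <= t / sig by rewrite divr_ge0// ltW.
have TE : (t / sig) ^+ 2 = t ^+ 2 / rho by rewrite expr_div_n sig2.
have [a1 a2] : aa (i + 1) c (l / rho) <= aa i c l /\ aa (i + 1) (c' i c l) (l / rho) <= aa i c l.
  by rewrite (aa_split i c l0); split; rewrite ?lerDl ?lerDr aa_ge0.
have child (d : R3 R) : aa (i + 1) d (l / rho) <= aa i c l -> aa (i + 1) d (l / rho) * (l / rho) <= (t / sig) ^+ 2 /\ `|J u (i + 1) d (l / rho) / l ^+ 3| <= t / l ^+ 2.
  move=> ad; split.
    rewrite TE mulrA ler_pM2r ?invr_gt0//; apply: le_trans H.
    by rewrite ler_pM2r.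
  have M := mean_sqr (i + 1) d h0; rewrite vol_child in M.
  apply: sqr_le_le; first by rewrite divr_ge0 ?exprn_ge0// ltW.
  rewrite -(ler_pM2r (exprn_gt0 4 l0)).
  have -> : (t / l ^+ 2) ^+ 2 * l ^+ 4 = t ^+ 2 by field; rewrite gt_eqF.
  apply: le_trans H; rewrite [l ^+ 4]exprSr mulrA ler_pM2r//; exact: le_trans ad.
have [g1 m1] := child _ a1; have [g2 m2] := child _ a2.
have I1 := IH _ _ _ _ h0 T0 g1; have I2 := IH _ _ _ _ h0 T0 g2.
rewrite /=; apply: le_trans (lerD I1 I2) _; rewrite vol_child.
have HD := half_diff HG i c l0.
have JS := box_int_split i c (L2_locint (H1p_L2 HG)) l0.
rewrite (bb_split i c l0) in HD *; rewrite JS.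
move: HD m1 m2 (bb_ge0 (i + 1) c (l / rho)) (bb_ge0 (i + 1) (c' i c l) (l / rho)) {I1 I2 JS g1 g2 a1 a2 H child}.
set j1 := J u _ _ _; set j2 := J u _ _ _; set b1 := bb _ _ _; set b2 := bb _ _ _ => HD m1 m2 b10 b20.
have l3 : 0 < l ^+ 3 by rewrite exprn_gt0.
have Em : (j1 + j2) / (2 * l ^+ 3) = (j1 / l ^+ 3 + j2 / l ^+ 3) / 2 by field; rewrite gt_eqF.
have coulomb_box : (j1 / l ^+ 3 - j2 / l ^+ 3) ^+ 2 * l ^+ 3 <= 2 * l ^+ 2 * (b1 + b2).
  rewrite -(ler_pM2r l3).
  rewrite [X in X <= _](_ : _ = (j1 - j2) ^+ 2); last by field; rewrite gt_eqF.
  by rewrite [X in _ <= X](_ : _ = l ^+ 2 * (2 * l ^+ 3 * (b1 + b2)))//; ring.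
rewrite Em.
move: coulomb_box m1 m2; set x1 := j1 / _; set x2 := j2 / _ => coulomb_box m1 m2.
have CM := cube_mean x1 x2.
have EX : (`|x1| + `|x2|) * ((x1 - x2) ^+ 2 * l ^+ 3) <= 4 * t * (b1 + b2).
  apply: (@le_trans _ _ ((2 * (t / l ^+ 2)) * (2 * l ^+ 2 * (b1 + b2)))); last first.
    by rewrite le_eqVlt; apply/orP; left; apply/eqP; field; rewrite gt_eqF.
  apply: ler_pM => //.
    by apply: mulr_ge0; [exact: sqr_ge0|exact: ltW].
  by move: m1 m2; clear; lra.
rewrite [in leRHS]C0_eq.
have -> : `|(x1 + x2) / 2| ^+ 3 * (2 * l ^+ 3) + (4 + C0 / sig) * t * (b1 + b2) =
   `|(x1 + x2) / 2| ^+ 3 * (2 * l ^+ 3) + 4 * t * (b1 + b2) + C0 * (t / sig) * (b1 + b2).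
  by field; rewrite gt_eqF.
have -> : `|x1| ^+ 3 * l ^+ 3 + C0 * (t / sig) * b1 + (`|x2| ^+ 3 * l ^+ 3 + C0 * (t / sig) * b2) = (`|x1| ^+ 3 + `|x2| ^+ 3) / 2 * (2 * l ^+ 3) + C0 * (t / sig) * (b1 + b2).
  by field; rewrite gt_eqF.
rewrite lerD2r; apply: (le_trans _ (lerD (lexx _) EX)).
have V0 : 0 <= 2 * l ^+ 3 by apply: mulr_ge0 => //; exact: ltW.
apply: le_trans (ler_wpM2r V0 CM) _.
rewrite mulrDl lerD2l le_eqVlt; apply/orP; left; apply/eqP; field; exact: isT.
Qed.

Lemma avg_cube_good_le n i c l t : 0 < l -> 0 <= t -> aa i c l * l <= t ^+ 2 ->
  X n i c l <= t * (aa i c l / l ^+ 2) + C0 * t * bb i c l.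
Proof.
move=> l0 t0 H; apply: le_trans (avg_cube_good n l0 t0 H) _; rewrite lerD2r.
apply: le_trans (mean_cube l0 (mean_good l0 t0 H)) _.
by rewrite mulrAC mulrA.
Qed.

(** A superadditive bound on the boxes of size 1 holds on all larger boxes. *)
Lemma avg_cube_scale (F : 'I_3 -> R3 R -> R -> R) n0 :
  (forall i c l, 0 < l -> F (i + 1) c (l / rho) + F (i + 1) (c' i c l) (l / rho) <= F i c l) ->
  (forall i c, X n0 i c 1 <= F i c 1) ->
  forall m i c, X (n0 + m) i c (rho ^+ m) <= F i c (rho ^+ m).
Proof.
move=> FS F1; have r0 := @rho_gt0 R.
elim=> [|m IH] i c; first by rewrite addn0 expr0; exact: F1.
have lm : 0 < rho ^+ m.+1 by rewrite exprn_gt0.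
rewrite addnS /=; apply: le_trans (FS _ _ _ lm).
have -> : rho ^+ m.+1 / rho = rho ^+ m by rewrite exprSr mulfK// gt_eqF.
exact: lerD.
Qed.

Definition C1 : R := C0 + 1 / (rho - 1).

Section stopping.
(** [D] stands for the Coulomb energy inside a box, of which only these two
    properties matter. The factor [4 l] bounds the distance of two points. *)
Variables (D : 'I_3 -> R3 R -> R -> R).
Hypothesis D_split : forall i c l, 0 < l ->
  D (i + 1) c (l / rho) + D (i + 1) (c' i c l) (l / rho) + 2 * (aa (i + 1) c (l / rho) * aa (i + 1) (c' i c l) (l / rho)) / (4 * l) <= D i c l.
Hypothesis D_low : forall i c l, 0 < l -> aa i c l ^+ 2 / (4 * l) <= D i c l.

(** Bisect until the boxes are good. A good box is handled by
    [avg_cube_good_le]. Splitting a bad box multiplies the term [a / l^2] by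
    [rho^2], which is too much to be iterated. It is compensated by the
    Coulomb energy, which exceeds the sum of those of the two halves by their
    interaction. Together with the change of the term [- a^2 / l] this gains
    [(rho - 1) a^2 / l], which is large enough as [l a > t^2] in a bad box. *)
Lemma stopping n i c l t : 0 < l -> 0 < t ->
  X n i c l <= C1 * t * (bb i c l + aa i c l / l ^+ 2 + 3 / t ^+ 2 * (4 * rho * D i c l - aa i c l ^+ 2 / l)).
Proof.
move=> + t0; have r0 := @rho_gt0 R; have r1 := @rho_gt1 R; have r2 := @rho_lt2 R.
have t20 : 0 < t ^+ 2 by rewrite exprn_gt0.
have rm : 0 < rho - 1 by lra.
have irm : 0 < 1 / (rho - 1) by rewrite divr_gt0.
have C4 := @C0_ge4 R.
have C10 : 0 < C1 by rewrite /C1; lra.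
elim: n i c l => [|n IH] i c l l0.
all: have l20 : 0 < l ^+ 2 by rewrite exprn_gt0.
all: have al0 : 0 <= aa i c l / l ^+ 2 by rewrite divr_ge0 ?aa_ge0// ltW.
all: have DR : (rho - 1) * (aa i c l ^+ 2 / l) <= 4 * rho * D i c l - aa i c l ^+ 2 / l.
(* Both cases of the induction start alike, hence the grouped steps. *)
1,3: have DL : 4 * rho * (aa i c l ^+ 2 / (4 * l)) <= 4 * rho * D i c l by rewrite ler_pM2l ?mulr_gt0//; exact: D_low.
1,2: by apply: (le_trans _ (lerD DL (lexx _))); rewrite le_eqVlt; apply/orP; left; apply/eqP; field; rewrite gt_eqF.
all: have S0 : 0 <= aa i c l ^+ 2 / l by apply: divr_ge0 (ltW l0); exact: sqr_ge0.
all: have [good|bad] := leP (aa i c l * l) (t ^+ 2).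
1,3: have tg : 0 <= 3 / t ^+ 2 * (4 * rho * D i c l - aa i c l ^+ 2 / l) by apply: mulr_ge0; [rewrite divr_ge0// ltW|apply: le_trans DR; apply: mulr_ge0 => //; exact: ltW].
1,2: apply: le_trans (avg_cube_good_le _ l0 (ltW t0) good) _.
1,2: apply: (@le_trans _ _ (C1 * t * (bb i c l + aa i c l / l ^+ 2))); last by rewrite ler_pM2l ?mulr_gt0// lerDl.
1,2: rewrite mulrDr addrC; apply: lerD.
1,3: by rewrite ler_wpM2r ?bb_ge0// ler_pM2r// /C1; lra.
1,2: by rewrite ler_wpM2r// ler_peMl ?ltW// /C1; lra.
- have M : `|J u i c l / (2 * l ^+ 3)| <= aa i c l / (l * t).
    have := mean_sqr i c l0; set m := _ / _ => M.
    apply: sqr_le_le; first by rewrite divr_ge0 ?aa_ge0// mulr_ge0 ?ltW.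
    rewrite -(ler_pM2r (exprn_gt0 3 l0)).
    have -> : (aa i c l / (l * t)) ^+ 2 * l ^+ 3 = aa i c l * (aa i c l * l / t ^+ 2) by field; rewrite !gt_eqF.
    have P : 0 <= m ^+ 2 * l ^+ 3 by apply: mulr_ge0; [exact: sqr_ge0|exact: exprn_ge0 (ltW l0)].
    apply: (@le_trans _ _ (m ^+ 2 * (2 * l ^+ 3))).
      by rewrite (_ : _ * (2 * _) = m ^+ 2 * l ^+ 3 + m ^+ 2 * l ^+ 3); [rewrite lerDl|ring].
    apply: le_trans M _; apply: ler_peMr (aa_ge0 _ _ _) _.
    by rewrite ler_pdivlMr// mul1r ltW.
  apply: le_trans (mean_cube l0 M) _.
  apply: (@le_trans _ _ (C1 * t * (3 / t ^+ 2 * ((rho - 1) * (aa i c l ^+ 2 / l))))); last first.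
    rewrite ler_pM2l ?mulr_gt0//; apply: ler_wpDl; first by rewrite addr_ge0 ?bb_ge0.
    by apply: ler_wpM2l DR; rewrite divr_ge0// ltW.
  have -> : aa i c l / (l * t) * aa i c l = (aa i c l ^+ 2 / l) / t by field; rewrite !gt_eqF.
  have -> : C1 * t * (3 / t ^+ 2 * ((rho - 1) * (aa i c l ^+ 2 / l))) = (C1 * 3 * (rho - 1)) * ((aa i c l ^+ 2 / l) / t) by field; rewrite !gt_eqF.
  apply: ler_peMl; first by rewrite divr_ge0// ltW.
  rewrite /C1 (_ : _ * _ = C0 * 3 * (rho - 1) + 3); last by field; rewrite gt_eqF.
  have : 0 <= C0 * 3 * (rho - 1) by apply: mulr_ge0 (ltW rm); apply: mulr_ge0 => //; exact: le_trans C4.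
  by lra.
- have h0 : 0 < l / rho by rewrite divr_gt0.
  rewrite /=; apply: le_trans (lerD (IH _ _ _ h0) (IH _ _ _ h0)) _.
  rewrite -mulrDr ler_pM2l ?mulr_gt0//.
  have := D_split i c l0; rewrite (bb_split i c l0) !(aa_split i c l0) in bad DR *.
  move: bad (aa_ge0 (i + 1) c (l / rho)) (aa_ge0 (i + 1) (c' i c l) (l / rho)).
  set a1 := aa _ _ _; set a2 := aa _ _ _; set b1 := bb _ _ _; set b2 := bb _ _ _.
  set D1 := D _ _ _; set D2 := D _ _ _; set D0 := D _ _ _ => bad a10 a20 DS.
  have KD : 4 * rho * (D1 + D2) + 2 * rho * (a1 * a2) / l <= 4 * rho * D0.
    have : 4 * rho * (D1 + D2 + 2 * (a1 * a2) / (4 * l)) <= 4 * rho * D0 by rewrite ler_pM2l// mulr_gt0.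
    by rewrite (_ : 4 * rho * (_ + _ / _) = 4 * rho * (D1 + D2) + 2 * rho * (a1 * a2) / l)//; field; rewrite gt_eqF.
  (* The growth of [a / l^2] is paid since the box is bad and [rho + 1 <= 3]. *)
  have B : (rho ^+ 2 - 1) * ((a1 + a2) / l ^+ 2) <= 3 / t ^+ 2 * ((rho - 1) * ((a1 + a2) ^+ 2 / l)).
    have -> : 3 / t ^+ 2 * ((rho - 1) * ((a1 + a2) ^+ 2 / l)) = (rho - 1) * (3 * ((a1 + a2) * l / t ^+ 2) * ((a1 + a2) / l ^+ 2)) by field; rewrite !gt_eqF.
    have -> : (rho ^+ 2 - 1) * ((a1 + a2) / l ^+ 2) = (rho - 1) * ((rho + 1) * ((a1 + a2) / l ^+ 2)) by ring.
    rewrite ler_pM2l//; apply: ler_wpM2r; first by rewrite divr_ge0 ?addr_ge0// ltW.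
    have : 1 <= (a1 + a2) * l / t ^+ 2 by rewrite ler_pdivlMr// mul1r ltW.
    by move: r2; clear; lra.
  have -> : a1 / (l / rho) ^+ 2 = a1 / l ^+ 2 + (rho ^+ 2 - 1) * (a1 / l ^+ 2) by field; rewrite !gt_eqF.
  have -> : a2 / (l / rho) ^+ 2 = a2 / l ^+ 2 + (rho ^+ 2 - 1) * (a2 / l ^+ 2) by field; rewrite !gt_eqF.
  have KT : 3 / t ^+ 2 * (4 * rho * (D1 + D2) + 2 * rho * (a1 * a2) / l) <= 3 / t ^+ 2 * (4 * rho * D0).
    by rewrite ler_wpM2l// divr_ge0// ltW.
  rewrite [in leRHS]mulrBr.
  have -> : a1 ^+ 2 / (l / rho) = rho * a1 ^+ 2 / l by field; rewrite !gt_eqF.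
  have -> : a2 ^+ 2 / (l / rho) = rho * a2 ^+ 2 / l by field; rewrite !gt_eqF.
  have E : 3 / t ^+ 2 * (4 * rho * D1 - rho * a1 ^+ 2 / l) + 3 / t ^+ 2 * (4 * rho * D2 - rho * a2 ^+ 2 / l) =
     3 / t ^+ 2 * (4 * rho * (D1 + D2) + 2 * rho * (a1 * a2) / l) - 3 / t ^+ 2 * ((a1 + a2) ^+ 2 / l) - 3 / t ^+ 2 * ((rho - 1) * ((a1 + a2) ^+ 2 / l)).
    by field; rewrite !gt_eqF.
  have E2 : (rho ^+ 2 - 1) * ((a1 + a2) / l ^+ 2) = (rho ^+ 2 - 1) * (a1 / l ^+ 2) + (rho ^+ 2 - 1) * (a2 / l ^+ 2) by ring.
  have E3 : (a1 + a2) / l ^+ 2 = a1 / l ^+ 2 + a2 / l ^+ 2 by ring.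
  rewrite E2 in B; rewrite E3.
  move: KT B E; set k1 := _ * (4 * rho * D1 - _); set k2 := _ * (4 * rho * D2 - _).
  set k3 := _ * (4 * rho * (_ + _) + _); set k4 := 3 / _ * (4 * rho * D0).
  set k5 := 3 / _ * (_ / l); set k6 := 3 / _ * ((rho - 1) * _).
  set q1 := _ * (a1 / _); set q2 := _ * (a2 / _); set w1 := a1 / _; set w2 := a2 / _.
  clear; lra.
Qed.
End stopping.
End rec.

End Stopping.

(** * Convergence of the averages over boxes *)

Section BoxAverages.
Variable R : realType.
Notation RR := (measurableTypeR R).
Notation LL := (@leb3 R).
Notation L2 := (Lfun (@leb3 R) 2%:E).
Notation meas f := (measurable_fun [set: RR * RR * RR] f).
Implicit Types (u v f g phi psi : R3 R -> R) (i j : 'I_3) (x c : R3 R) (l t : R).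
Notation integ f := (LL.-integrable setT (EFin \o (f : R3 R -> R))).
Notation rho := (@rho R).

(** Increments that are summable in mean are summable almost everywhere, and
    the sum of their absolute values dominates the sequence. *)
Lemma L1_limit (w : nat -> R3 R -> R) (S : R) : (forall n, integ (w n)) ->
  (forall N, \sum_(0 <= n < N) \int[LL]_x `|w n.+1 x - w n x| <= S) ->
  exists v, [/\ integ v, {ae LL, forall x, w n x @[n --> \oo] --> v x} &
    forall f (M : R), meas f -> (forall x, `|f x| <= M) ->
      \int[LL]_x (w n x * f x) @[n --> \oo] --> \int[LL]_x (v x * f x)].
Proof.
move=> wi HS; have wm n := integ_meas (wi n).
pose e n x := `|w n.+1 x - w n x|.
have ei n : integ (e n) by apply: integ_norm; exact: integB.
pose Hs x := (\sum_(0 <= n <oo) (e n x)%:E)%E.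
have Hs0 x : (0 <= Hs x)%E by apply: nneseries_ge0 => n _ _; rewrite lee_fin normr_ge0.
have em n : measurable_fun setT (fun x : RR * RR * RR => (e n x)%:E) by apply/measurable_EFinP; exact: integ_meas.
have mHs : measurable_fun setT (Hs : RR * RR * RR -> \bar R).
  have := @ge0_emeasurable_sum _ (RR * RR * RR)%type R setT (fun n x => (e n x)%:E) xpredT.
  by apply => // *; rewrite lee_fin normr_ge0.
have IHs : (\int[LL]_x Hs x <= S%:E)%E.
  rewrite integral_nneseries//; last by move=> n x _; rewrite lee_fin normr_ge0.
  apply: lime_le; first by apply: is_cvg_nneseries => n _ _; apply: integral_ge0 => x _; rewrite lee_fin normr_ge0.
  apply: nearW => N; apply: le_trans (_ : (\sum_(0 <= n < N) \int[LL]_x e n x)%:E <= _)%E; last by rewrite lee_fin.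
  by rewrite -sumEFin; apply: lee_sum => n _; rewrite Rint_EFin//; exact: ei.
have iHs : LL.-integrable setT Hs.
  apply/integrableP; split => //.
  under eq_integral => x _ do rewrite (gee0_abs (Hs0 x)).
  by apply: le_lt_trans IHs _; rewrite ltry.
pose A := [set x : RR * RR * RR | Hs x \is a fin_num].
have mA : measurable A by have := emeasurable_fin_num measurableT mHs; rewrite setTI.
have aeA : {ae LL, forall x, A x}.
  by apply: aeS (integrable_ae measurableT iHs) => x; apply.
pose H x := `|w 0%N x| + fine (Hs x).
have Hi : integ H.
  apply: integD; first exact: integ_norm.
  apply/integrableP; split.
    by apply/measurable_EFinP; apply: measurableT_comp mHs.
  apply: le_lt_trans (_ : _ <= \int[LL]_x Hs x)%E _; last by apply: le_lt_trans IHs _; rewrite ltry.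
  apply: ge0_le_integral => //.
    by apply: measurableT_comp => //; apply/measurable_EFinP; apply: measurableT_comp mHs.
  move=> x _ /=; have := Hs0 x; case: (Hs x) => [r| |]//=.
  - by rewrite lee_fin => r0; rewrite ger0_norm.
  - by rewrite normr0 leey.
have part x N : A x -> \sum_(0 <= n < N) e n x <= fine (Hs x).
  move=> Ax; rewrite -lee_fin fineK// -sumEFin; apply: nneseries_lim_ge => n _ _.
  by rewrite lee_fin normr_ge0.
have tele x n : w n x = w 0%N x + \sum_(0 <= k < n) (w k.+1 x - w k x).
  by rewrite telescope_sumr// addrCA subrr addr0.
pose w' n x := w n x * \1_A x.
have mw' n : meas (w' n) by apply: measurable_funM => //; exact: measurable_indic.
have w'H n x : `|w' n x| <= H x.
  rewrite /w' indicE; have [Ax|nA] := pselect (A x); last first.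
    by rewrite memNset// mulr0 normr0 addr_ge0// fine_ge0.
  rewrite mem_set// mulr1 tele; apply: le_trans (ler_normD _ _) _; rewrite lerD2l.
  by apply: le_trans (ler_norm_sum _ _ _) (part x n Ax).
have w'c x : cvgn (w' ^~ x).
  rewrite /w' indicE; have [Ax|nA] := pselect (A x); last first.
    by rewrite memNset//; under eq_fun do rewrite mulr0; exact: is_cvg_cst.
  rewrite mem_set//; under eq_fun do rewrite mulr1 tele.
  apply: is_cvgD; first exact: is_cvg_cst.
  apply: (@normed_cvg _ _ (fun k => w k.+1 x - w k x)).
  apply: nondecreasing_is_cvgn.
    by apply: nondecreasing_series => n _ _; exact: normr_ge0.
  by exists (fine (Hs x)) => _ [N _ <-]; exact: part.
pose v x := limn (w' ^~ x).
have w'v x : w' n x @[n --> \oo] --> v x by exact: w'c.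
have mv : meas v by apply: measurable_fun_cvg mw' _ => x _; exact: w'v.
have eqw : {ae LL, forall x, forall n, w' n x = w n x}.
  by apply: aeS aeA => x Ax n; rewrite /w' indicE mem_set// mulr1.
exists v; split.
- apply: integ_le Hi => // x; rewrite [leRHS]ger0_norm; last by rewrite addr_ge0// fine_ge0.
  have nv : `|w' n x| @[n --> \oo] --> `|v x| by apply: cvg_norm; exact: w'v.
  rewrite -(cvg_lim (@Rhausdorff R) nv); apply: limr_le; first by apply/cvg_ex; eexists; exact: nv.
  by apply: nearW => n; exact: w'H.
- apply: aeS eqw => x E; have := w'v x.
  by rewrite (_ : w' ^~ x = w ^~ x)//; apply/funext => n; exact: E.
move=> f M mf fM.
have : \int[LL]_x (w' n x * f x) @[n --> \oo] --> \int[LL]_x (v x * f x).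
  have M0 : 0 <= M by apply: le_trans (fM 0).
  apply: (dominated_Rint _ _ _ (integZ M Hi)).
  - by move=> n; exact: measurable_funM.
  - exact: measurable_funM.
  - by move=> x; apply: cvgM (w'v x) _; exact: cvg_cst.
  - by move=> n x; rewrite normrM mulrC; apply: ler_pM.
rewrite (_ : (fun n => \int[LL]_x (w' n x * f x)) = fun n => \int[LL]_x (w n x * f x))//.
apply/funext => n; apply: ae_eq_Rint; [exact: measurable_funM..|].
by apply: aeS eqw => x ->.
Qed.

(** Fatou's lemma for almost everywhere convergence to a function that is
    already known to be measurable. *)
Lemma fatou_ae (w : nat -> R3 R -> R) f (B : R) : (forall n, meas (w n)) -> meas f ->
  (forall n x, 0 <= w n x) -> (forall x, 0 <= f x) ->
  {ae LL, forall x, w n x @[n --> \oo] --> f x} ->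
  (forall n, (\int[LL]_x (w n x)%:E <= B%:E)%E) -> (\int[LL]_x (f x)%:E <= B%:E)%E.
Proof.
move=> mw mf w0 f0 [N [mN N0 NA]] wB.
have mA : measurable (~` N) by exact: measurableC.
have AX x : ~ N x -> w n x @[n --> \oo] --> f x by move=> nN; apply: contrapT => H; apply/nN/NA.
have m1 : measurable_fun setT (\1_(~` N) : RR * RR * RR -> R) by exact: measurable_indic.
have E (g : R3 R -> R) : meas g -> (\int[LL]_x (g x)%:E = \int[LL]_x (g x * \1_(~` N) x)%:E)%E.
  move=> mg; apply: ae_eq_integral => //.
  - exact/measurable_EFinP.
  - by apply/measurable_EFinP; exact: measurable_funM.
  exists N; split => // x /= H; apply: contrapT => nN; apply: H => _.
  by rewrite indicE mem_set// mulr1.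
rewrite E//; apply: le_trans (_ : _ <= limn_einf (fun n => \int[LL]_x (w n x * \1_(~` N) x)%:E))%E _; last first.
  rewrite limn_einf_lim; apply: lime_le; first exact: is_cvg_einfs.
  apply: nearW => n; apply: le_trans (_ : _ <= \int[LL]_x (w n x * \1_(~` N) x)%:E)%E _; last by rewrite -E.
  by apply: ereal_inf_lbound; exists n => /=.
rewrite [leLHS](_ : _ = \int[LL]_x limn_einf (fun n => (w n x * \1_(~` N) x)%:E))%E; last first.
  apply: eq_integral => x _; apply/esym.
  have H : (w n x * \1_(~` N) x)%:E @[n --> \oo] --> (f x * \1_(~` N) x)%:E.
    apply: cvg_EFin; first by apply: nearW.
    rewrite /comp /=; have [Nx|nN] := pselect (N x).
      rewrite indicE memNset/=; last by move/(_ Nx).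
      by rewrite mulr0; under eq_fun do rewrite mulr0; exact: cvg_cst.
    by apply: cvgM; [exact: AX|exact: cvg_cst].
  by rewrite (cvg_limn_einf_sup H).1.
apply: fatou => //.
- by move=> n; apply/measurable_EFinP; exact: measurable_funM.
- by move=> n x _; rewrite lee_fin mulr_ge0.
Qed.

Lemma integ_bddM f g (M : R) : integ f -> meas g -> (forall x, `|g x| <= M) -> integ (fun x => f x * g x).
Proof.
move=> fi mg gM; apply: integ_le (integZ M fi); first by apply: measurable_funM => //; exact: integ_meas.
have M0 : 0 <= M by apply: le_trans (gM 0).
by move=> x; rewrite !normrM mulrC (ger0_norm M0) ler_wpM2r.
Qed.

Lemma smooth_lipschitz phi (M : R) x y : smooth phi -> (forall i x, `|partial i phi x| <= M) ->
  `|phi x - phi y| <= M * (`|coord 0 (x - y)| + `|coord 1 (x - y)| + `|coord 2 (x - y)|).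
Proof.
move=> sp H.
have L i := line_lipschitz _ _ sp (H i).
pose y1 := coord 0 (x - y) *: basis3 R 0 + y.
pose y2 := coord 1 (x - y) *: basis3 R 1 + y1.
have xE : x = coord 2 (x - y) *: basis3 R 2 + y2.
  apply: ext3 => j; rewrite /y2 /y1 !coordD !coordZ !coord_basis !coordN.
  by elim/I3_ind: j => /=; ring.
rewrite [X in phi X - _]xE.
have L0 : `|phi y1 - phi y| <= M * `|coord 0 (x - y)| by exact: L.
have L1 : `|phi y2 - phi y1| <= M * `|coord 1 (x - y)| by exact: L.
have L2 : `|phi (coord 2 (x - y) *: basis3 R 2 + y2) - phi y2| <= M * `|coord 2 (x - y)| by exact: L.
rewrite !mulrDr; move: L0 L1 L2; set p2 := phi (_ + y2) => L0 L1 L2.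
rewrite (_ : p2 - phi y = (phi y1 - phi y) + (phi y2 - phi y1) + (p2 - phi y2)); last by ring.
by apply: le_trans (ler_normD _ _) (lerD (le_trans (ler_normD _ _) (lerD L0 L1)) L2).
Qed.

Lemma box_lipschitz phi (M : R) i c l x : smooth phi -> (forall i x, `|partial i phi x| <= M) -> 0 < l ->
  box i c l x -> `|phi x - phi c| <= 12 * M * l.
Proof.
move=> sp H l0 xb; apply: le_trans (smooth_lipschitz x c sp H) _.
have M0 : 0 <= M by apply: le_trans (H 0 0).
have K j : `|coord j (x - c)| <= 4 * l.
  move/boxP : xb => /(_ j) /andP[h1 h2]; rewrite coordD coordN ger0_norm; last by rewrite subr_ge0 ltW.
  have : side i l j <= 4 * l.
    rewrite /side mulrC ler_pM2r//; apply: (@le_trans _ _ (rho ^+ 2)).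
      by rewrite ler_weXn2l ?leq_subr// ltW// rho_gt1.
    have := @rho_lt2 R; have := @rho_gt1 R; clear; nra.
  by move: h2; clear; lra.
rewrite (_ : 12 * M * l = M * (4 * l + 4 * l + 4 * l)); last by ring.
by rewrite ler_wpM2l// !lerD.
Qed.

Lemma test_lipschitz phi : test_function phi -> exists M : R, forall i x, `|partial i phi x| <= M.
Proof.
move=> tp; have [M0 p0 H0] := test_bounded (test_partial 0 tp); have [M1 p1 H1] := test_bounded (test_partial 1 tp).
have [M2 p2 H2] := test_bounded (test_partial 2 tp).
exists (M0 + M1 + M2) => i x; elim/I3_ind: i.
- by apply: le_trans (H0 x) _; move: p1 p2; clear; lra.
- by apply: le_trans (H1 x) _; move: p0 p2; clear; lra.
- by apply: le_trans (H2 x) _; move: p0 p1; clear; lra.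
Qed.

Section rec.
Variables (u : R3 R -> R) (G : 'I_3 -> R3 R -> R) (HG : H1p u G).
Notation J := (@box_int R).
Notation X := (avg_cube u).
Notation aa := (J (usq u)).
Notation bb := (J (gsq G)).
Notation c' i c l := (c + (l / rho) *: basis3 R i).
Let lu0 := L2_locint (H1p_L2 HG).

(** The average of [u] at scale [n], as a step function on the box. *)
Fixpoint box_avg n i c l x : R := if n is n'.+1 then
  box_avg n' (i + 1) c (l / rho) x + box_avg n' (i + 1) (c' i c l) (l / rho) x
  else J u i c l / (2 * l ^+ 3) * \1_(box i c l) x.

Lemma child_gt0 l : 0 < l -> 0 < l / rho. Proof. by move=> l0; rewrite divr_gt0// rho_gt0. Qed.

Lemma integ_box i c l : integ (\1_(box i c l) : R3 R -> R).
Proof. by apply: eq_integ (locint_box i c l (locint_cst 1)) => x; rewrite mul1r. Qed.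
Lemma Rint_box i c l : 0 < l -> \int[LL]_x (\1_(box i c l) x : R) = 2 * l ^+ 3.
Proof. by move=> l0; rewrite -(box_int_cst1 i c l0); apply: eq_Rint => x; rewrite mul1r. Qed.

Lemma box_avg_integ n i c l : integ (box_avg n i c l).
Proof.
elim: n i c l => [|n IH] i c l /=; last exact: integD.
by apply: integZ; exact: integ_box.
Qed.

Lemma box_avg_out n i c l x : 0 < l -> \1_(box i c l) x = 0 :> R -> box_avg n i c l x = 0.
Proof.
elim: n i c l => [|n IH] i c l l0 /= H; first by rewrite H mulr0.
have h0 := child_gt0 l0; move: H; rewrite (box_split i c x l0) => /eqP.
rewrite paddr_eq0// => /andP[/eqP H1 /eqP H2].
by rewrite !IH// addr0.
Qed.

Lemma box_disj i c l x : 0 < l -> \1_(box (i + 1) c (l / rho)) x = 0 :> R \/ \1_(box (i + 1) (c' i c l) (l / rho)) x = 0 :> R.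
Proof.
move=> l0; have := box_split i c x l0; rewrite !indicE.
by case: (_ \in _); case: (_ \in _); case: (_ \in _) => /=; rewrite ?mulr1n ?mulr0n; [lra|..]; try (by left); try (by right); lra.
Qed.

Lemma box_avg_cube n i c l : 0 < l -> integ (fun x => `|box_avg n i c l x| ^+ 3) /\ \int[LL]_x (`|box_avg n i c l x| ^+ 3) = X n i c l.
Proof.
elim: n i c l => [|n IH] i c l l0.
  have E x : `|box_avg 0 i c l x| ^+ 3 = `|J u i c l / (2 * l ^+ 3)| ^+ 3 * \1_(box i c l) x.
    rewrite /box_avg normrM exprMn; congr (_ * _); rewrite indicE.
    by case: (_ \in _); rewrite ?normr1 ?normr0 ?expr1n ?expr0n.
  split; first by apply: eq_integ (integZ _ (integ_box i c l)) => x; rewrite E.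
  by rewrite (eq_Rint E) RintZ ?Rint_box//; exact: integ_box.
have h0 := child_gt0 l0.
have [I1 E1] := IH (i + 1) c _ h0; have [I2 E2] := IH (i + 1) (c' i c l) _ h0.
have E x : `|box_avg n.+1 i c l x| ^+ 3 = `|box_avg n (i + 1) c (l / rho) x| ^+ 3 + `|box_avg n (i + 1) (c' i c l) (l / rho) x| ^+ 3.
  by rewrite /=; have [H|H] := box_disj i c x l0; rewrite (box_avg_out n h0 H) normr0 expr0n/= ?add0r ?addr0.
split; first by apply: eq_integ (integD I1 I2) => x; rewrite E.
by rewrite (eq_Rint E) RintD// E1 E2.
Qed.

(** On each box the two successive averages differ by half the difference of
    the averages over its two halves, which [half_diff] controls. The
    Cauchy-Schwarz term is bounded by a sum of volume and energy, both of
    which add up over the boxes. *)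
Lemma box_avg_diff n i c l : 0 < l -> \int[LL]_x `|box_avg n.+1 i c l x - box_avg n i c l x| <= l / rho ^+ n * (2 * l ^+ 3 + bb i c l).
Proof.
elim: n i c l => [|n IH] i c l l0; have h0 := child_gt0 l0.
  have HD := half_diff HG i c l0; have JS := box_int_split i c lu0 l0.
  have l3 : 0 < l ^+ 3 by rewrite exprn_gt0.
  have b0 := bb_ge0 G i c l.
  rewrite expr0 divr1; set b := bb _ _ _ in HD b0 *.
  set j1 := J u _ c (l / rho) in HD JS; set j2 := J u _ (c' _ _ _) _ in HD JS.
  have D : `|j1 - j2| <= l * (2 * l ^+ 3 + b).
    have V0 : 0 <= 2 * l ^+ 3 by apply: mulr_ge0 => //; exact: ltW.
    apply: sqr_le_le; first by apply: mulr_ge0; [exact: ltW|exact: addr_ge0].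
    apply: le_trans HD _; rewrite exprMn ler_wpM2l ?sqr_ge0//.
    have : 0 <= l ^+ 3 * b by apply: mulr_ge0 => //; exact: ltW.
    have : 0 <= (l ^+ 3) ^+ 2 by exact: sqr_ge0.
    have : 0 <= b ^+ 2 by exact: sqr_ge0.
    by rewrite (_ : (2 * l ^+ 3 + b) ^+ 2 = 4 * (l ^+ 3) ^+ 2 + 4 * (l ^+ 3 * b) + b ^+ 2); [lra|ring].
  have P x : `|box_avg 1 i c l x - box_avg 0 i c l x| <= `|j1 - j2| / (2 * l ^+ 3) * \1_(box i c l) x.
    rewrite /box_avg !vol_child -/j1 -/j2 JS (box_split i c x l0); set i1 := \1_(_) x; set i2 := \1_(_) x.
    have -> : j1 / l ^+ 3 * i1 + j2 / l ^+ 3 * i2 - (j1 + j2) / (2 * l ^+ 3) * (i1 + i2) = (j1 - j2) / (2 * l ^+ 3) * (i1 - i2).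
      by field; rewrite gt_eqF.
    rewrite normrM normrM (ger0_norm (_ : 0 <= (2 * l ^+ 3)^-1)); last by rewrite invr_ge0 mulr_ge0 ?ltW.
    rewrite ler_wpM2l//; first by rewrite divr_ge0// mulr_ge0 ?ltW.
    by apply: le_trans (ler_normB _ _) _; rewrite !ger0_norm.
  apply: le_trans (_ : _ <= \int[LL]_x (`|j1 - j2| / (2 * l ^+ 3) * \1_(box i c l) x)) _.
    apply: Rint_le => //; last by apply: integZ; exact: integ_box.
    by apply: integ_norm; apply: integB; exact: box_avg_integ.
  rewrite RintZ; last exact: integ_box.
  by rewrite Rint_box// divfK// gt_eqF// mulr_gt0.
have I m d := integ_norm (integB (box_avg_integ m.+1 (i + 1) d (l / rho)) (box_avg_integ m (i + 1) d (l / rho))).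
apply: le_trans (_ : _ <= \int[LL]_x (`|box_avg n.+1 (i + 1) c (l / rho) x - box_avg n (i + 1) c (l / rho) x| + `|box_avg n.+1 (i + 1) (c' i c l) (l / rho) x - box_avg n (i + 1) (c' i c l) (l / rho) x|)) _.
  apply: Rint_le; first by apply: integ_norm; apply: integB; exact: box_avg_integ.
    by apply: integD; exact: I.
  move=> x; rewrite [box_avg n.+2 _ _ _ _]/= [box_avg n.+1 i _ _ _]/= opprD addrACA; exact: ler_normD.
rewrite RintD//; apply: le_trans (lerD (IH _ _ _ h0) (IH _ _ _ h0)) _.
rewrite -mulrDr (bb_split HG i c l0) vol_child.
have -> : l / rho / rho ^+ n = l / rho ^+ n.+1 by rewrite exprS invfM mulrA.
apply: ler_wpM2l; first by rewrite divr_ge0 ?exprn_ge0// ltW// rho_gt0.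
by rewrite addrACA -mulr2n mulr_natl.
Qed.

(** Up to the oscillation of the test function, which is of the order of the
    size of the small boxes, averaging can be moved from [u] to the test
    function. *)
Lemma box_avg_weak phi (M : R) n i c l : test_function phi -> (forall i x, `|partial i phi x| <= M) -> 0 < l ->
  `|\int[LL]_x (box_avg n i c l x * phi x) - \int[LL]_x (u x * \1_(box i c l) x * phi x)| <= l / rho ^+ n * (24 * M * J (fun x => `|u x|) i c l).
Proof.
move=> tp HM; have [P _ pP] := test_bounded tp; have mp := test_meas tp.
have M0 : 0 <= M by apply: le_trans (HM 0 0).
have iU m i' d k := integ_bddM (box_avg_integ m i' d k) mp pP.
have iu i' d k := integ_bddM (locint_box i' d k lu0) mp pP.
have lau : locint (fun x => `|u x|).
  apply: L2_locint; apply: L2_intro; first by apply: measurableT_comp => //; exact: L2_meas (H1p_L2 HG).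
  by apply: eq_integ (L2_sqr (H1p_L2 HG)) => x; rewrite real_normK// num_real.
elim: n i c l => [|n IH] i c l l0; have h0 := child_gt0 l0.
  rewrite expr0 divr1; set m := J u i c l / (2 * l ^+ 3).
  have V0 : 0 < 2 * l ^+ 3 by rewrite mulr_gt0// exprn_gt0.
  set A := J (fun x => `|u x|) i c l.
  have iub := locint_box i c l lu0; have iuab := locint_box i c l lau.
  have JA : `|J u i c l| <= A.
    apply: le_trans (Rint_norm iub) _; apply: Rint_le => //; first exact: integ_norm.
    by move=> x; rewrite normrM [X in _ * X]ger0_norm.
  have osc x : `|\1_(box i c l) x * (phi x - phi c)| <= 12 * M * l * \1_(box i c l) x.
    rewrite indicE; have [xb|xb] := pselect (box i c l x); last by rewrite memNset// mul0r normr0 mulr0.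
    by rewrite mem_set// mul1r mulr1; apply: box_lipschitz xb => //; exact: test_smooth.
  have ip := integ_bddM (integ_box i c l) mp pP.
  have E1 : \int[LL]_x (box_avg 0 i c l x * phi x) = m * \int[LL]_x (\1_(box i c l) x * (phi x - phi c)) + phi c * J u i c l.
    rewrite (eq_Rint (g := fun x => m * (\1_(box i c l) x * (phi x - phi c)) + phi c * m * \1_(box i c l) x)); last first.
      by move=> x; rewrite /box_avg -/m; ring.
    have I0 : integ (fun x => \1_(box i c l) x * (phi x - phi c)).
      by apply: eq_integ (integB ip (integZ (phi c) (integ_box i c l))) => x; ring.
    rewrite RintD; [|exact: integZ|by apply: integZ; exact: integ_box].
    rewrite RintZ// (RintZ _ (integ_box i c l)) Rint_box//; congr (_ + _); rewrite /m.
    by field; rewrite gt_eqF.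
  have Iu0 : integ (fun x => u x * (\1_(box i c l) x * (phi x - phi c))).
    by apply: eq_integ (integB (iu i c l) (integZ (phi c) iub)) => x; ring.
  have E2 : \int[LL]_x (u x * \1_(box i c l) x * phi x) = \int[LL]_x (u x * (\1_(box i c l) x * (phi x - phi c))) + phi c * J u i c l.
    rewrite (eq_Rint (g := fun x => u x * (\1_(box i c l) x * (phi x - phi c)) + phi c * (u x * \1_(box i c l) x))); last by move=> x; ring.
    by rewrite RintD ?RintZ//; exact: integZ.
  rewrite E1 E2 opprD addrACA subrr addr0; apply: le_trans (ler_normB _ _) _.
  rewrite (_ : l * _ = 12 * M * l * A + 12 * M * l * A); last by ring.
  have C0 : 0 <= 12 * M * l by rewrite !mulr_ge0// ltW.
  apply: lerD.
    apply: le_trans (_ : _ <= `|m| * (12 * M * l * (2 * l ^+ 3))) _.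
      rewrite normrM ler_wpM2l// -(Rint_box i c l0) -RintZ; last exact: integ_box.
      have I0 : integ (fun x => \1_(box i c l) x * (phi x - phi c)).
        by apply: eq_integ (integB ip (integZ (phi c) (integ_box i c l))) => x; ring.
      apply: le_trans (Rint_norm I0) _; apply: Rint_le => //; first exact: integ_norm.
      by apply: integZ; exact: integ_box.
    rewrite mulrCA ler_wpM2l// /m normrM normfV (gtr0_norm V0).
    by rewrite divfK// gt_eqF.
  rewrite -RintZ//; apply: le_trans (Rint_norm Iu0) _; apply: Rint_le; first exact: integ_norm.
    exact: integZ.
  by move=> x; rewrite (normrM (u x)) [leRHS]mulrCA ler_wpM2l.
have -> : l / rho ^+ n.+1 = l / rho / rho ^+ n by rewrite exprS invfM mulrA.
rewrite (box_int_split i c lau l0) mulrDr mulrDr.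
apply: (le_trans _ (lerD (IH _ _ _ h0) (IH _ _ _ h0))).
apply: (le_trans _ (ler_normD _ _)).
have E1 : \int[LL]_x (box_avg n.+1 i c l x * phi x) = \int[LL]_x (box_avg n (i + 1) c (l / rho) x * phi x) + \int[LL]_x (box_avg n (i + 1) (c' i c l) (l / rho) x * phi x).
  by rewrite -RintD//; apply: eq_Rint => x; rewrite /= mulrDl.
have E2 : \int[LL]_x (u x * \1_(box i c l) x * phi x) = \int[LL]_x (u x * \1_(box (i + 1) c (l / rho)) x * phi x) + \int[LL]_x (u x * \1_(box (i + 1) (c' i c l) (l / rho)) x * phi x).
  by rewrite -RintD//; apply: eq_Rint => x; rewrite (box_split i c x l0) mulrDr mulrDl.
by rewrite E1 E2 opprD addrACA.
Qed.

Lemma rho_pow_cvg0 (K : R) : K / rho ^+ n @[n --> \oo] --> 0.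
Proof.
rewrite (_ : (fun n => _) = geometric K rho^-1); last by apply/funext => n; rewrite /geometric/= exprVn.
apply: cvg_geometric; rewrite normfV invf_lt1 ?normr_gt0 ?gt_eqF ?rho_gt0//.
by rewrite gtr0_norm ?rho_gt1// rho_gt0.
Qed.

(** The averages converge almost everywhere by [box_avg_diff], and their limit
    is [u] by [box_avg_weak] and the fundamental lemma. This replaces the
    differentiation theorem of Lebesgue. Fatou's lemma concludes. *)
Lemma cube_box (m0 : nat) i c l (B : R) : 0 < l -> (forall n, X (n + m0)%N i c l <= B) ->
  (\int[LL]_x (`|u x| ^+ 3 * \1_(box i c l) x)%:E <= B%:E)%E.
Proof.
move=> l0 XB; have r1 := @rho_gt1 R; have r0 := @rho_gt0 R.
have iub := locint_box i c l lu0.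
set V := 2 * l ^+ 3 + bb i c l.
have V0 : 0 <= V by rewrite addr_ge0 ?bb_ge0// mulr_ge0// exprn_ge0// ltW.
have geo N : \sum_(0 <= k < N) l / rho ^+ k <= l * (rho / (rho - 1)).
  have -> : \sum_(0 <= k < N) l / rho ^+ k = l * (rho / (rho - 1)) - l * (rho / (rho - 1)) / rho ^+ N.
    elim: N => [|N IH]; first by rewrite big_geq// expr0 divr1 subrr.
    rewrite big_nat_recr//= IH exprS; field.
    by rewrite expf_neq0 ?gt_eqF// subr_gt0.
  by rewrite gerBl divr_ge0 ?exprn_ge0 ?(ltW r0)// mulr_ge0 ?(ltW l0)// divr_ge0 ?(ltW r0)// subr_ge0 ltW.
have [v [vi cv wv]] := @L1_limit (fun n => box_avg n i c l) (l * (rho / (rho - 1)) * V) (fun n => box_avg_integ n i c l)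
  (fun N => le_trans (ler_sum _ (fun n _ => box_avg_diff n i c l0)) (le_trans (eq_ind_r (fun z => z <= _) (ler_wpM2r V0 (geo N)) (esym (mulr_suml _ _ _ _))) (lexx _))).
have vE : {ae LL, forall x, v x - u x * \1_(box i c l) x = 0}.
  apply: fundamental_lemma; first by apply: integ_locint; exact: integB.
  move=> phi tp; have [P _ pP] := test_bounded tp; have mp := test_meas tp.
  rewrite (eq_Rint (g := fun x => v x * phi x - u x * \1_(box i c l) x * phi x)); last by move=> x; ring.
  rewrite RintB; [|exact: integ_bddM mp pP..].
  apply/eqP; rewrite subr_eq0; apply/eqP.
  have K1 := wv phi P mp pP.
  have [M HM] := test_lipschitz tp.
  have K2 : \int[LL]_x (box_avg n i c l x * phi x) @[n --> \oo] --> \int[LL]_x (u x * \1_(box i c l) x * phi x).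
    apply/subr_cvg0; apply/norm_cvg0P.
    set A := 24 * M * J (fun x => `|u x|) i c l.
    apply: (@squeeze_cvgr _ _ _ _ (fun=> 0) (fun n => (l * A) / rho ^+ n)).
    - apply: nearW => n; rewrite normr_ge0/=.
      by have := box_avg_weak n i c tp HM l0; rewrite -/A mulrAC.
    - exact: cvg_cst.
    - exact: rho_pow_cvg0.
  by rewrite -(cvg_lim (@Rhausdorff R) K1) -(cvg_lim (@Rhausdorff R) K2).
apply: (@fatou_ae (fun n x => `|box_avg (n + m0)%N i c l x| ^+ 3)).
- by move=> n; apply: measurable_funX; apply: measurableT_comp => //; exact: integ_meas (box_avg_integ _ _ _ _).
- apply: measurable_funM; last by apply: measurable_indic; exact: box_measurable.
  by apply: measurable_funX; apply: measurableT_comp => //; exact: L2_meas (H1p_L2 HG).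
- by move=> n x; rewrite exprn_ge0.
- by move=> x; rewrite mulr_ge0// exprn_ge0.
- apply: aeS (aeI vE cv) => x [/eqP + cx]; rewrite subr_eq0 => /eqP vx.
  have -> : `|u x| ^+ 3 * \1_(box i c l) x = `|v x| ^+ 3.
    rewrite vx normrM exprMn; congr (_ * _); rewrite indicE.
    by case: (_ \in _); rewrite ?normr1 ?normr0 ?expr1n ?expr0n.
  have cx' : box_avg (n + m0)%N i c l x @[n --> \oo] --> v x by have := cvg_shiftn m0 (fun n => box_avg n i c l x) (nbhs (v x)) => ->.
  have nx : `|box_avg (n + m0)%N i c l x| @[n --> \oo] --> `|v x| by apply: cvg_norm; exact: cx'.
  exact: (cvgM nx (cvgM nx nx)).
- move=> n; have [I E] := box_avg_cube (n + m0)%N i c l0.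
  by rewrite Rint_EFin// lee_fin E.
Qed.

(** Boxes of size [2^k] centered at the origin fill the space. *)
Lemma cube_R3 (B : R) : (forall n m c, X (n + m)%N 0 c (rho ^+ m) <= B) -> (\int[LL]_x (`|u x| ^+ 3)%:E <= B%:E)%E.
Proof.
move=> XB.
pose l k : R := rho ^+ (3 * k).
have lE k : l k = 2 ^+ k by rewrite /l exprM rho3.
have l0 k : 0 < l k by rewrite lE exprn_gt0.
pose c k : R3 R := vec3 (fun=> - l k / 2).
apply: (@fatou_ae (fun k x => `|u x| ^+ 3 * \1_(box 0 (c k) (l k)) x)).
- move=> n; apply: measurable_funM; last by apply: measurable_indic; exact: box_measurable.
  by apply: measurable_funX; apply: measurableT_comp => //; exact: L2_meas (H1p_L2 HG).
- by apply: measurable_funX; apply: measurableT_comp => //; exact: L2_meas (H1p_L2 HG).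
- by move=> n x; rewrite mulr_ge0// exprn_ge0.
- by move=> x; rewrite exprn_ge0.
- apply: aeW => x.
  apply: cvg_near_cst.
  pose s := `|coord 0 x| + `|coord 1 x| + `|coord 2 x|.
  have s0 : 0 <= 2 * s by rewrite mulr_ge0// !addr_ge0.
  exists (Num.bound (2 * s)) => // k /= Hk.
  have lk : 2 * s < l k.
    apply: lt_trans (_ : (k%:R : R) < _); last by rewrite lE -natrX ltr_nat ltn_expl.
    by apply: (lt_le_trans (archi_boundP s0)); rewrite ler_nat.
  have xb : box 0 (c k) (l k) x.
    apply/boxP => j; rewrite coord_vec3.
    have sj : `|coord j x| <= s.
      rewrite /s; move: (normr_ge0 (coord 0 x)) (normr_ge0 (coord 1 x)) (normr_ge0 (coord 2 x)).
      by elim/I3_ind: j; lra.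
    have sdj : l k <= side 0 (l k) j by rewrite /side ler_peMr ?(ltW (l0 k))// exprn_ege1// ltW// rho_gt1.
    move: sj; rewrite ler_norml => /andP[h1 h2].
    by apply/andP; split; lra.
  by rewrite indicE mem_set// mulr1.
- by move=> k; apply: (@cube_box (3 * k)%N) => // n; exact: XB.
Qed.
End rec.

End BoxAverages.

(** * The Coulomb energy *)

Section CoulombEnergy.
Variable R : realType.
Notation RR := (measurableTypeR R).
Notation mu := (@lebesgue_measure R).
Notation LL := (@leb3 R).
Notation L2 := (Lfun (@leb3 R) 2%:E).
Notation meas f := (measurable_fun [set: RR * RR * RR] f).
Implicit Types (u v f g phi psi : R3 R -> R) (i j : 'I_3) (x y c : R3 R) (l t : R).
Notation integ f := (LL.-integrable setT (EFin \o (f : R3 R -> R))).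
Notation rho := (@rho R).
Notation P2 := (leb3s R \x leb3s R)%E.
Notation meas2 F := (measurable_fun [set: (RR * RR * RR) * (RR * RR * RR)] F).
Implicit Types (F K : R3 R * R3 R -> R) (z : R3 R * R3 R).
Notation integ2 F := (P2.-integrable setT (EFin \o (F : R3 R * R3 R -> R))).

Lemma norm3_ge0 x : 0 <= norm3 x. Proof. exact: sqrtr_ge0. Qed.

Lemma norm3E x : norm3 x = Num.sqrt (coord 0 x ^+ 2 + coord 1 x ^+ 2 + coord 2 x ^+ 2).
Proof. by []. Qed.

Lemma coord_le_norm3 j x : `|coord j x| <= norm3 x.
Proof.
rewrite norm3E -sqrtr_sqr ler_sqrt; last by rewrite !addr_ge0 ?sqr_ge0.
have := sqr_ge0 (coord 0 x); have := sqr_ge0 (coord 1 x); have := sqr_ge0 (coord 2 x).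
by elim/I3_ind: j; lra.
Qed.

Lemma norm3_le (s : R) x : 0 <= s -> (forall j, `|coord j x| <= s) -> norm3 x <= 2 * s.
Proof.
move=> s0 H; rewrite norm3E -(ger0_norm (_ : 0 <= 2 * s)) ?mulr_ge0// -sqrtr_sqr ler_sqrt ?sqr_ge0//.
have K j : coord j x ^+ 2 <= s ^+ 2.
  by rewrite -(real_normK (num_real (coord j x))) ler_pXn2r ?nnegrE.
have := K 0; have := K 1; have := K 2; have := sqr_ge0 s; rewrite exprMn; lra.
Qed.

Lemma norm3N x : norm3 (- x) = norm3 x.
Proof. by rewrite !norm3E !coordN !sqrrN. Qed.

Lemma measurable_norm3 : meas (@norm3 R).
Proof.
rewrite (_ : @norm3 R = fun x => (coord 0 x ^+ 2 + coord 1 x ^+ 2 + coord 2 x ^+ 2) `^ 2^-1); last first.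
  by apply/funext => x; rewrite powR12_sqrt// !addr_ge0 ?sqr_ge0.
apply: (measurableT_comp (measurable_powR _)).
by apply: measurable_funD; [apply: measurable_funD|]; apply: measurable_funX; exact: measurable_coord.
Qed.

Lemma measurable_inorm3 : meas (fun x => (norm3 x)^-1).
Proof.
rewrite (_ : (fun x => _) = fun x : R3 R => norm3 x `^ (-1)); last first.
  by apply/funext => x; rewrite powR_inv1// norm3_ge0.
exact: (measurableT_comp (measurable_powR _) measurable_norm3).
Qed.

Lemma cube3_vol (r : R) : 0 < r -> LL (cube3 r) = (8 * r ^+ 3)%:E.
Proof.
move=> r0; rewrite cube3E leb3_setX; try exact: measurable_itv.
rewrite !lebesgue_measure_itv/= lte_fin.
have -> : - r < r by lra.
by rewrite -!EFinB -!EFinM; congr EFin; ring.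
Qed.

Definition ball1 : set (R3 R) := [set x | norm3 x < 1].
(** The square of the kernel [1 / |x|] is locally integrable in dimension 3. *)
Definition near_kernel x : R := (norm3 x)^-1 ^+ 2 * \1_ball1 x.

Lemma ball1_measurable : measurable (ball1 : set (RR * RR * RR)).
Proof.
rewrite (_ : ball1 = @norm3 R @^-1` `]-oo, 1[%classic); last by apply/seteqP; split => x /=; rewrite in_itv.
by rewrite -[X in measurable X]setTI; apply: measurable_norm3 => //; exact: measurable_itv.
Qed.

Lemma near_kernel_meas : meas near_kernel.
Proof.
apply: measurable_funM; last by apply: measurable_indic; exact: ball1_measurable.
by apply: measurable_funX; exact: measurable_inorm3.
Qed.
Lemma near_kernel_ge0 x : 0 <= near_kernel x. Proof. by rewrite /near_kernel mulr_ge0// sqr_ge0. Qed.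
Lemma near_kernelN x : near_kernel (- x) = near_kernel x.
Proof.
rewrite /near_kernel norm3N; congr (_ * _); have [b|b] := pselect (ball1 x).
  by rewrite !indicE !mem_set// /ball1/= norm3N.
by rewrite !indicE !memNset// /ball1/= norm3N.
Qed.

(** On the dyadic shell [2^-(j+1) <= |x| < 2^-j] the kernel is at most
    [4^(j+1)], and the shell is contained in a cube of volume [8 * 8^-j]. *)
Lemma near_kernel_integ : integ near_kernel.
Proof.
apply/integrableP; split; first by apply/measurable_EFinP; exact: near_kernel_meas.
pose q (j : nat) : R := 2^-1 ^+ j.
have q0 (j : nat) : 0 < q j by rewrite exprn_gt0// invr_gt0.
pose e (j : nat) x : R := 4 ^+ j.+1 * \1_(cube3 (q j)) x.
have e0 (j : nat) x : 0 <= e j x by rewrite mulr_ge0// exprn_ge0.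
have S0 x : (0 <= \sum_(0 <= j <oo) (e j x)%:E)%E.
  by apply: nneseries_ge0 => j _ _; rewrite lee_fin; exact: e0.
have B x : ((near_kernel x)%:E <= \sum_(0 <= j <oo) (e j x)%:E)%E.
  have [n0|n0] := eqVneq (norm3 x) 0.
    by rewrite /near_kernel n0 invr0 expr0n/= mul0r; exact: S0.
  have [n1|n1] := pselect (ball1 x); last first.
    by rewrite /near_kernel indicE memNset// mulr0; exact: S0.
  have np : 0 < norm3 x by rewrite lt_neqAle eq_sym n0 norm3_ge0.
  have ex : exists j : nat, q j.+1 <= norm3 x.
    exists (Num.bound (norm3 x)^-1).
    rewrite /q exprVn -[leRHS]invrK lef_pV2 ?posrE ?invr_gt0 ?exprn_gt0//.
    apply: ltW; apply: lt_trans (archi_boundP (_ : 0 <= (norm3 x)^-1)) _; first by rewrite invr_ge0 norm3_ge0.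
    by rewrite -natrX ltr_nat (leq_ltn_trans _ (ltn_expl _ _)).
  case: (ex_minnP ex) => j qj jmin.
  have nq : norm3 x < q j.
    case: j qj jmin => [_ _|j _ jmin]; first by rewrite /q expr0.
    by rewrite ltNge; apply/negP => /jmin; rewrite ltnn.
  apply: le_trans (_ : (\sum_(0 <= k < j.+1) (e k x)%:E <= _)%E); last first.
    by apply: nneseries_lim_ge => k _ _; rewrite lee_fin; exact: e0.
  rewrite sumEFin lee_fin big_nat_recr//=; apply: ler_wpDl; first by apply: sumr_ge0 => k _; exact: e0.
  rewrite /near_kernel /e !indicE mem_set// mem_set; last by move=> k; apply: le_trans (coord_le_norm3 k x) (ltW nq).
  rewrite !mulr1 exprVn -[leRHS]invrK lef_pV2 ?posrE ?invr_gt0 ?exprn_gt0//.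
  rewrite (_ : (4 ^+ j.+1)^-1 = q j.+1 ^+ 2); last first.
    by rewrite /q -exprVn -exprM mulnC exprM; congr (_ ^+ _); field.
  by rewrite ler_pXn2r ?nnegrE ?norm3_ge0// ltW.
have me (j : nat) : meas (e j) by apply: measurable_funM => //; apply: measurable_indic; exact: cube3_measurable.
apply: le_lt_trans (_ : _ <= \int[LL]_x \sum_(0 <= j <oo) (e j x)%:E)%E _.
  apply: ge0_le_integral => //.
  - by apply: measurableT_comp => //; apply/measurable_EFinP; exact: near_kernel_meas.
  - have := @ge0_emeasurable_sum _ (RR * RR * RR)%type R setT (fun (j : nat) x => (e j x)%:E) xpredT.
    by apply => [j x _ _|j _]; [rewrite lee_fin; exact: e0|apply/measurable_EFinP; exact: me].
  - by move=> x _; rewrite gee0_abs ?lee_fin ?near_kernel_ge0//; exact: B.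
rewrite integral_nneseries//; last 2 first.
  by move=> j; apply/measurable_EFinP; exact: me.
  by move=> j x _; rewrite lee_fin; exact: e0.
apply: le_lt_trans (_ : (64 : R)%:E < _)%E; last by rewrite ltry.
apply: lime_le; first by apply: is_cvg_nneseries => j _ _; apply: integral_ge0 => x _; rewrite lee_fin; exact: e0.
apply: nearW => N.
have E (j : nat) : (\int[LL]_x (e j x)%:E = (32 * q j)%:E)%E.
  rewrite Rint_EFin; last by apply: integZ; exact: integ_cube.
  rewrite RintZ; last exact: integ_cube.
  rewrite /Rintegral integral_indic ?setIT//; last exact: cube3_measurable.
  rewrite cube3_vol//=; congr EFin; rewrite /q exprS.
  have -> : (2^-1 ^+ j : R) ^+ 3 = 2^-1 ^+ j * (4 ^+ j)^-1.
    by rewrite -exprVn -exprMn -exprM mulnC exprM; congr (_ ^+ _); field.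
  by field; rewrite expf_neq0.
rewrite (eq_bigr (fun j : nat => (32 * q j)%:E))//.
rewrite sumEFin lee_fin.
have -> : \sum_(0 <= j < N) 32 * q j = 64 - 64 * q N.
  elim: N => [|N IH]; first by rewrite big_geq// /q expr0 mulr1 subrr.
  by rewrite big_nat_recr//= IH /q exprS; field; exact: isT.
by rewrite gerBl mulr_ge0// ltW.
Qed.

(** The singularity of the kernel is separated from the product of the two
    densities at the price of third powers of the function. *)
Lemma young_kernel (a b k : R) : 0 <= a -> 0 <= b -> 1 <= k ->
  a ^+ 2 * b ^+ 2 * k <= a ^+ 3 * b ^+ 3 + a ^+ 3 * k ^+ 2 + b ^+ 3 * k ^+ 2.
Proof.
have K (p q : R) : 0 <= q -> q <= p -> 1 <= k -> p ^+ 2 * q ^+ 2 * k <= p ^+ 3 * q ^+ 3 + p ^+ 3 * k ^+ 2.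
  move=> q0 qp k1; have p0 : 0 <= p by exact: le_trans qp.
  have pk0 : 0 <= p ^+ 3 * k ^+ 2 by rewrite mulr_ge0 ?exprn_ge0//; lra.
  have pq0 : 0 <= p ^+ 3 * q ^+ 3 by rewrite mulr_ge0 ?exprn_ge0//; lra.
  have [H|H] := leP k (p * q).
    apply: ler_wpDr => //.
    have -> : p ^+ 3 * q ^+ 3 = p ^+ 2 * q ^+ 2 * (p * q) by ring.
    by apply: ler_wpM2l => //; apply: mulr_ge0; exact: sqr_ge0.
  apply: ler_wpDl => //.
  have -> : p ^+ 3 * k ^+ 2 = p ^+ 2 * k * (p * k) by ring.
  rewrite (mulrAC (p ^+ 2)); apply: ler_wpM2l; first by apply: mulr_ge0; [exact: sqr_ge0|lra].
  have [p1|p1] := leP 1 p.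
    apply: (@le_trans _ _ (p * q)); first by rewrite expr2 ler_wpM2r.
    by apply: (le_trans (ltW H)); rewrite ler_peMl//; lra.
  apply: (@le_trans _ _ p); last by rewrite ler_peMr.
  apply: (@le_trans _ _ (p * q)); first by rewrite expr2 ler_wpM2r.
  by rewrite ler_piMr// ltW// (le_lt_trans qp).
move=> a0 b0 k1; have k0 : 0 <= k by lra.
have [ab|/ltW ba] := leP a b.
  have := K b a a0 ab k1; rewrite (mulrC (b ^+ 2)) (mulrC (b ^+ 3) (a ^+ 3)).
  have : 0 <= a ^+ 3 * k ^+ 2 by rewrite mulr_ge0 ?exprn_ge0.
  lra.
have := K a b b0 ba k1.
have : 0 <= b ^+ 3 * k ^+ 2 by rewrite mulr_ge0 ?exprn_ge0.
lra.
Qed.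

Lemma measurable_sub2 : measurable_fun [set: (RR * RR * RR) * (RR * RR * RR)] (fun z => (z.2 - z.1 : R3 R) : RR * RR * RR).
Proof.
have A k : meas2 (fun z => coord k z.2 - coord k z.1).
  apply: measurable_funB; first exact: (measurableT_comp (measurable_coord k) measurable_snd).
  exact: (measurableT_comp (measurable_coord k) measurable_fst).
apply/measurable_fun_pairP; split => /=; first (apply/measurable_fun_pairP; split => /=).
- exact: (A 0).
- exact: (A 1).
- exact: (A 2).
Qed.

Lemma meas2_1 f : meas f -> meas2 (fun z => f z.1).
Proof. by move=> mf; exact: (measurableT_comp mf measurable_fst). Qed.
Lemma meas2_2 f : meas f -> meas2 (fun z => f z.2).
Proof. by move=> mf; exact: (measurableT_comp mf measurable_snd). Qed.
Lemma meas2_sub f : meas f -> meas2 (fun z => f (z.2 - z.1)).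
Proof. by move=> mf; exact: (measurableT_comp mf measurable_sub2). Qed.

Lemma tonelli F : meas2 F -> (forall z, 0 <= F z) ->
  (\int[P2]_z (F z)%:E = \int[LL]_y \int[LL]_x (F (y, x))%:E)%E.
Proof.
by move=> mF F0; rewrite fubini_tonelli1//; exact/measurable_EFinP.
Qed.
Lemma tonelli' F : meas2 F -> (forall z, 0 <= F z) ->
  (\int[P2]_z (F z)%:E = \int[LL]_x \int[LL]_y (F (y, x))%:E)%E.
Proof.
by move=> mF F0; rewrite fubini_tonelli2//; exact/measurable_EFinP.
Qed.

Lemma integ2_ge0 F : meas2 F -> (forall z, 0 <= F z) -> (\int[P2]_z (F z)%:E < +oo)%E -> integ2 F.
Proof.
move=> mF F0 H; apply/integrableP; split; first exact/measurable_EFinP.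
by under eq_integral => z _ do rewrite /= ger0_norm//.
Qed.

Lemma integ2_le F K : meas2 F -> (forall z, `|F z| <= K z) -> integ2 K -> integ2 F.
Proof.
move=> mF FK; apply: le_integrable => //; first exact/measurable_EFinP.
by move=> z _ /=; rewrite lee_fin; apply: le_trans (FK z) (ler_norm _).
Qed.

Lemma integ2D F K : integ2 F -> integ2 K -> integ2 (fun z => F z + K z).
Proof. by move=> iF iK; have := integrableD measurableT iF iK. Qed.

Lemma tonelli_prod f g : integ f -> integ g -> (forall x, 0 <= f x) -> (forall x, 0 <= g x) ->
  (\int[P2]_z (f z.1 * g z.2)%:E = ((\int[LL]_x f x) * (\int[LL]_x g x))%:E)%E.
Proof.
move=> fi gi f0 g0; rewrite tonelli; last first.
- by move=> z; rewrite mulr_ge0.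
- by apply: measurable_funM; [apply: meas2_1|apply: meas2_2]; exact: integ_meas.
transitivity (\int[LL]_y (f y * \int[LL]_x g x)%:E)%E.
  by apply: eq_integral => y _; rewrite /= Rint_EFin ?RintZ//; exact: integZ.
rewrite Rint_EFin; last by apply: eq_integ (integZ (\int[LL]_x g x) fi) => x; rewrite mulrC.
by congr EFin; rewrite mulrC -RintZ//; apply: eq_Rint => x; rewrite mulrC.
Qed.

Lemma tonelli_shear f g : integ f -> integ g -> (forall x, 0 <= f x) -> (forall x, 0 <= g x) ->
  (\int[P2]_z (f z.1 * g (z.2 - z.1))%:E = ((\int[LL]_x f x) * (\int[LL]_x g x))%:E)%E.
Proof.
move=> fi gi f0 g0; rewrite tonelli; last first.
- by move=> z; rewrite mulr_ge0.
- by apply: measurable_funM; [apply: meas2_1|apply: meas2_sub]; exact: integ_meas.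
transitivity (\int[LL]_y (f y * \int[LL]_x g x)%:E)%E.
  apply: eq_integral => y _; rewrite /= Rint_EFin; last by apply: integZ; exact: (integ_tr (- y) gi).
  by rewrite (RintZ _ (integ_tr (- y) gi)) (Rintegral_tr3 (- y) (integ_meas gi)).
rewrite Rint_EFin; last by apply: eq_integ (integZ (\int[LL]_x g x) fi) => x; rewrite mulrC.
by congr EFin; rewrite mulrC -RintZ//; apply: eq_Rint => x; rewrite mulrC.
Qed.

Lemma tonelli_shear' f g : integ f -> integ g -> (forall x, 0 <= f x) -> (forall x, 0 <= g x) -> (forall x, g (- x) = g x) ->
  (\int[P2]_z (f z.2 * g (z.2 - z.1))%:E = ((\int[LL]_x f x) * (\int[LL]_x g x))%:E)%E.
Proof.
move=> fi gi f0 g0 gN; rewrite tonelli'; last first.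
- by move=> z; rewrite mulr_ge0.
- by apply: measurable_funM; [apply: meas2_2|apply: meas2_sub]; exact: integ_meas.
transitivity (\int[LL]_y (f y * \int[LL]_x g x)%:E)%E.
  apply: eq_integral => y _; transitivity (\int[LL]_x (f y * g (x - y))%:E)%E; first by apply: eq_integral => x _; rewrite -gN opprB.
  rewrite Rint_EFin; last by apply: integZ; exact: (integ_tr (- y) gi).
  by rewrite (RintZ _ (integ_tr (- y) gi)) (Rintegral_tr3 (- y) (integ_meas gi)).
rewrite Rint_EFin; last by apply: eq_integ (integZ (\int[LL]_x g x) fi) => x; rewrite mulrC.
by congr EFin; rewrite mulrC -RintZ//; apply: eq_Rint => x; rewrite mulrC.
Qed.

Definition coulomb_density u z : R := u z.2 ^+ 2 * u z.1 ^+ 2 / norm3 (z.2 - z.1).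

Lemma coulomb_density_ge0 u z : 0 <= coulomb_density u z.
Proof. by apply: divr_ge0; [apply: mulr_ge0; exact: sqr_ge0|exact: norm3_ge0]. Qed.

Lemma coulomb_density_meas u : meas u -> meas2 (coulomb_density u).
Proof.
move=> mu; apply: measurable_funM; last exact: (meas2_sub measurable_inorm3).
apply: measurable_funM; [exact: (meas2_2 (measurable_funX 2 mu))|exact: (meas2_1 (measurable_funX 2 mu))].
Qed.

Lemma coulombE u : meas u -> coulomb u = \int[P2]_z coulomb_density u z.
Proof. by move=> mu; rewrite /coulomb /Rintegral tonelli//; [exact: coulomb_density_meas|exact: coulomb_density_ge0]. Qed.

(** Where [|x - y| >= 1] the density is at most [u(x)^2 u(y)^2], and
    elsewhere [young_kernel] bounds it by functions whose integrals Tonelli's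
    theorem computes. Thus the Coulomb energy is finite as soon as [u] is
    square and cube integrable. *)
Lemma coulomb_density_integ u : u \in L2 -> integ (fun x => `|u x| ^+ 3) -> integ2 (coulomb_density u).
Proof.
move=> lu iu; have mu := L2_meas lu; have iq := L2_sqr lu.
have c0 x : 0 <= `|u x| ^+ 3 by rewrite exprn_ge0.
have q0 x : 0 <= u x ^+ 2 by exact: sqr_ge0.
pose F1 z := u z.1 ^+ 2 * u z.2 ^+ 2.
pose F2 z := `|u z.1| ^+ 3 * `|u z.2| ^+ 3.
pose F3 z := `|u z.1| ^+ 3 * near_kernel (z.2 - z.1).
pose F4 z := `|u z.2| ^+ 3 * near_kernel (z.2 - z.1).
have mc : meas (fun x => `|u x| ^+ 3) by exact: integ_meas.
have mq : meas (fun x => u x ^+ 2) by exact: integ_meas.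
have i1 : integ2 F1.
  apply: integ2_ge0; first by apply: measurable_funM; [exact: (meas2_1 mq)|exact: (meas2_2 mq)].
    by move=> z; rewrite mulr_ge0.
  by rewrite (tonelli_prod iq iq)// ltry.
have i2 : integ2 F2.
  apply: integ2_ge0; first by apply: measurable_funM; [exact: (meas2_1 mc)|exact: (meas2_2 mc)].
    by move=> z; rewrite mulr_ge0.
  by rewrite (tonelli_prod iu iu)// ltry.
have i3 : integ2 F3.
  apply: integ2_ge0; first by apply: measurable_funM; [exact: (meas2_1 mc)|exact: (meas2_sub near_kernel_meas)].
    by move=> z; rewrite mulr_ge0// near_kernel_ge0.
  by rewrite (tonelli_shear iu near_kernel_integ)// ?ltry// => x; exact: near_kernel_ge0.
have i4 : integ2 F4.
  apply: integ2_ge0; first by apply: measurable_funM; [exact: (meas2_2 mc)|exact: (meas2_sub near_kernel_meas)].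
    by move=> z; rewrite mulr_ge0// near_kernel_ge0.
  by rewrite (tonelli_shear' iu near_kernel_integ)// ?ltry// => x; [exact: near_kernel_ge0|exact: near_kernelN].
have ii : integ2 (fun z => F1 z + (F2 z + (F3 z + F4 z))).
  by apply: integ2D => //; apply: integ2D => //; exact: integ2D.
apply: integ2_le ii; first exact: coulomb_density_meas.
move=> z; rewrite ger0_norm ?coulomb_density_ge0// /coulomb_density.
have p1 : 0 <= F1 z by rewrite mulr_ge0.
have p2 : 0 <= F2 z by rewrite mulr_ge0.
have p3 : 0 <= F3 z by rewrite mulr_ge0// near_kernel_ge0.
have p4 : 0 <= F4 z by rewrite mulr_ge0// near_kernel_ge0.
have [k1|k1] := leP (norm3 (z.2 - z.1))^-1 1.
  apply: (@le_trans _ _ (F1 z)); last by rewrite lerDl !addr_ge0.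
  by rewrite /F1 (mulrC (u z.1 ^+ 2)); apply: ler_piMr => //; exact: mulr_ge0.
have n0 : 0 < norm3 (z.2 - z.1).
  by rewrite -invr_gt0; apply: lt_trans k1.
have n1 : norm3 (z.2 - z.1) < 1.
  by rewrite -[ltRHS]invr1 -[ltLHS]invrK ltf_pV2 ?posrE ?invr_gt0.
apply: le_trans (_ : _ <= F2 z + (F3 z + F4 z)) _; last by rewrite lerDr.
have := young_kernel (normr_ge0 (u z.2)) (normr_ge0 (u z.1)) (ltW k1).
rewrite !real_normK ?num_real// => H; apply: le_trans H _.
rewrite /F2 /F3 /F4 /near_kernel indicE mem_set// mulr1 (mulrC (`|u z.1| ^+ 3) (`|u z.2| ^+ 3)).
by rewrite -addrA lerD2l addrC.
Qed.

Lemma LL_point x : LL [set x] = 0%E.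
Proof.
rewrite (_ : [set x] = [set x.1.1] `*` [set x.1.2] `*` [set x.2]); last first.
  by apply/seteqP; split => [y ->|[[a b] c] /= [[-> ->] ->]]//; move: x => [[]].
by rewrite leb3_setX ?lebesgue_measure_set1 ?mule0.
Qed.

Lemma measurable_point x : measurable ([set x] : set (RR * RR * RR)).
Proof.
rewrite (_ : [set x] = [set x.1.1] `*` [set x.1.2] `*` [set x.2]); last first.
  by apply/seteqP; split => [y ->|[[a b] c] /= [[-> ->] ->]]//; move: x => [[]].
by apply: measurableX => //; exact: measurableX.
Qed.

(** On the diagonal the inverse distance is 0 by convention, so that pointwise
    lower bounds fail there. The diagonal is negligible. *)
Lemma Rint2_diag F : meas2 F -> (forall z, 0 <= F z) -> \int[P2]_z (F z * \1_[set 0] (z.2 - z.1)) = 0.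
Proof.
move=> mF F0; rewrite /Rintegral.
have m0 : meas (\1_[set 0] : R3 R -> R) by apply: measurable_indic; exact: measurable_point.
have mG : meas2 (fun z => F z * \1_[set 0] (z.2 - z.1)) by apply: measurable_funM => //; exact: meas2_sub m0.
rewrite tonelli//; last by move=> z; rewrite mulr_ge0.
transitivity (fine (\int[LL]_(y in setT) 0)%E); last by rewrite integral0.
congr fine; apply: eq_integral => y _; transitivity (\int[LL]_(x in setT) 0)%E; last by rewrite integral0.
apply: ae_eq_integral => //.
- by apply/measurable_EFinP; exact: (measurableT_comp mG (pair1_measurable (y : RR * RR * RR))).
exists [set y]; split; [exact: measurable_point|exact: LL_point|].
move=> x /= H; apply: contrapT => xy; apply: H => _.
rewrite indicE memNset ?mulr0//= => /eqP; rewrite subr_eq0 => /eqP; exact: xy.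
Qed.

Lemma dist_le (p q s d m : R) : p < q -> q <= p + d -> p < s -> s <= p + d -> d <= m -> `|q - s| <= m.
Proof. by move=> *; rewrite ler_norml; apply/andP; split; lra. Qed.

Section energy.
Variables (u : R3 R -> R) (G : 'I_3 -> R3 R -> R) (HG : H1p u G).
Notation J := (@box_int R).
Notation X := (avg_cube u).
Notation aa := (J (usq u)).
Notation bb := (J (gsq G)).
Notation c' i c l := (c + (l / rho) *: basis3 R i).

Notation A0 := (\int[LL]_x (u x ^+ 2)).
Notation B0 := (\int[LL]_x gsq G x).
Let aaA i c l : aa i c l <= A0.
Proof. by apply: box_int_le; [exact: usq_ge0|exact: int_usq HG]. Qed.
Let bbB i c l : bb i c l <= B0.
Proof. by apply: box_int_le; [exact: gsq_ge0|exact: int_gsq HG]. Qed.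
Let A00 : 0 <= A0. Proof. by apply: Rint_ge0 => x; exact: sqr_ge0. Qed.

(** At a level [t] with [t^2] above the integral of [u^2] all boxes of size 1
    are good, so that the Coulomb energy, not yet known to be finite, does not
    show up. *)
Lemma H1p_cube_integ : integ (fun x => `|u x| ^+ 3).
Proof.
have r0 := @rho_gt0 R; have C4 := @C0_ge4 R.
pose t := 1 + A0; have t0 : 0 <= t by rewrite addr_ge0.
have At : A0 <= t ^+ 2.
  have K (a : R) : 0 <= a -> a <= (1 + a) ^+ 2.
    by move=> a0; rewrite (_ : (1 + a) ^+ 2 = 1 + a + a + a ^+ 2); [have := sqr_ge0 a; lra|ring].
  exact: K.
apply/integrableP; split.
  by apply/measurable_EFinP; apply: measurable_funX; apply: measurableT_comp => //; exact: L2_meas (H1p_L2 HG).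
under eq_integral => x _ do rewrite /= (ger0_norm (exprn_ge0 3 (normr_ge0 (u x)))).
apply: le_lt_trans (cube_R3 HG (B := t * A0 + C0 R * t * B0) _) _; last by rewrite ltry.
move=> n m c.
apply: le_trans (_ : _ <= t * aa 0 c (rho ^+ m) + C0 R * t * bb 0 c (rho ^+ m)) _; last first.
  by apply: lerD; apply: ler_wpM2l => //; apply: mulr_ge0 => //; exact: le_trans C4.
apply: (avg_cube_scale (F := fun i c l => t * aa i c l + C0 R * t * bb i c l)).
  by move=> i d l l0; rewrite (aa_split HG i d l0) (bb_split HG i d l0) !mulrDr addrACA.
move=> i d; have := avg_cube_good_le HG n (i := i) (c := d) ltr01 t0.
by rewrite mulr1 expr1n divr1; apply; exact: le_trans (aaA _ _ _) At.
Qed.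

Lemma H1p_coulomb_integ : integ2 (coulomb_density u).
Proof. by apply: coulomb_density_integ H1p_cube_integ; exact: H1p_L2 HG. Qed.

Definition coulomb_on (A B : set (R3 R)) : R := \int[P2]_z (coulomb_density u z * (\1_A z.2 * \1_B z.1)).

Lemma integ_coulomb_on (A B : set (RR * RR * RR)) : measurable A -> measurable B -> integ2 (fun z => coulomb_density u z * (\1_A z.2 * \1_B z.1)).
Proof.
move=> mA mB; apply: integ2_le H1p_coulomb_integ.
  apply: measurable_funM; first by apply: coulomb_density_meas; exact: L2_meas (H1p_L2 HG).
  by apply: measurable_funM; [apply: (@meas2_2 (\1_A))|apply: (@meas2_1 (\1_B))]; exact: measurable_indic.
move=> z; rewrite normrM (ger0_norm (coulomb_density_ge0 u z)); apply: ler_piMr; first exact: coulomb_density_ge0.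
by rewrite normrM !indicE; case: (_ \in A); case: (_ \in B); rewrite ?normr1 ?normr0 ?mulr1 ?mulr0.
Qed.

(** Two points of a box of size [l] are at distance at most [4 l]. *)
Lemma coulomb_on_low (A B : set (RR * RR * RR)) i c l : 0 < l -> measurable A -> measurable B ->
  A `<=` box i c l -> B `<=` box i c l ->
  (\int[LL]_x (usq u x * \1_A x)) * (\int[LL]_x (usq u x * \1_B x)) / (4 * l) <= coulomb_on A B.
Proof.
move=> l0 mA mB AQ BQ.
have iI (S : set (RR * RR * RR)) : measurable S -> integ (fun x => usq u x * \1_S x).
  move=> mS; apply: (integ_bddM (M := 1) (int_usq HG)); first exact: measurable_indic.
  by move=> x; rewrite indicE; case: (_ \in _); rewrite ?normr1 ?normr0.
have I0 (S : set (R3 R)) x : 0 <= usq u x * \1_S x by rewrite mulr_ge0// usq_ge0.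
pose F z := (usq u z.1 * \1_B z.1) * (usq u z.2 * \1_A z.2).
have F0 z : 0 <= F z by rewrite mulr_ge0.
have mF : meas2 F.
  by apply: measurable_funM; [apply: (meas2_1 (integ_meas (iI B mB)))|apply: (meas2_2 (integ_meas (iI A mA)))].
have TF := tonelli_prod (iI B mB) (iI A mA) (I0 B) (I0 A).
have iF : integ2 F by apply: integ2_ge0 => //; rewrite TF ltry.
have RF : \int[P2]_z F z = (\int[LL]_x (usq u x * \1_A x)) * (\int[LL]_x (usq u x * \1_B x)).
  by rewrite /Rintegral TF /= mulrC.
pose F' z := (4 * l)^-1 * F z.
have iF' : integ2 F' by have := integrableZl measurableT (4 * l)^-1 iF.
have RF' : \int[P2]_z F' z = (4 * l)^-1 * \int[P2]_z F z by rewrite RintegralZl.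
(* Carries the lower bound on the diagonal, without changing the integral. *)
pose Dg z := F' z * \1_[set 0] (z.2 - z.1).
have l40 : 0 <= (4 * l)^-1 by rewrite invr_ge0 mulr_ge0// ltW.
have F'0 z : 0 <= F' z by rewrite mulr_ge0.
have mF' : meas2 F' by apply: measurable_funM.
have D0 : \int[P2]_z Dg z = 0 by exact: Rint2_diag.
have iD : integ2 Dg.
  apply: integ2_le iF'.
    by apply: measurable_funM => //; apply: (@meas2_sub (\1_[set 0])); apply: measurable_indic; exact: measurable_point.
  move=> z; have Dz : 0 <= Dg z by apply: mulr_ge0.
  by rewrite (ger0_norm Dz); apply: ler_piMr.
have iE := integ_coulomb_on mA mB.
rewrite mulrC -RF -RF' -[leRHS]addr0 -D0 -RintegralD//.
apply: le_Rintegral => //; first exact: integ2D.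
move=> z _.
have [[za zb]|nab] := pselect (A z.2 /\ B z.1); last first.
  have -> : F' z = 0.
    rewrite /F' /F; have [zb|zb] := pselect (B z.1); last by rewrite indicE memNset// mulr0 mul0r mulr0.
    by rewrite [X in _ * (_ * X)]indicE memNset ?mulr0// => za; apply: nab.
  by apply: addr_ge0; apply: mulr_ge0; [exact: coulomb_density_ge0|exact: mulr_ge0| |].
rewrite /Dg /F' /F !indicE !(mem_set za) !(mem_set zb) !mulr1.
have [z0|z0] := eqVneq (z.2 - z.1) 0.
  by rewrite z0 mem_set//= mulr1 lerDr coulomb_density_ge0.
rewrite memNset; last by move/eqP: z0.
rewrite mulr0 addr0 /coulomb_density /usq mulrC (mulrC (u z.1 ^+ 2)); apply: ler_wpM2l; first by apply: mulr_ge0; exact: sqr_ge0.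
have n0 : 0 < norm3 (z.2 - z.1).
  rewrite lt_neqAle norm3_ge0 andbT eq_sym; apply/eqP => N0; move/eqP: z0; apply; apply: ext3 => j.
  have := coord_le_norm3 j (z.2 - z.1); rewrite N0 normr_le0 => /eqP ->.
  by elim/I3_ind: j.
rewrite lef_pV2 ?posrE ?mulr_gt0//.
have r0 := @rho_gt0 R; have r1 := @rho_gt1 R; have r3 := @rho3 R.
have r2 : rho ^+ 2 <= 2.
  have : rho ^+ 2 * 1 <= rho ^+ 2 * rho by rewrite ler_wpM2l ?sqr_ge0// ltW.
  by rewrite mulr1 -exprSr r3.
apply: le_trans (norm3_le (s := 2 * l) _ _) _; first by rewrite mulr_ge0// ltW.
  move=> j; rewrite coordD coordN.
  have /boxP/(_ j)/andP[a1 a2] := AQ _ za; have /boxP/(_ j)/andP[b1 b2] := BQ _ zb.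
  have : side i l j <= 2 * l.
    rewrite /side mulrC ler_pM2r//; apply: le_trans r2.
    by rewrite ler_weXn2l ?leq_subr// ltW.
  exact: (dist_le a1 a2 b1 b2).
by rewrite mulrA -natrM.
Qed.

Definition coulomb_box i c l : R := coulomb_on (box i c l) (box i c l).

Lemma coulomb_box_low i c l : 0 < l -> aa i c l ^+ 2 / (4 * l) <= coulomb_box i c l.
Proof. by move=> l0; apply: (@coulomb_on_low _ _ i c l) => //; exact: box_measurable. Qed.

Lemma coulomb_box_split i c l : 0 < l ->
  coulomb_box (i + 1) c (l / rho) + coulomb_box (i + 1) (c' i c l) (l / rho) + 2 * (aa (i + 1) c (l / rho) * aa (i + 1) (c' i c l) (l / rho)) / (4 * l) <= coulomb_box i c l.
Proof.
move=> l0.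
set Q1 := box (i + 1) c (l / rho); set Q2 := box (i + 1) (c' i c l) (l / rho).
have m1 : measurable (Q1 : set (RR * RR * RR)) by exact: box_measurable.
have m2 : measurable (Q2 : set (RR * RR * RR)) by exact: box_measurable.
have sp x : \1_(box i c l) x = \1_Q1 x + \1_Q2 x :> R by exact: box_split.
have s1 : Q1 `<=` box i c l.
  move=> x x1; have := sp x; rewrite !indicE (mem_set x1); case: (boolP (x \in box i c l)) => [/set_mem//|_] /=.
  by have : 0 <= ((x \in Q2)%:R : R) by []; lra.
have s2 : Q2 `<=` box i c l.
  move=> x x1; have := sp x; rewrite !indicE (mem_set x1); case: (boolP (x \in box i c l)) => [/set_mem//|_] /=.
  by have : 0 <= ((x \in Q1)%:R : R) by []; lra.
have E : coulomb_box i c l = coulomb_on Q1 Q1 + coulomb_on Q1 Q2 + coulomb_on Q2 Q1 + coulomb_on Q2 Q2.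
  rewrite /coulomb_box /coulomb_on -!RintegralD//; try exact: integ_coulomb_on.
  - by apply: eq_Rintegral => z _; rewrite !sp; ring.
  - by apply: integ2D; [apply: integ2D|]; exact: integ_coulomb_on.
  - by apply: integ2D; exact: integ_coulomb_on.
rewrite E /coulomb_box -/Q1 -/Q2.
have [a1 E1] : exists a, a = aa (i + 1) c (l / rho) by eexists.
have [a2 E2'] : exists a, a = aa (i + 1) (c' i c l) (l / rho) by eexists.
have L1 : a1 * a2 / (4 * l) <= coulomb_on Q1 Q2 by rewrite E1 E2'; exact: coulomb_on_low l0 m1 m2 s1 s2.
have L2 : a2 * a1 / (4 * l) <= coulomb_on Q2 Q1 by rewrite E1 E2'; exact: coulomb_on_low l0 m2 m1 s2 s1.
rewrite -E1 -E2'; rewrite (mulrC a2) in L2.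
have -> : 2 * (a1 * a2) / (4 * l) = a1 * a2 / (4 * l) + a1 * a2 / (4 * l) by ring.
rewrite -!addrA (addrC (coulomb_on Q2 Q2)) lerD2l addrA lerD2r; exact: lerD.
Qed.

(** The key estimate. Its right hand side is optimized over [t]: a small [t]
    makes the gradient term as small as wanted, at the expense of the Coulomb
    term. *)
Lemma coulomb_cube t : 0 < t ->
  \int[LL]_x (`|u x| ^+ 3) <= C1 R * t * (B0 + A0 + 12 * rho / t ^+ 2 * coulomb u).
Proof.
move=> t0; have r0 := @rho_gt0 R; have r1 := @rho_gt1 R; have C4 := @C0_ge4 R.
have C10 : 0 < C1 R.
  have : 0 < 1 / (rho - 1) by rewrite divr_gt0// subr_gt0.
  by rewrite /C1; lra.
have CU : coulomb u = \int[P2]_z coulomb_density u z by apply: coulombE; exact: L2_meas (H1p_L2 HG).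
have DC i c l : coulomb_box i c l <= coulomb u.
  rewrite CU; apply: le_Rintegral => //; [apply: integ_coulomb_on; exact: box_measurable|exact: H1p_coulomb_integ|].
  by move=> z _; apply: ler_piMr; [exact: coulomb_density_ge0|rewrite mulr_ile1].
have k0 : 0 <= 3 / t ^+ 2 by rewrite divr_ge0// sqr_ge0.
rewrite -lee_fin -Rint_EFin; last exact: H1p_cube_integ.
apply: (cube_R3 HG) => n m c.
pose F i c l := C1 R * t * (bb i c l + aa i c l + 3 / t ^+ 2 * (4 * rho * coulomb_box i c l)).
apply: (@le_trans _ _ (F 0 c (rho ^+ m))); last first.
  rewrite /F; apply: ler_wpM2l; first by rewrite mulr_ge0 ?ltW.
  apply: lerD; first by apply: lerD.
  rewrite (_ : 12 * rho / _ * _ = 3 / t ^+ 2 * (4 * rho * coulomb u)); last by ring.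
  by rewrite ler_wpM2l// ler_wpM2l// mulr_ge0// ltW.
apply: (avg_cube_scale (F := F)).
  move=> i d l l0; rewrite /F -mulrDr; apply: ler_wpM2l; first by rewrite mulr_ge0 ?ltW.
  rewrite (aa_split HG i d l0) (bb_split HG i d l0).
  have := coulomb_box_split i d l0; have a1 := aa_ge0 u (i + 1) d (l / rho); have a2 := aa_ge0 u (i + 1) (c' i d l) (l / rho).
  set d1 := coulomb_box _ _ _; set d2 := coulomb_box _ _ _; set d0 := coulomb_box _ _ _ => H.
  have H' : d1 + d2 <= d0.
    apply: le_trans H; rewrite lerDl; apply: divr_ge0; last by rewrite mulr_ge0// ltW.
    by apply: mulr_ge0 => //; exact: mulr_ge0.
  have : 3 / t ^+ 2 * (4 * rho * (d1 + d2)) <= 3 / t ^+ 2 * (4 * rho * d0).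
    by rewrite ler_wpM2l// ler_wpM2l// mulr_ge0// ltW.
  rewrite !mulrDr; set q1 := _ * (_ * d1); set q2 := _ * (_ * d2); set q3 := _ * (_ * d0).
  lra.
move=> i d; apply: le_trans (stopping HG coulomb_box_split coulomb_box_low n i d ltr01 t0) _.
rewrite /F; apply: ler_wpM2l; first by rewrite mulr_ge0 ?ltW.
rewrite expr1n !divr1 lerD2l; apply: ler_wpM2l => //.
by rewrite gerBl sqr_ge0.
Qed.
End energy.

End CoulombEnergy.

(** * Strong coupling *)

Section StrongCoupling.
Variable R : realType.
Notation RR := (measurableTypeR R).
Notation LL := (@leb3 R).
Notation meas f := (measurable_fun [set: RR * RR * RR] f).
Implicit Types (u v f g phi psi : R3 R -> R) (i j : 'I_3) (x y c : R3 R) (l t : R).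
Notation integ f := (LL.-integrable setT (EFin \o (f : R3 R -> R))).
Notation rho := (@rho R).

Section power.
Variables (p : R) (hp2 : 2 < p) (hp3 : p < 3).

Lemma powR_split2 (s : R) : 0 < s -> s `^ p = s ^+ 2 * s `^ (p - 2).
Proof.
move=> s0; rewrite -powR_mulrn ?ltW// -powRD; last by rewrite (gt_eqF s0) implybT.
by congr (_ `^ _); rewrite addrC subrK.
Qed.
Lemma powR_split3 (s : R) : 0 < s -> s `^ p = s ^+ 3 * s `^ (p - 3).
Proof.
move=> s0; rewrite -powR_mulrn ?ltW// -powRD; last by rewrite (gt_eqF s0) implybT.
by congr (_ `^ _); rewrite addrC subrK.
Qed.

(** For [p] between 2 and 3 the power is below the quadratic term left of
    [tau], and below the cubic term right of [tau]. *)
Lemma powR_between (tau s : R) : 0 < tau -> 0 <= s -> s `^ p <= tau `^ (p - 2) * s ^+ 2 + tau `^ (p - 3) * s ^+ 3.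
Proof.
move=> tau0; rewrite le_eqVlt => /orP[/eqP <-|s0].
  by rewrite powR0 ?gt_eqF ?(lt_trans _ hp2)// !expr0n/= !mulr0 addr0.
have [st|/ltW ts] := leP s tau.
  apply: (@le_trans _ _ (tau `^ (p - 2) * s ^+ 2)).
    rewrite powR_split2// mulrC ler_wpM2r ?sqr_ge0//; apply: ge0_ler_powR => //; rewrite ?nnegrE ?(ltW s0) ?(ltW tau0)//.
    by rewrite subr_ge0 ltW.
  by rewrite lerDl mulr_ge0 ?powR_ge0// exprn_ge0// ltW.
apply: (@le_trans _ _ (tau `^ (p - 3) * s ^+ 3)).
  rewrite powR_split3// mulrC ler_wpM2r ?exprn_ge0 ?(ltW s0)//.
  have -> : p - 3 = - (3 - p) by ring.
  rewrite !powRN lef_pV2 ?posrE ?powR_gt0//.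
  by apply: ge0_ler_powR; rewrite ?nnegrE ?(ltW s0) ?(ltW tau0) ?subr_ge0 ?(ltW hp3).
by rewrite lerDr mulr_ge0 ?powR_ge0// sqr_ge0.
Qed.

(** The level [tau] is the one for which the quadratic coefficient is [p / 4]. *)
Lemma powR_absorb : exists2 M : R, 0 < M & forall s : R, 0 <= s -> p^-1 * s `^ p <= s ^+ 2 / 4 + M * s ^+ 3.
Proof.
have p0 : 0 < p by exact: lt_trans hp2.
pose tau := (p / 4) `^ (p - 2)^-1.
have tau0 : 0 < tau by rewrite powR_gt0// divr_gt0.
have tauE : tau `^ (p - 2) = p / 4.
  by rewrite /tau -powRrM mulVf ?powRr1 ?divr_ge0 ?ltW// gt_eqF// subr_gt0.
exists (p^-1 * tau `^ (p - 3)); first by rewrite mulr_gt0 ?invr_gt0// powR_gt0.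
move=> s s0; have := powR_between tau0 s0; rewrite tauE => H.
have ip0 : 0 <= p^-1 by rewrite invr_ge0 ltW.
apply: le_trans (ler_wpM2l ip0 H) _.
by rewrite mulrDr !mulrA lerD2r le_eqVlt; apply/orP; left; apply/eqP; field; rewrite gt_eqF.
Qed.

Lemma powR_meas f : meas f -> meas (fun x => `|f x| `^ p).
Proof. by move=> mf; apply: (measurableT_comp (measurable_powR p)); exact: measurableT_comp. Qed.

Lemma powR_integ u G : H1p u G -> integ (fun x => `|u x| `^ p).
Proof.
move=> HG; apply: integ_le (integD (L2_sqr (H1p_L2 HG)) (H1p_cube_integ HG)).
  by apply: powR_meas; exact: L2_meas (H1p_L2 HG).
move=> x; rewrite (ger0_norm (powR_ge0 _ _)); apply: le_trans (ler_norm _).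
have := powR_between ltr01 (normr_ge0 (u x)).
by rewrite !powR1 !mul1r real_normK ?num_real.
Qed.

(** The functional, with an arbitrary weak gradient instead of the chosen one. *)
Definition energy (lambda : R) u (G : 'I_3 -> R3 R -> R) : R :=
  2^-1 * (\int[LL]_x gsq G x + \int[LL]_x (u x ^+ 2)) + lambda / 4 * coulomb u - p^-1 * \int[LL]_x (`|u x| `^ p).

Lemma Rint_gsq u G : H1p u G -> \int[LL]_x gsq G x = \sum_i \int[LL]_x (G i x ^+ 2).
Proof.
move=> HG; rewrite sum3 /gsq.
have I i := L2_sqr (H1p_gradL2 HG i).
by rewrite RintD ?RintD//; exact: integD.
Qed.

Lemma I_functionalE (lambda : R) u G : H1p u G -> I_functional p lambda u = energy lambda u G.
Proof. by move=> HG; rewrite /I_functional /energy (H1p_energy HG) (Rint_gsq HG). Qed.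

Lemma coulomb_ge0 u : 0 <= coulomb u.
Proof.
rewrite /coulomb fine_ge0//; apply: integral_ge0 => y _; apply: integral_ge0 => x _.
by rewrite lee_fin; apply: divr_ge0; [apply: mulr_ge0; exact: sqr_ge0|exact: norm3_ge0].
Qed.

(** With [M] from [powR_absorb], the level [t] of [coulomb_cube] is chosen such
    that the factor [M * C1 * t] is [1/4]. The quadratic part of the bound for
    the power is then below that of the functional, and what remains of the
    bound is a fixed multiple of the Coulomb energy, absorbed by the quartic
    part for strong coupling. *)
Lemma energy_ge0_large : exists2 L : R, 0 < L & forall (lambda : R) u G, H1p u G -> L <= lambda -> 0 <= energy lambda u G.
Proof.
have [M M0 HM] := powR_absorb.
have r0 := @rho_gt0 R; have r1 := @rho_gt1 R; have C4 := @C0_ge4 R.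
have C10 : 0 < C1 R.
  have : 0 < 1 / (rho - 1) by rewrite divr_gt0// subr_gt0.
  by rewrite /C1; lra.
pose t := (4 * M * C1 R)^-1.
have t0 : 0 < t by rewrite invr_gt0 !mulr_gt0.
have Mt : M * (C1 R * t) = 4^-1 by rewrite /t; field; rewrite !gt_eqF.
exists (12 * rho / t ^+ 2); first by rewrite divr_gt0 ?exprn_gt0// mulr_gt0.
move=> lambda u G HG Ll.
have K0 := coulomb_ge0 u.
have CC := coulomb_cube HG t0.
have I1 := powR_integ HG; have I2 := L2_sqr (H1p_L2 HG); have I3 := H1p_cube_integ HG.
have PP : p^-1 * \int[LL]_x (`|u x| `^ p) <= 4^-1 * \int[LL]_x (u x ^+ 2) + M * \int[LL]_x (`|u x| ^+ 3).
  rewrite -!RintZ// -RintD; [|exact: integZ..].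
  apply: Rint_le; [exact: integZ|by apply: integD; exact: integZ|].
  by move=> x; have := HM _ (normr_ge0 (u x)); rewrite real_normK ?num_real// (mulrC 4^-1).
have B0 : 0 <= \int[LL]_x gsq G x by apply: Rint_ge0 => x; exact: gsq_ge0.
have LK : 12 * rho / t ^+ 2 * coulomb u <= lambda * coulomb u by rewrite ler_wpM2r.
have MC := ler_wpM2l (ltW M0) CC.
rewrite (mulrA M) Mt in MC.
rewrite /energy; move: PP B0 LK MC.
set P := p^-1 * _; set A := \int[LL]_x (u x ^+ 2); set B := \int[LL]_x gsq G x; set N := M * _.
set K1 := 12 * rho / t ^+ 2 * _; set K := coulomb u; rewrite (_ : lambda / 4 * K = lambda * K / 4); last by ring.
set K2 := lambda * K => PP B0 LK MC.
suff : 0 <= 2^-1 * (B + A) + K2 / 4 - (4^-1 * A + 4^-1 * (B + A + K1)).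
  by move=> h; apply: le_trans h _; rewrite lerD2l lerN2; apply: le_trans PP _; rewrite lerD2l.
by move: B0 LK; lra.
Qed.
End power.

End StrongCoupling.

(** * Cutting off and doubling *)

Section CutoffDoubling.
Variable R : realType.
Notation RR := (measurableTypeR R).
Notation mu := (@lebesgue_measure R).
Notation LL := (@leb3 R).
Notation meas f := (measurable_fun [set: RR * RR * RR] f).
Implicit Types (u v f g phi psi : R3 R -> R) (i j : 'I_3) (x y c : R3 R) (l t : R).
Notation integ f := (LL.-integrable setT (EFin \o (f : R3 R -> R))).
Notation P2 := (leb3s R \x leb3s R)%E.
Implicit Types (F K : R3 R * R3 R -> R) (z : R3 R * R3 R).
Notation integ2 F := (P2.-integrable setT (EFin \o (F : R3 R * R3 R -> R))).

Definition eta (t : R) : R := sstep (2 + t) * sstep (2 - t).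

Lemma eta_csmooth : csmooth eta.
Proof.
apply: csmoothM.
  rewrite (_ : (fun _ => _) = fun t : R => sstep (1 * t + 2)); first exact/csmooth_aff/sstep_csmooth.
  by apply/funext => t; rewrite mul1r addrC.
rewrite (_ : (fun _ => _) = fun t : R => sstep ((-1) * t + 2)); first exact/csmooth_aff/sstep_csmooth.
by apply/funext => t; rewrite mulN1r addrC.
Qed.

Lemma eta_bound t : 0 <= eta t <= 1.
Proof.
by rewrite /eta mulr_ge0 ?sstep_ge0//= mulr_ile1 ?sstep_ge0 ?sstep_le1.
Qed.
Lemma eta1 t : `|t| <= 1 -> eta t = 1.
Proof. by rewrite ler_norml => /andP[a b]; rewrite /eta !sstep1 ?mulr1//; lra. Qed.
Lemma eta0 t : 2 <= `|t| -> eta t = 0.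
Proof.
rewrite ler_normr => /orP[h|h]; rewrite /eta.
  by rewrite (@sstep0 _ (2 - t)) ?mulr0//; lra.
by rewrite sstep0 ?mul0r//; lra.
Qed.

Definition chi (n : nat) x : R := tens (fun _ t => eta (n.+1%:R^-1 * (t - 0))) x.

Lemma chi_test n : test_function (chi n).
Proof.
apply: (@tens_test _ _ (2 * n.+1%:R)) => j.
  rewrite (_ : (fun t => _) = fun t => eta (n.+1%:R^-1 * t + 0)); first exact/csmooth_aff/eta_csmooth.
  by apply/funext => t; rewrite subr0 addr0.
move=> t h; apply: eta0; rewrite subr0 normrM ger0_norm ?invr_ge0//.
by rewrite mulrC ler_pdivlMr// ltW.
Qed.

Lemma chi_bound n x : 0 <= chi n x <= 1.
Proof.
have K (a b e : R) : 0 <= a <= 1 -> 0 <= b <= 1 -> 0 <= e <= 1 -> 0 <= a * b * e <= 1.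
  move=> /andP[a0 a1] /andP[b0 b1] /andP[e0 e1]; apply/andP; split; first by rewrite !mulr_ge0.
  by apply: mulr_ile1 => //; [exact: mulr_ge0|exact: mulr_ile1].
by apply: K; exact: eta_bound.
Qed.

Lemma chi1 n x : cube3 n.+1%:R x -> chi n x = 1.
Proof.
move=> H; have K j : eta (n.+1%:R^-1 * (coord j x - 0)) = 1.
  apply: eta1; rewrite subr0 normrM ger0_norm ?invr_ge0//.
  by rewrite mulrC ler_pdivrMr// mul1r.
by rewrite /chi /tens !K !mulr1.
Qed.

Lemma chi_supp n : supp_in (2 * n.+1%:R) (chi n).
Proof.
by apply: tens_supp => j t h; apply: eta0; rewrite subr0 normrM ger0_norm ?invr_ge0// mulrC ler_pdivlMr// ltW.
Qed.

(** All the cutoffs are dilations of the first one. *)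
Lemma chi_partial : exists2 M : R, 0 <= M & forall n i x, `|partial i (chi n) x| <= M / n.+1%:R.
Proof.
have [deta _ dE] := csmooth_derive eta_csmooth.
pose k n : 'I_3 -> R -> R := fun _ t => eta (n.+1%:R^-1 * (t - 0)).
have kc n j : csmooth (k n j).
  rewrite (_ : k n j = fun t => eta (n.+1%:R^-1 * t + 0)); first exact/csmooth_aff/eta_csmooth.
  by apply/funext => t; rewrite /k subr0 addr0.
have P n i x : partial i (chi n) x = n.+1%:R^-1 * tens (upd (fun _ => eta) i deta) (n.+1%:R^-1 *: x).
  have -> : partial i (chi n) x = tens (upd (k n) i (fun t => deta (n.+1%:R^-1 * (t - 0)) * n.+1%:R^-1)) x.
    by apply: (tens_partial x (kc n)) => t; have := is_derive_comp_aff n.+1%:R^-1 0 t dE; exact.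
  by rewrite /tens /upd !coordZ; elim/I3_ind: i => /=; rewrite /k !subr0; ring.
have [M HM] := test_lipschitz (chi_test 0).
exists M; first by apply: le_trans (HM 0 0).
move=> n i x; rewrite P normrM ger0_norm ?invr_ge0// mulrC ler_pM2r ?invr_gt0//.
have := HM i (n.+1%:R^-1 *: x); rewrite P invr1 mul1r scale1r; exact.
Qed.

Lemma chi_near1 x : \forall n \near \oo, chi n x = 1.
Proof.
pose s := `|coord 0 x| + `|coord 1 x| + `|coord 2 x|.
have s0 : 0 <= s by rewrite !addr_ge0.
exists (Num.bound s) => // n /= Hn; apply: chi1 => j.
apply: le_trans (_ : s <= _).
  rewrite /s; move: (normr_ge0 (coord 0 x)) (normr_ge0 (coord 1 x)) (normr_ge0 (coord 2 x)).
  by elim/I3_ind: j; lra.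
by apply: le_trans (ltW (archi_boundP s0)) _; rewrite ler_nat leqW.
Qed.

Lemma chi_cvg x : chi n x @[n --> \oo] --> (1 : R).
Proof. by apply: cvg_near_cst; exact: chi_near1. Qed.

Lemma coulomb_le u v G : H1p u G -> meas v -> (forall x, `|v x| <= `|u x|) -> coulomb v <= coulomb u.
Proof.
move=> HG mv vu; rewrite !coulombE//; last exact: L2_meas (H1p_L2 HG).
have K z : coulomb_density v z <= coulomb_density u z.
  rewrite /coulomb_density; apply: ler_wpM2r; first by rewrite invr_ge0 norm3_ge0.
  have S x : v x ^+ 2 <= u x ^+ 2.
    by rewrite -(real_normK (num_real (v x))) -(real_normK (num_real (u x))) ler_pXn2r ?nnegrE.
  by apply: ler_pM => //; exact: sqr_ge0.
apply: le_Rintegral => //; [|exact: H1p_coulomb_integ HG].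
apply: integ2_le (H1p_coulomb_integ HG); first exact: coulomb_density_meas.
by move=> z; rewrite ger0_norm ?coulomb_density_ge0.
Qed.

Section cut.
Variables (p : R) (hp2 : 2 < p) (hp3 : p < 3).
Variables (u : R3 R -> R) (G : 'I_3 -> R3 R -> R) (HG : H1p u G).
Let un n x := chi n x * u x.
Let Gn n i x := chi n x * G i x + partial i (chi n) x * u x.

Lemma cutoff_H1p n : H1p (un n) (Gn n).
Proof. exact: H1p_mul (chi_test n) HG. Qed.

Lemma un_le n x : `|un n x| <= `|u x|.
Proof.
have /andP[c0 c1] := chi_bound n x.
by rewrite /un normrM (ger0_norm c0) ler_piMl.
Qed.

Lemma cutoff_sqr : \int[LL]_x (un n x ^+ 2) @[n --> \oo] --> \int[LL]_x (u x ^+ 2).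
Proof.
apply: (dominated_Rint _ _ _ (L2_sqr (H1p_L2 HG))).
- by move=> n; apply: measurable_funX; exact: L2_meas (H1p_L2 (cutoff_H1p n)).
- by apply: measurable_funX; exact: L2_meas (H1p_L2 HG).
- move=> x; rewrite -[u x]mul1r.
  have H : un n x @[n --> \oo] --> 1 * u x by apply: cvgM; [exact: chi_cvg|exact: cvg_cst].
  exact: (cvgM H H).
- by move=> n x; rewrite normrX -(real_normK (num_real (u x))) ler_pXn2r ?nnegrE ?un_le.
Qed.

Lemma cutoff_pow : \int[LL]_x (`|un n x| `^ p) @[n --> \oo] --> \int[LL]_x (`|u x| `^ p).
Proof.
have p0 : 0 < p by exact: lt_trans hp2.
apply: (dominated_Rint _ _ _ (powR_integ hp2 hp3 HG)).
- by move=> n; apply: powR_meas; exact: L2_meas (H1p_L2 (cutoff_H1p n)).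
- by apply: powR_meas; exact: L2_meas (H1p_L2 HG).
- move=> x; apply: cvg_near_cst; have := chi_near1 x.
  by apply: filterS => n E; rewrite /un E mul1r.
- move=> n x; rewrite ger0_norm ?powR_ge0//.
  by apply: ge0_ler_powR; rewrite ?nnegrE ?(ltW p0) ?un_le.
Qed.

Lemma cutoff_grad : \int[LL]_x gsq (Gn n) x @[n --> \oo] --> \int[LL]_x gsq G x.
Proof.
have [M M0 HM] := chi_partial.
have iD : integ (fun x => 2 * gsq G x + (6 * M ^+ 2) * u x ^+ 2).
  by apply: integD; apply: integZ; [exact: int_gsq HG|exact: L2_sqr (H1p_L2 HG)].
apply: (dominated_Rint _ _ _ iD).
- by move=> n; exact: integ_meas (int_gsq (cutoff_H1p n)).
- exact: integ_meas (int_gsq HG).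
- move=> x.
  have H i : Gn n i x @[n --> \oo] --> G i x.
    rewrite -(addr0 (G i x)); apply: cvgD.
      by apply: cvg_near_cst; have := chi_near1 x; apply: filterS => n ->; rewrite mul1r.
    rewrite -(mul0r (u x)); apply: cvgM; last exact: cvg_cst.
    apply/norm_cvg0P; apply: (@squeeze_cvgr _ _ _ _ (fun=> 0) (fun n => M * n.+1%:R^-1)).
    + by apply: nearW => n; rewrite normr_ge0 HM.
    + exact: cvg_cst.
    + rewrite -(mulr0 M); apply: cvgM; first exact: cvg_cst.
      exact: cvg_harmonic.
  by apply: cvgD; [apply: cvgD|]; exact: (cvgM (H _) (H _)).
- move=> n x; rewrite ger0_norm ?gsq_ge0//.
  have S i : Gn n i x ^+ 2 <= 2 * G i x ^+ 2 + 2 * (M ^+ 2 * u x ^+ 2).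
    set a := chi n x * G i x; set b := partial i (chi n) x * u x.
    have A : a ^+ 2 <= G i x ^+ 2.
      have /andP[c0 c1] := chi_bound n x.
      by rewrite /a exprMn ler_piMl ?sqr_ge0// expr_le1.
    have B : b ^+ 2 <= M ^+ 2 * u x ^+ 2.
      rewrite /b exprMn ler_wpM2r ?sqr_ge0// -(real_normK (num_real (partial _ _ _))) ler_pXn2r ?nnegrE//.
      by apply: le_trans (HM n i x) _; rewrite ler_pdivrMr// ler_peMr// ler1n.
    have K (r s : R) : (r + s) ^+ 2 <= 2 * r ^+ 2 + 2 * s ^+ 2.
      by have := sqr_ge0 (r - s); rewrite !sqrrD sqrrN; lra.
    by apply: le_trans (K a b) _; apply: lerD; rewrite ler_wpM2l.
  apply: le_trans (lerD (lerD (S 0) (S 1)) (S 2)) _.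
  by rewrite le_eqVlt; apply/orP; left; apply/eqP; rewrite /gsq; ring.
Qed.

(** All the terms converge, except possibly the Coulomb energy, for which it
    is enough that it does not increase. *)
Lemma cutoff (lambda : R) : 0 < lambda -> energy p lambda u G < 0 -> exists n, energy p lambda (un n) (Gn n) < 0.
Proof.
move=> l0 H.
pose Jn n := 2^-1 * (\int[LL]_x gsq (Gn n) x + \int[LL]_x (un n x ^+ 2)) + lambda / 4 * coulomb u - p^-1 * \int[LL]_x (`|un n x| `^ p).
have JC : Jn n @[n --> \oo] --> energy p lambda u G.
  apply: cvgB; [apply: cvgD; last exact: cvg_cst|].
    by apply: cvgM; [exact: cvg_cst|apply: cvgD; [exact: cutoff_grad|exact: cutoff_sqr]].
  by apply: cvgM; [exact: cvg_cst|exact: cutoff_pow].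
have [N _ HN] : \forall n \near \oo, Jn n < 0 by apply: (cvgr_lt _ JC).
exists N; apply: le_lt_trans (HN N (leqnn N)).
apply: lerB (lexx _); apply: lerD (lexx _) _; apply: ler_wpM2l; first by rewrite divr_ge0// ltW.
by apply: (coulomb_le HG); [exact: L2_meas (H1p_L2 (cutoff_H1p N))|exact: un_le].
Qed.
End cut.

Section doubling.
Variables (p : R) (hp2 : 2 < p) (hp3 : p < 3).

Lemma coulomb_tr u (t : R3 R) : meas u -> coulomb (fun x => u (x + t)) = coulomb u.
Proof.
move=> mu; rewrite /coulomb.
pose Phi y := (\int[LL]_x ((u x ^+ 2 * u y ^+ 2) / norm3 (x - y))%:E)%E.
have mPhi : measurable_fun setT (Phi : RR * RR * RR -> \bar R).
  have := @measurable_fun_fubini_tonelli_F _ _ (RR * RR * RR)%type (RR * RR * RR)%type R (leb3s R) (fun z => (coulomb_density u z)%:E).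
  apply; first by apply/measurable_EFinP; exact: coulomb_density_meas.
  by move=> z; rewrite lee_fin coulomb_density_ge0.
have Phi0 y : (0 <= Phi y)%E.
  apply: integral_ge0 => x _; rewrite lee_fin.
  by apply: divr_ge0; [apply: mulr_ge0; exact: sqr_ge0|exact: norm3_ge0].
apply: (congr1 (@fine R)); transitivity (\int[LL]_y Phi (y + t)%R)%E; last exact: ge0_integral_tr3.
apply: eq_integral => y _; rewrite /Phi.
pose h x := ((u x ^+ 2 * u (y + t) ^+ 2) / norm3 (x - (y + t)))%:E.
rewrite -[RHS](@ge0_integral_tr3 R t h).
- by apply: eq_integral => x _; rewrite /h; congr ((_ * _ / norm3 _)%:E); rewrite opprD addrACA subrr addr0.
- apply/measurable_EFinP; apply: measurable_funM.
    by apply: measurable_funM => //; exact: measurable_funX.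
  exact: (measurableT_comp (@measurable_inorm3 R) (@measurable_tr3 R (- (y + t)))).
- by move=> x; rewrite lee_fin; apply: divr_ge0; [apply: mulr_ge0; exact: sqr_ge0|exact: norm3_ge0].
Qed.

Lemma double_arith (m A B P Kv Kw q s a : R) : 0 <= m -> m * q <= a / 2 ->
  2^-1 * (B + A) + m * Kv - s * P <= - a -> Kw <= 2 * Kv + q ->
  2^-1 * (2 * B + 2 * A) + m * Kw - s * (2 * P) <= - (3 / 2 * a).
Proof.
move=> m0 mq H K; have := ler_wpM2l m0 K; rewrite !mulrDr !(mulrCA _ 2); lra.
Qed.

(** Add to [v] a translate by [h] whose support is disjoint. All the terms are
    doubled, except for the mutual Coulomb energy, at most
    [2 A^2 / (h - 2 d)] where [A] is the integral of [v^2]. It eats up at most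
    a quarter of the gain if [h] is large. *)
Lemma doubling (lambda a d : R) v (H : 'I_3 -> R3 R -> R) : 0 < lambda -> 0 < a -> 0 <= d ->
  H1p v H -> supp_in d v -> (forall i, supp_in d (H i)) -> energy p lambda v H <= - a ->
  exists d' v' H', [/\ 0 <= d', H1p v' H', supp_in d' v', (forall i, supp_in d' (H' i)) & energy p lambda v' H' <= - (3 / 2 * a)].
Proof.
move=> l0 a0 d0 HH sv sH HI.
set A := \int[LL]_x (v x ^+ 2).
have A0 : 0 <= A by apply: Rint_ge0 => x; exact: sqr_ge0.
pose k := lambda * A ^+ 2 / a + 1.
have k0 : 0 < k by rewrite /k ltr_wpDl// divr_ge0 ?(ltW a0)// mulr_ge0 ?sqr_ge0 ?(ltW l0).
pose h := 2 * d + k; pose e := h *: basis3 R 0.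
have h0 : 0 <= h by rewrite addr_ge0 ?mulr_ge0 ?(ltW k0).
have eE j : `|coord j e| <= h.
  by rewrite /e coordZ coord_basis normrM (ger0_norm h0) ler_piMr//; case: (_ == _); rewrite ?normr1 ?normr0.
have far x y : cube3 d x -> cube3 d (y + e) -> k <= norm3 (x - y).
  move=> /(_ 0) + /(_ 0); rewrite coordD /e coordZ coord_basis eqxx mulr1 !ler_norml => /andP[x1 x2] /andP[y1 y2].
  apply: le_trans (coord_le_norm3 0 (x - y)); rewrite coordD coordN ler_normr; apply/orP; left.
  by rewrite /h in y1 y2 *; lra.
have dis x : ~ cube3 d x \/ ~ cube3 d (x + e).
  have [xd|] := pselect (cube3 d x); last by left.
  right=> xe; have := far x x xd xe; rewrite subrr (_ : norm3 0 = 0) ?leNgt ?k0//.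
  by rewrite norm3E (_ : coord 0 0 = 0)// (_ : coord 1 0 = 0)// (_ : coord 2 0 = 0)// expr0n/= !addr0 sqrtr0.
have Hv := H1p_tr e HH; have HW := H1pD HH Hv.
set w := (fun x => v x + v (x + e)) in HW.
set W := (fun i x => H i x + H i (x + e)) in HW.
have tsupp f : supp_in d f -> supp_in (d + h) (fun x => f x + f (x + e)).
  move=> sf x xd; rewrite !sf ?addr0// => H'; apply: xd => j.
    have := H' j; rewrite coordD => H2.
    rewrite -(addrK (coord j e) (coord j x)); apply: le_trans (ler_normB _ _) _; exact: lerD.
  by apply: le_trans (H' j) _; rewrite lerDl.
have sq f x : supp_in d f -> (f x + f (x + e)) ^+ 2 = f x ^+ 2 + f (x + e) ^+ 2.
  by move=> sf; have [n|n] := dis x; rewrite (sf _ n); ring.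
exists (d + h), w, W; split => //; [by rewrite addr_ge0|exact: tsupp|by move=> i; exact: tsupp|].
have mv := L2_meas (H1p_L2 HH).
have iv := L2_sqr (H1p_L2 HH).
have EA : \int[LL]_x (w x ^+ 2) = 2 * A.
  rewrite (eq_Rint (g := fun x => v x ^+ 2 + v (x + e) ^+ 2)); last by move=> x; exact: sq.
  rewrite (RintD iv (integ_tr e iv)).
  by rewrite (Rintegral_tr3 e (integ_meas iv)) -/A; ring.
have EB : \int[LL]_x gsq W x = 2 * \int[LL]_x gsq H x.
  rewrite (eq_Rint (g := fun x => gsq H x + gsq H (x + e))); last first.
    by move=> x; rewrite /gsq /W !sq//; ring.
  rewrite RintD; [|exact: int_gsq HH|exact: (integ_tr e (int_gsq HH))].
  by rewrite (Rintegral_tr3 e (integ_meas (int_gsq HH))); ring.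
have p0 : p != 0 by rewrite gt_eqF// (lt_trans _ hp2).
have EP : \int[LL]_x (`|w x| `^ p) = 2 * \int[LL]_x (`|v x| `^ p).
  have ip := powR_integ hp2 hp3 HH.
  rewrite (eq_Rint (g := fun x => `|v x| `^ p + `|v (x + e)| `^ p)); last first.
    by move=> x; rewrite /w; have [n|n] := dis x; rewrite (sv _ n) ?add0r ?addr0 normr0 powR0// ?add0r ?addr0.
  rewrite (RintD ip (integ_tr e ip)).
  by rewrite (Rintegral_tr3 e (integ_meas ip)); ring.
have EK : coulomb w <= 2 * coulomb v + 2 * A ^+ 2 / k.
  pose ve x := v (x + e).
  have mve : meas ve by exact: L2_meas (H1p_L2 Hv).
  have ive : integ (fun x => ve x ^+ 2) by exact: (integ_tr e iv).
  have AE : \int[LL]_x (ve x ^+ 2) = A by exact: (Rintegral_tr3 e (integ_meas iv)).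
  have q0 f x : 0 <= f x ^+ 2 by exact: sqr_ge0.
  pose F1 z := v z.1 ^+ 2 * ve z.2 ^+ 2; pose F2 z := ve z.1 ^+ 2 * v z.2 ^+ 2.
  have T1 := tonelli_prod iv ive (q0 v) (q0 ve).
  have T2 := tonelli_prod ive iv (q0 ve) (q0 v).
  have i1 : integ2 F1.
    apply: integ2_ge0; [|by move=> z; exact: mulr_ge0|by rewrite T1 ltry].
    by apply: measurable_funM; [exact: (meas2_1 (integ_meas iv))|exact: (meas2_2 (integ_meas ive))].
  have i2 : integ2 F2.
    apply: integ2_ge0; [|by move=> z; exact: mulr_ge0|by rewrite T2 ltry].
    by apply: measurable_funM; [exact: (meas2_1 (integ_meas ive))|exact: (meas2_2 (integ_meas iv))].
  have i12 := integ2D i1 i2.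
  have ik : integ2 (fun z => k^-1 * (F1 z + F2 z)) by have := integrableZl measurableT k^-1 i12.
  have ic := H1p_coulomb_integ HH; have ice := H1p_coulomb_integ Hv.
  have icc := integ2D ic ice.
  have -> : 2 * coulomb v + 2 * A ^+ 2 / k = \int[P2]_z (coulomb_density v z + coulomb_density ve z + k^-1 * (F1 z + F2 z)).
    rewrite RintegralD// RintegralD// RintegralZl// RintegralD//.
    have R1 : \int[P2]_z F1 z = A * A by rewrite /Rintegral T1 /= AE.
    have R2 : \int[P2]_z F2 z = A * A by rewrite /Rintegral T2 /= AE.
    have KV : coulomb ve = coulomb v by exact: coulomb_tr.
    by rewrite R1 R2 -(coulombE mv) -(coulombE mve) KV; ring.
  rewrite coulombE; last exact: L2_meas (H1p_L2 HW).
  apply: le_Rintegral => //; [exact: H1p_coulomb_integ HW|exact: integ2D|].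
  move=> z _; rewrite /coulomb_density /w !sq// -/(ve z.1) -/(ve z.2).
  set r := (norm3 _)^-1; have r0 : 0 <= r by rewrite invr_ge0 norm3_ge0.
  have C1' : ve z.1 ^+ 2 * v z.2 ^+ 2 * r <= k^-1 * F2 z.
    have [n2|n2] := pselect (cube3 d z.2); last by rewrite /F2 (sv _ n2) expr0n/= !(mulr0, mul0r).
    have [n1|n1] := pselect (cube3 d (z.1 + e)); last by rewrite /F2 /ve (sv _ n1) expr0n/= !(mulr0, mul0r).
    rewrite mulrC; apply: ler_wpM2r; first exact: mulr_ge0.
    by rewrite lef_pV2 ?posrE ?(lt_le_trans k0)//; exact: far.
  have C2' : v z.1 ^+ 2 * ve z.2 ^+ 2 * r <= k^-1 * F1 z.
    have [n1|n1] := pselect (cube3 d z.1); last by rewrite /F1 (sv _ n1) expr0n/= !(mulr0, mul0r).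
    have [n2|n2] := pselect (cube3 d (z.2 + e)); last by rewrite /F1 /ve (sv _ n2) expr0n/= !(mulr0, mul0r).
    rewrite mulrC; apply: ler_wpM2r; first exact: mulr_ge0.
    have fk := far _ _ n1 n2; rewrite -norm3N opprB in fk.
    by rewrite lef_pV2 ?posrE ?(lt_le_trans k0).
  rewrite (mulrDr k^-1).
  have -> : (v z.2 ^+ 2 + ve z.2 ^+ 2) * (v z.1 ^+ 2 + ve z.1 ^+ 2) * r =
    v z.2 ^+ 2 * v z.1 ^+ 2 * r + ve z.2 ^+ 2 * ve z.1 ^+ 2 * r + (v z.1 ^+ 2 * ve z.2 ^+ 2 * r + ve z.1 ^+ 2 * v z.2 ^+ 2 * r) by ring.
  by rewrite lerD2l; exact: lerD.
have KA : lambda / 4 * (2 * A ^+ 2 / k) <= a / 2.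
  rewrite (_ : _ * _ = lambda * A ^+ 2 / k / 2); last by field; rewrite gt_eqF.
  rewrite ler_pM2r// ler_pdivrMr// /k mulrDr mulr1.
  by rewrite [a * _]mulrC divfK ?gt_eqF// lerDl ltW.
have l4 : 0 <= lambda / 4 by rewrite divr_ge0// ltW.
rewrite /energy EA EB EP; exact: (double_arith l4 KA HI EK).
Qed.

(** Cut off, then double over and over. *)
Lemma unbounded (lambda : R) u (G : 'I_3 -> R3 R -> R) (M : R) : 0 < lambda -> H1p u G -> energy p lambda u G < 0 ->
  exists v (H : 'I_3 -> R3 R -> R), H1p v H /\ energy p lambda v H <= - M.
Proof.
move=> l0 HG /(cutoff hp2 hp3 HG l0)[n Hn].
set v := (fun x => _) in Hn; set H := (fun i x => _) in Hn.
pose a := - energy p lambda v H; have a0 : 0 < a by rewrite oppr_gt0.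
have base : exists d v' H', [/\ 0 <= d, H1p v' H', supp_in d v', (forall i, supp_in d (H' i)) & energy p lambda v' H' <= - a].
  exists (2 * n.+1%:R), v, H; split; first by rewrite mulr_ge0.
  - exact: cutoff_H1p.
  - by move=> x xr; rewrite /v (chi_supp xr) mul0r.
  - by move=> i x xr; rewrite /H (chi_supp xr) (supp_in_partial i (@chi_supp n) xr) !mul0r addr0.
  - by rewrite opprK.
have step m : exists d v' H', [/\ 0 <= d, H1p v' H', supp_in d v', (forall i, supp_in d (H' i)) & energy p lambda v' H' <= - ((3 / 2) ^+ m * a)].
  elim: m => [|m [d [v' [H' [d0 HH sv sH HI]]]]]; first by rewrite expr0 mul1r.
  have a1 : 0 < (3 / 2) ^+ m * a by rewrite mulr_gt0// exprn_gt0.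
  have [d' [v2 [H2 [? ? ? ? HI2]]]] := doubling l0 a1 d0 HH sv sH HI.
  by exists d', v2, H2; split => //; rewrite exprS -mulrA.
have [m Hm] : exists m : nat, M <= (3 / 2) ^+ m * a.
  have bern (m : nat) : 1 + m%:R / 2 <= (3 / 2 : R) ^+ m.
    elim: m => [|m IH]; first by rewrite mul0r addr0 expr0.
    have m0 : 0 <= m%:R / 2 :> R by rewrite divr_ge0.
    rewrite exprS -natr1; apply: le_trans (_ : 3 / 2 * (1 + m%:R / 2) <= _); last by rewrite ler_pM2l.
    lra.
  exists (Num.bound (2 * `|M| / a)).
  rewrite -ler_pdivrMr//; apply: le_trans (bern _).
  have MA : 0 <= 2 * `|M| / a by rewrite divr_ge0 ?mulr_ge0 ?(ltW a0).
  have := archi_boundP MA; set N := _%:R; move=> HN.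
  have : M / a <= `|M| / a by rewrite ler_pM2r ?invr_gt0// ler_norm.
  move: HN; rewrite -mulrA; lra.
have [d [v' [H' [_ HH _ _ HI]]]] := step m.
by exists v', H'; split => //; apply: le_trans HI _; rewrite lerN2.
Qed.
End doubling.

End CutoffDoubling.

(** * The threshold *)

Section Threshold.
Variable R : realType.
Notation LL := (@leb3 R).
Implicit Types (u v f g phi psi : R3 R -> R) (i j : 'I_3) (x y c : R3 R) (l t s lambda : R).
Variables (p : R) (hp2 : 2 < p) (hp3 : p < 3).
Let p0 : 0 < p. Proof. exact: lt_trans hp2. Qed.

Lemma coulombZ s u G : H1p u G -> coulomb (fun x => s * u x) = s ^+ 4 * coulomb u.
Proof.
move=> HG; have ik := H1p_coulomb_integ HG.
rewrite (coulombE (L2_meas (H1p_L2 (H1pZ s HG)))) (coulombE (L2_meas (H1p_L2 HG))) -RintegralZl//.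
by apply: eq_Rintegral => z _; rewrite /coulomb_density !exprMn; ring.
Qed.

Lemma energyZ lambda s u G : 0 <= s -> H1p u G ->
  energy p lambda (fun x => s * u x) (fun i x => s * G i x) =
  s ^+ 2 * (2^-1 * (\int[LL]_x gsq G x + \int[LL]_x (u x ^+ 2))) + lambda / 4 * (s ^+ 4 * coulomb u)
  - p^-1 * (s `^ p * \int[LL]_x (`|u x| `^ p)).
Proof.
move=> s0 HG; rewrite /energy (coulombZ s HG).
have -> : \int[LL]_x gsq (fun i x => s * G i x) x = s ^+ 2 * \int[LL]_x gsq G x.
  by rewrite -(RintZ _ (int_gsq HG)); apply: eq_Rint => x; rewrite /gsq; ring.
have -> : \int[LL]_x ((s * u x) ^+ 2) = s ^+ 2 * \int[LL]_x (u x ^+ 2).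
  by rewrite -(RintZ _ (L2_sqr (H1p_L2 HG))); apply: eq_Rint => x; rewrite exprMn.
have -> : \int[LL]_x (`|s * u x| `^ p) = s `^ p * \int[LL]_x (`|u x| `^ p).
  rewrite -(RintZ _ (powR_integ hp2 hp3 HG)); apply: eq_Rint => x.
  by rewrite normrM (ger0_norm s0) powRM.
by rewrite [2^-1 * _](_ : _ = s ^+ 2 * (2^-1 * (\int[LL]_x gsq G x + \int[LL]_x (u x ^+ 2))))//; ring.
Qed.

(** As [p > 2], the functional without Coulomb term is negative at a large
    multiple of a bump. A small coupling does not change the sign. *)
Lemma energy_neg_ex : exists2 lambda, 0 < lambda & exists u G, H1p u G /\ energy p lambda u G < 0.
Proof.
pose u := @chi R 0; have HG := H1p_test (@chi_test R 0).
set G := (fun i => _) in HG.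
set E := 2^-1 * (\int[LL]_x gsq G x + \int[LL]_x (u x ^+ 2)).
set P := \int[LL]_x (`|u x| `^ p).
have P0 : 0 < P.
  apply: lt_le_trans (_ : \int[LL]_x (\1_(cube3 1) x) <= P).
    rewrite /Rintegral integral_indic ?setIT; [|exact: measurableT|exact: cube3_measurable].
    by rewrite cube3_vol//= expr1n mulr1.
  apply: Rint_le; [exact: integ_cube|exact: (powR_integ hp2 hp3 HG)|].
  move=> x; rewrite indicE; have [xc|xc] := pselect (cube3 1 x); last by rewrite memNset// powR_ge0.
  by rewrite mem_set// /u chi1 ?normr1 ?powR1.
have E0 : 0 <= E.
  by rewrite mulr_ge0// addr_ge0//; apply: Rint_ge0 => x; [exact: gsq_ge0|exact: sqr_ge0].
pose q := p * E / P + 1; have q0 : 0 < q by rewrite ltr_wpDl// divr_ge0 ?(ltW P0)// mulr_ge0 ?(ltW p0).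
pose s := q `^ (p - 2)^-1; have s0 : 0 < s by rewrite powR_gt0.
have sq : s `^ (p - 2) = q by rewrite /s -powRrM mulVf ?powRr1 ?(ltW q0)// gt_eqF// subr_gt0.
set K := coulomb u; have K0 : 0 <= K by exact: coulomb_ge0.
pose dl := s ^+ 2 * (P / p); have dl0 : 0 < dl by rewrite mulr_gt0 ?exprn_gt0 ?divr_gt0.
pose Q := s ^+ 4 * K / 4; have Q0 : 0 <= Q by rewrite divr_ge0// mulr_ge0 ?exprn_ge0 ?(ltW s0).
have Q1 : 0 < Q + 1 by rewrite ltr_wpDl.
exists (dl / (Q + 1)); first by rewrite divr_gt0.
exists (fun x => s * u x), (fun i x => s * G i x); split; first exact: H1pZ.
rewrite (energyZ _ (ltW s0) HG) -/E -/P -/K (powR_split2 p s0) sq.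
have -> : s ^+ 2 * E + dl / (Q + 1) / 4 * (s ^+ 4 * K) - p^-1 * (s ^+ 2 * q * P) = dl * (Q / (Q + 1)) - dl.
  have -> : dl / (Q + 1) / 4 * (s ^+ 4 * K) = dl * (Q / (Q + 1)) by rewrite [in RHS]/Q; ring.
  have -> : p^-1 * (s ^+ 2 * q * P) = s ^+ 2 * E + dl by rewrite /dl /q; field; rewrite !gt_eqF.
  by ring.
rewrite subr_lt0 -[ltRHS]mulr1 ltr_pM2l// ltr_pdivrMr// mul1r.
by rewrite ltrDl.
Qed.

(** The supremum of the couplings at which the functional takes a negative
    value. These couplings are bounded by [energy_ge0_large], and form an
    interval, as the functional increases with the coupling. At the supremum
    itself the functional is nonnegative because it depends continuously on
    the coupling: a negative value would persist slightly above. *)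
Lemma threshold : exists2 lambda0, 0 < lambda0 &
  (forall lambda u G, lambda0 <= lambda -> H1p u G -> 0 <= energy p lambda u G) /\
  (forall lambda, 0 < lambda -> lambda < lambda0 -> exists u G, H1p u G /\ energy p lambda u G < 0).
Proof.
pose S := [set lambda : R | 0 < lambda /\ exists u G, H1p u G /\ energy p lambda u G < 0].
have [l1 l10 Sl1] := energy_neg_ex.
have S1 : S l1 by [].
have [L L0 HL] := energy_ge0_large hp2 hp3.
have Sub : has_ubound S.
  exists L => l [l0 [u [G [HG neg]]]]; rewrite leNgt; apply/negP => /ltW /(HL _ _ _ HG).
  by rewrite leNgt neg.
exists (sup S); first by apply: lt_le_trans l10 _; exact: ub_le_sup.
split => [l u G lS HG|l l0 lS].
  rewrite leNgt; apply/negP => neg.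
  have K0 := coulomb_ge0 u.
  have l0 : 0 < l by apply: lt_le_trans l10 (le_trans _ lS); exact: ub_le_sup.
  pose e := - energy p l u G / (coulomb u + 1).
  have K1 : 0 < coulomb u + 1 by rewrite ltr_wpDl.
  have e0 : 0 < e by rewrite divr_gt0// oppr_gt0.
  have Se : S (l + e).
    split; first exact: addr_gt0.
    exists u, G; split => //.
    have -> : energy p (l + e) u G = energy p l u G + e * coulomb u / 4 by rewrite /energy; ring.
    have : e * coulomb u / 4 < - energy p l u G.
      rewrite ltr_pdivrMr// /e mulrAC ltr_pdivrMr// -mulrA ltr_pM2l ?oppr_gt0//.
      by move: K0; lra.
    by lra.
  have := ub_le_sup Sub Se; apply/negP; rewrite -ltNge.
  by apply: le_lt_trans lS _; rewrite ltrDl.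
have [l' [l'0 [u [G [HG neg]]]] ll'] := sup_gt (ex_intro _ _ S1) lS.
exists u, G; split => //; apply: le_lt_trans neg.
rewrite /energy; apply: lerB (lexx _); apply: lerD (lexx _) _.
by apply: ler_wpM2r; [exact: coulomb_ge0|rewrite ler_pM2r// ltW].
Qed.
End Threshold.

Theorem theorem1p6 (R : realType) (p : R) (hp2 : 2 < p) (hp3 : p < 3) :
  exists2 lambda0 : R, 0 < lambda0 &
    (forall lambda : R, lambda0 <= lambda ->
       ereal_inf [set (I_functional p lambda u)%:E | u in H1_R3 R] = 0%E) /\
    (forall lambda : R, 0 < lambda -> lambda < lambda0 ->
       ereal_inf [set (I_functional p lambda u)%:E | u in H1_R3 R] = -oo%E).
Proof.
have [l0 l00 [Hpos Hneg]] := threshold hp2 hp3.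
exists l0 => //; split => [l ll|l lp ll].
  apply/eqP; rewrite eq_le; apply/andP; split.
    have HG := H1p_test (@chi_test R 0); have HZ := H1pZ 0 HG.
    apply: ereal_inf_lbound; exists (fun x => 0 * chi 0 x).
      by apply/H1pP; exists (fun i x => 0 * partial i (chi 0) x).
    rewrite (I_functionalE _ _ HZ) (energyZ hp2 hp3 _ (lexx 0) HG).
    have p0 : p != 0 by rewrite gt_eqF// (lt_trans _ hp2).
    by rewrite powR0// !expr0n/= !mul0r !mulr0 addr0 subr0.
  apply/ereal_infP => _ [u /H1pP[G HG] <-].
  by rewrite lee_fin (I_functionalE _ _ HG); exact: Hpos.
have Ny (e : \bar R) : (forall A : R, (e <= A%:E)%E) -> e = -oo%E.
  case: e => [r||]// H; last by have := H 0; rewrite leye_eq.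
  by have := H (r - 1); rewrite lee_fin => ?; exfalso; lra.
apply: Ny => A.
have [u [G [HG neg]]] := Hneg l lp ll.
have [v [H [HH vA]]] := unbounded hp2 hp3 (- A) lp HG neg.
apply: le_trans (_ : _ <= (I_functional p l v)%:E)%E _.
  by apply: ereal_inf_lbound; exists v => //; apply/H1pP; exists H.
by rewrite lee_fin (I_functionalE _ _ HH) -[leRHS]opprK.
Qed.
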